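(* Let $N\ge 3$, let $\varepsilon_1,\varepsilon_2,c\in\mathbb{C}$, put $\hbar=\varepsilon_1+\varepsilon_2$, and assume $\hbar c=N\varepsilon_2$ and $\varepsilon_2\neq 0$. Let $\mathrm{ev}\colon Y(\hat{\mathfrak{sl}}_N)\to U(\hat{\mathfrak{gl}}_N)_{\mathrm{comp},-}$ be the evaluation map of the affine Yangian (see context). For $m\ge 1$ let $R_m\in U(\hat{\mathfrak{sl}}_N)\subset Y(\hat{\mathfrak{sl}}_N)$ be $$\begin{aligned}R_m={}&(-1)^{m-1}\sum_{i=0}^{N-1}x_i^+\,T_{w(i,m)}(x_{i-1}^+)+\sum_{p=1}^{m-1}\sum_{1\le i\le j\le N-1}h_i(p)h_j(m-p)\\&-\sum_{p=-m+2}^{m-1}\Big(E_{1,N}(p-1)E_{N,1}(m-p+1)+\sum_{i=0}^{N-2}E_{i+2,i+1}(p)E_{i+1,i+2}(m-p)\Big)\\&+\sum_{p=-m+2}^{0}\Big(E_{1,N-1}(p-1)E_{N-1,1}(m-p+1)+E_{2,N}(p-1)E_{N,2}(m-p+1)+\sum_{i=0}^{N-3}E_{i+3,i+1}(p)E_{i+1,i+3}(m-p)\Big),\end{aligned}$$ and for $m\in\mathbb{Z}$ define $a_m\in Y(\hat{\mathfrak{sl}}_N)$ by $$a_m=\frac{1}{\varepsilon_2}\times\begin{cases}(-1)^{m-1}\sum_{i=0}^{N-1}\big[x_i^+,T_{w(i,m)}(x_{i-1,1}^+)\big]-\hbar R_m & \text{if } m>0,\\[1mm] \sum_{i=0}^{N-1}\tilde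 h_{i,1}-c-\frac{\hbar}{2}c^2 & \text{if } m=0,\\[1mm] (-1)^{m-1}\sum_{i=0}^{N-1}\big[T_{w(i,-m)}(x_{i-1,1}^-),x_i^-\big]-\hbar\,\omega(R_{-m}) & \text{if } m<0.\end{cases}$$ Then $\mathrm{ev}(a_m)=\mathbf{1}(m)$ for all $m\in\mathbb{Z}$. In particular, the image of $\mathrm{ev}$ contains $U(\hat{\mathfrak{gl}}_N)$.
   Context: Affine Yangian. Fix $N\ge3$. $Y(\hat{\mathfrak{sl}}_N)$ is the $\mathbb{C}$-algebra generated by $x_{i,r}^{+},x_{i,r}^-,h_{i,r}$ ($i\in\mathbb{Z}/N\mathbb{Z}$, $r\in\mathbb{Z}_{\ge0}$) with parameters $\varepsilon_1,\varepsilon_2\in\mathbb{C}$ and relations $[h_{i,r},h_{j,s}]=0$, $[x_{i,r}^+,x_{j,s}^-]=\delta_{ij}h_{i,r+s}$, $[h_{i,0},x_{j,r}^\pm]=\pm a_{ij}x_{j,r}^\pm$, $[h_{i,r+1},x_{j,s}^\pm]-[h_{i,r},x_{j,s+1}^\pm]=\pm a_{ij}\frac{\varepsilon_1+\varepsilon_2}{2}\{h_{i,r},x_{j,s}^\pm\}-m_{ij}\frac{\varepsilon_1-\varepsilon_2}{2}[h_{i,r},x_{j,s}^\pm]$, $[x_{i,r+1}^\pm,x_{j,s}^\pm]-[x_{i,r}^\pm,x_{j,s+1}^\pm]=\pm a_{ij}\frac{\varepsilon_1+\varepsilon_2}{2}\{x_{i,r}^\pm,x_{j,s}^\pm\}-m_{ij}\frac{\varepsilon_1-\varepsilon_2}{2}[x_{i,r}^\pm,x_{j,s}^\pm]$,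 $\sum_{w\in\mathfrak{S}_{1-a_{ij}}}[x_{i,r_{w(1)}}^\pm,[x_{i,r_{w(2)}}^\pm,\dots,[x_{i,r_{w(1-a_{ij})}}^\pm,x_{j,s}^\pm]\dots]]=0$ for $i\ne j$. Here $\{x,y\}=xy+yx$; $a_{ij}=2$ if $i=j$, $-1$ if $i=j\pm1$, $0$ otherwise; $m_{ij}=1$ if $j=i-1$, $-1$ if $j=i+1$, $0$ otherwise. Put $\hbar=\varepsilon_1+\varepsilon_2$, $x_i^\pm=x_{i,0}^\pm$, $h_i=h_{i,0}$, $\tilde h_{i,1}=h_{i,1}-\frac{\hbar}{2}h_i^2$. $\omega$ is the algebra anti-automorphism of $Y(\hat{\mathfrak{sl}}_N)$ with $x_{i,r}^\pm\mapsto x_{i,r}^\mp$, $h_{i,r}\mapsto h_{i,r}$. Affine Lie algebra. $\hat{\mathfrak{gl}}_N=\mathfrak{gl}_N\otimes\mathbb{C}[t,t^{-1}]\oplus\mathbb{C}c$ with $[X(r),Y(s)]=[X,Y](r+s)+r\delta_{r+s,0}\mathrm{tr}(XY)c$, $c$ central, $X(s)=X\otimes t^s$, $X=X(0)$; $\hat{\mathfrak{sl}}_N=\mathfrak{sl}_N\otimes\mathbb{C}[t,t^{-1}]\oplus\mathbb{C}c$. $E_{i,j}$ are matrix units with indices read modulo $N$, and $\mathbf 1=\sum_{i=1}^N E_{i,i}$. Chevalley generators: $x_0^+=E_{N,1}(1)$, $x_0^-=E_{1,N}(-1)$, $h_0=E_{N,N}-E_{1,1}+c$, and for $i\neq0$: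 $x_i^+=E_{i,i+1}$, $x_i^-=E_{i+1,i}$, $h_i=E_{i,i}-E_{i+1,i+1}$; $h_i(p)=h_i\otimes t^p$ for $1\le i\le N-1$. The subalgebra of $Y(\hat{\mathfrak{sl}}_N)$ generated by the $x_i^\pm,h_i$ is identified with $U(\hat{\mathfrak{sl}}_N)$ in this way. The central element $c$ is regarded as a complex number, i.e. $U(\hat{\mathfrak{gl}}_N)$ is taken with the central element specialized to the scalar $c$. Operators $T_w$. $T_i=\exp\mathrm{ad}\,x_i^+\,\exp\mathrm{ad}(-x_i^-)\,\exp\mathrm{ad}\,x_i^+$ ($i\in\mathbb{Z}/N\mathbb{Z}$), an algebra automorphism of $Y(\hat{\mathfrak{sl}}_N)$; these satisfy the braid relations, so for $w$ in the affine Weyl group $\hat W=\langle s_i\mid i\in\mathbb{Z}/N\mathbb{Z}\rangle$ with reduced expression $w=s_{i_1}\cdots s_{i_l}$ one puts $T_w=T_{i_1}\cdots T_{i_l}$. Let $\alpha_i$ be the simple roots, $\delta=\sum_{i=0}^{N-1}\alpha_i$, $Q=\bigoplus_{i=1}^{N-1}\mathbb{Z}\alpha_i$; $t_\alpha\in\hat W$ is the translation with $t_\alpha(\lambda)=\lambda-(\alpha,\lambda)\delta$ for $\lambda\in Q$ (so $t_{\alpha_0}=t_{-\theta}$ with $\theta=\sum_{i=1}^{N-1}\alpha_i$). For $m\ge1$, $i\in\mathbb{Z}/N\mathbb{Z}$: $w(i,m)=t_{-\alpha_{i+1}}^{m-1}s_{i+1}s_{i+2}\cdots s_{i-3}s_{i-2}$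 (indices modulo $N$, increasing cyclically from $i+1$ to $i-2$). Completion and evaluation map. Grade $U(\hat{\mathfrak{gl}}_N)=\bigoplus_d U[d]$ by $\deg X(s)=s$, $\deg c=0$, and let $U(\hat{\mathfrak{gl}}_N)_{\mathrm{comp},-}=\bigoplus_{d\in\mathbb{Z}}\varprojlim_n U[d]/\sum_{r>n}U[d+r]U[-r]$. Assuming $\hbar c=N\varepsilon_2$, it is known that there is a unique algebra homomorphism $\mathrm{ev}\colon Y(\hat{\mathfrak{sl}}_N)\to U(\hat{\mathfrak{gl}}_N)_{\mathrm{comp},-}$ with $\mathrm{ev}(x_i^\pm)=x_i^\pm$, $\mathrm{ev}(h_i)=h_i$, $\mathrm{ev}(x_{0,1}^+)=(1+N\varepsilon_2)x_0^++\hbar\sum_{s\ge0}\sum_{k=1}^N E_{k,1}(s+1)E_{N,k}(-s)$, $\mathrm{ev}(x_{0,1}^-)=(1+N\varepsilon_2)x_0^-+\hbar\sum_{s\ge0}\sum_{k=1}^N E_{k,N}(s)E_{1,k}(-s-1)$, and for $1\le i\le N-1$ $\mathrm{ev}(x_{i,1}^+)=(1+i\varepsilon_2)x_i^++\hbar\sum_{s\ge0}\big(\sum_{k=1}^iE_{k,i+1}(s)E_{i,k}(-s)+\sum_{k=i+1}^NE_{k,i+1}(s+1)E_{i,k}(-s-1)\big)$, $\mathrm{ev}(x_{i,1}^-)=(1+i\varepsilon_2)x_i^-+\hbar\sum_{s\ge0}\big(\sum_{k=1}^iE_{k,i}(s)E_{i+1,k}(-s)+\sum_{k=i+1}^NE_{k,i}(s+1)E_{i+1,k}(-s-1)\big)$.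 *)

(* Defs.v *)
From HB Require Import structures.
From mathcomp Require Import all_boot all_order all_algebra.
From mathcomp Require Import perm generic_quotient.
From mathcomp Require Import boolp classical_sets fsbigop functions cardinality.
From mathcomp Require Import reals complex.
From mathcomp Require Import monalg finmap zify.

Set Implicit Arguments.
Unset Strict Implicit.
Unset Printing Implicit Defensive.

Import Order.TTheory GRing.Theory Num.Theory.
Local Open Scope classical_set_scope.
Local Open Scope ring_scope.

(* [algType] requires [1 != 0], which is not available a priori for an algebra
   given by generators and relations; the algebras below are types carrying both
   a [pzRingType] and an [lmodType] structure. *)
Notation algebra_morphism f := (linear f /\ monoid_morphism f).
Notation algebra_antimorphism f :=
  [/\ linear f, f 1 = 1 & forall x y, f (x * y) = f y * f x].

Definition commr (A : pzRingType) (x y : A) := x * y - y * x.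
Definition acommr (A : pzRingType) (x y : A) := x * y + y * x.

(* Free associative algebra K<X>. *)
Notation free_alg K X := {malg K[{fmonom X}]}.

Definition fgen (K : nzRingType) (X : choiceType) (x : X) : free_alg K X :=
  << fmu x >>.

Lemma malg_scaleU (K : nzRingType) (M : choiceType) (a b : K) (m : M) :
  a *: (<< b *g m >> : {malg K[M]}) = << a * b *g m >>.
Proof.
apply/(proj1 (malgP _ _)) => k.
by rewrite mcoeffZ !mcoeffU mulrnAr.
Qed.

Lemma malg_scalerAr (K : comNzRingType) (M : monomType) (a : K)
  (x y : {malg K[M]}) : a *: (x * y) = x * (a *: y).
Proof.
have le := msuppZ_le a y.
rewrite [in RHS](malgMEw (fsubset_refl _) le) malgME scaler_sumr.
apply: eq_bigr => i _; rewrite scaler_sumr; apply: eq_bigr => j _.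
by rewrite malg_scaleU mcoeffZ mulrCA.
Qed.

Section FreeLift.
Context (K : comNzRingType) (X : choiceType) (A : pzRingType).
Variables (phi : {rmorphism K -> A}) (f : X -> A).
Hypothesis phiC : forall a x, phi a * x = x * phi a.

Definition free_lift (g : free_alg K X) : A :=
  \sum_(m <- msupp g) phi g@_m * \prod_(x <- (m : seq X)) f x.

Lemma free_liftEw (D : {fset {fmonom X}}) g : (msupp g `<=` D)%fset ->
  free_lift g = \sum_(m <- D) phi g@_m * \prod_(x <- (m : seq X)) f x.
Proof.
move=> le; rewrite /free_lift (big_fset_incl _ le) //= => m _ /mcoeff_outdom ->.
by rewrite rmorph0 mul0r.
Qed.

Lemma free_liftD g h : free_lift (g + h) = free_lift g + free_lift h.
Proof.
pose D := (msupp g `|` msupp h)%fset.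
rewrite (@free_liftEw D) ?msuppD_le // (@free_liftEw D g) ?fsubsetUl //.
rewrite (@free_liftEw D h) ?fsubsetUr // -big_split.
by apply: eq_bigr => m _; rewrite mcoeffD rmorphD mulrDl.
Qed.

Lemma free_liftZ a g : free_lift (a *: g) = phi a * free_lift g.
Proof.
rewrite (@free_liftEw (msupp g)) ?msuppZ_le // /free_lift mulr_sumr.
by apply: eq_bigr => m _; rewrite mcoeffZ rmorphM mulrA.
Qed.

Lemma free_liftU a (m : {fmonom X}) :
  free_lift << a *g m >> = phi a * \prod_(x <- (m : seq X)) f x.
Proof.
by rewrite (@free_liftEw [fset m]%fset) ?msuppU_le // big_seq_fset1 mcoeffUU.
Qed.

Lemma free_lift0 : free_lift 0 = 0.
Proof. by rewrite /free_lift msupp0 big_seq_fset0. Qed.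

Lemma free_lift1 : free_lift 1 = 1.
Proof.
have <- : @fgone {fmonom X} K = 1 by [].
rewrite /fgone free_liftU rmorph1 mul1r.
by rewrite fm1 big_nil.
Qed.

Lemma free_liftM g h : free_lift (g * h) = free_lift g * free_lift h.
Proof.
rewrite malgME (big_morph free_lift free_liftD free_lift0) mulr_suml.
apply: eq_bigr => m _.
rewrite (big_morph free_lift free_liftD free_lift0) mulr_sumr.
apply: eq_bigr => n _; rewrite free_liftU rmorphM fmM big_cat /= -!mulrA.
by congr (_ * _); rewrite !mulrA phiC.
Qed.

Lemma free_liftB g h : free_lift (g - h) = free_lift g - free_lift h.
Proof. by rewrite free_liftD -scaleN1r free_liftZ rmorphN1 mulN1r. Qed.

Lemma free_lift_commr g h :
  free_lift (commr g h) = commr (free_lift g) (free_lift h).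
Proof.
apply: (etrans (free_liftB (g * h) (h * g))).
exact: (f_equal2 (fun a b : A => a - b) (free_liftM g h) (free_liftM h g)).
Qed.

Lemma free_lift_gen x : free_lift (fgen K x) = f x.
Proof. by rewrite free_liftU rmorph1 mul1r fmU big_seq1. Qed.

End FreeLift.

Section Presented.
Context (K : comNzRingType) (X : choiceType).
Variable rels : free_alg K X -> free_alg K X -> Prop.

Inductive rel_ideal : free_alg K X -> Prop :=
| rel_ideal0 : rel_ideal 0
| rel_idealD x y : rel_ideal x -> rel_ideal y -> rel_ideal (x + y)
| rel_idealM a l r b : rels l r -> rel_ideal (a * (l - r) * b).

Lemma rel_idealMl a x : rel_ideal x -> rel_ideal (a * x).
Proof.
elim=> [|y z _ hy _ hz|b l r d lr]; first by rewrite mulr0; exact: rel_ideal0.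
  by rewrite mulrDr; exact: rel_idealD.
by rewrite !mulrA; exact: rel_idealM.
Qed.

Lemma rel_idealMr x a : rel_ideal x -> rel_ideal (x * a).
Proof.
elim=> [|y z _ hy _ hz|b l r d lr]; first by rewrite mul0r; exact: rel_ideal0.
  by rewrite mulrDl; exact: rel_idealD.
by rewrite -mulrA; exact: rel_idealM.
Qed.

Lemma rel_idealN x : rel_ideal x -> rel_ideal (- x).
Proof. by move=> hx; rewrite -mulN1r; exact: rel_idealMl. Qed.

Lemma rel_idealB x y : rel_ideal x -> rel_ideal y -> rel_ideal (x - y).
Proof. by move=> hx /rel_idealN; exact: rel_idealD. Qed.

Lemma rel_idealZ a x : rel_ideal x -> rel_ideal (a *: x).
Proof. by move=> hx; rewrite -mul_malgC; exact: rel_idealMl. Qed.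

Definition rel_eqv : rel (free_alg K X) := fun x y => `[< rel_ideal (x - y) >].

Lemma rel_eqv_refl : reflexive rel_eqv.
Proof. by move=> x; apply/asboolP; rewrite subrr; exact: rel_ideal0. Qed.

Lemma rel_eqv_sym : symmetric rel_eqv.
Proof.
by move=> x y; apply/asboolP/asboolP => /rel_idealN; rewrite opprB.
Qed.

Lemma rel_eqv_trans : transitive rel_eqv.
Proof.
move=> y x z /asboolP xy /asboolP yz; apply/asboolP.
by have := rel_idealD xy yz; rewrite addrA subrK.
Qed.

Canonical rel_eqv_equiv := EquivRel rel_eqv rel_eqv_refl rel_eqv_sym
  rel_eqv_trans.

(* The associative algebra generated by X subject to the relations [l = r],
   [rels l r]. *)
Definition presented := {eq_quot rel_eqv}%qT.
HB.instance Definition _ := Choice.on presented.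
HB.instance Definition _ : EqQuotient _ rel_eqv presented :=
  EqQuotient.on presented.

Local Notation pi := (\pi_(presented))%qT.

Lemma presW (P : presented -> Type) : (forall x, P (pi x)) -> forall x, P x.
Proof. by move=> h x; rewrite -[x]reprK; exact: h. Qed.

Lemma pi_eq x y : (pi x = pi y) <-> rel_ideal (x - y).
Proof. by split => [/eqmodP/asboolP|h]; [|apply/eqmodP/asboolP]. Qed.

Lemma pi_rel l r : rels l r -> pi l = pi r.
Proof.
move=> lr; apply/pi_eq; rewrite -[l - r]mulr1 -[l - r]mul1r.
exact: rel_idealM.
Qed.

Lemma repr_pi x : rel_ideal (repr (pi x) - x).
Proof. by apply/pi_eq; rewrite reprK. Qed.

Definition pr_add (x y : presented) := pi (repr x + repr y).
Definition pr_opp (x : presented) := pi (- repr x).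
Definition pr_mul (x y : presented) := pi (repr x * repr y).
Definition pr_scale (a : K) (x : presented) := pi (a *: repr x).

Lemma pr_addE x y : pr_add (pi x) (pi y) = pi (x + y).
Proof.
apply/pi_eq; rewrite opprD addrACA.
exact: rel_idealD (repr_pi x) (repr_pi y).
Qed.

Lemma pr_oppE x : pr_opp (pi x) = pi (- x).
Proof. by apply/pi_eq; rewrite -opprD; apply: rel_idealN; exact: repr_pi. Qed.

Lemma pr_mulE x y : pr_mul (pi x) (pi y) = pi (x * y).
Proof.
apply/pi_eq.
have -> : repr (pi x) * repr (pi y) - x * y =
    (repr (pi x) - x) * repr (pi y) + x * (repr (pi y) - y).
  by rewrite mulrBl mulrBr addrA subrK.
by apply: rel_idealD; [apply: rel_idealMr|apply: rel_idealMl]; exact: repr_pi.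
Qed.

Lemma pr_scaleE a x : pr_scale a (pi x) = pi (a *: x).
Proof.
by apply/pi_eq; rewrite -scalerBr; apply: rel_idealZ; exact: repr_pi.
Qed.

Let prE := (pr_addE, pr_oppE, pr_mulE, pr_scaleE).

Lemma pr_addA : associative pr_add.
Proof. by elim/presW=> x; elim/presW=> y; elim/presW=> z; rewrite !prE addrA. Qed.
Lemma pr_addC : commutative pr_add.
Proof. by elim/presW=> x; elim/presW=> y; rewrite !prE addrC. Qed.
Lemma pr_add0 : left_id (pi 0) pr_add.
Proof. by elim/presW=> x; rewrite !prE add0r. Qed.
Lemma pr_addN : left_inverse (pi 0) pr_opp pr_add.
Proof. by elim/presW=> x; rewrite !prE addNr. Qed.

HB.instance Definition _ :=
  GRing.isZmodule.Build presented pr_addA pr_addC pr_add0 pr_addN.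

Lemma piD x y : pi (x + y) = pi x + pi y. Proof. by rewrite -pr_addE. Qed.

Lemma pr_mulA : associative pr_mul.
Proof. by elim/presW=> x; elim/presW=> y; elim/presW=> z; rewrite !prE mulrA. Qed.
Lemma pr_mul1l : left_id (pi 1) pr_mul.
Proof. by elim/presW=> x; rewrite !prE mul1r. Qed.
Lemma pr_mul1r : right_id (pi 1) pr_mul.
Proof. by elim/presW=> x; rewrite !prE mulr1. Qed.
Lemma pr_mulDl : left_distributive pr_mul +%R.
Proof.
by elim/presW=> x; elim/presW=> y; elim/presW=> z; rewrite -piD !prE mulrDl piD.
Qed.
Lemma pr_mulDr : right_distributive pr_mul +%R.
Proof.
by elim/presW=> x; elim/presW=> y; elim/presW=> z; rewrite -piD !prE mulrDr piD.
Qed.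

HB.instance Definition _ := GRing.Zmodule_isPzRing.Build presented
  pr_mulA pr_mul1l pr_mul1r pr_mulDl pr_mulDr.

Lemma pr_scaleA a b v : pr_scale a (pr_scale b v) = pr_scale (a * b) v.
Proof. by elim/presW: v => v; rewrite !prE scalerA. Qed.
Lemma pr_scale1 : left_id 1 pr_scale.
Proof. by elim/presW=> x; rewrite !prE scale1r. Qed.
Lemma pr_scaleDr : right_distributive pr_scale +%R.
Proof. by move=> a; elim/presW=> x; elim/presW=> y; rewrite -piD !prE scalerDr piD. Qed.
Lemma pr_scaleDl v : {morph pr_scale^~ v : a b / a + b}.
Proof. by move=> a b; elim/presW: v => v; rewrite !prE scalerDl piD. Qed.

HB.instance Definition _ := GRing.Zmodule_isLmodule.Build K presented
  pr_scaleA pr_scale1 pr_scaleDr pr_scaleDl.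

Lemma piM x y : pi (x * y) = pi x * pi y. Proof. by rewrite -pr_mulE. Qed.
Lemma piZ a x : pi (a *: x) = a *: pi x. Proof. by rewrite -pr_scaleE. Qed.
Lemma piN x : pi (- x) = - pi x. Proof. by rewrite -pr_oppE. Qed.

Lemma pr_scalerAl (a : K) (x y : presented) : a *: (x * y) = (a *: x) * y.
Proof. by elim/presW: x => x; elim/presW: y => y; rewrite -piM -!piZ -piM scalerAl. Qed.
Lemma pr_scalerAr (a : K) (x y : presented) : a *: (x * y) = x * (a *: y).
Proof. by elim/presW: x => x; elim/presW: y => y; rewrite -piM -!piZ -piM malg_scalerAr. Qed.

Definition gen (x : X) : presented := pi (fgen K x).

Section PresentedLift.
Context (A : pzRingType).
Variables (phi : {rmorphism K -> A}) (f : X -> A).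
Hypothesis phiC : forall a x, phi a * x = x * phi a.
Hypothesis f_rels : forall l r, rels l r ->
  free_lift phi f l = free_lift phi f r.

Definition pr_lift (x : presented) : A := free_lift phi f (repr x).

Lemma pr_lift_pi x : pr_lift (pi x) = free_lift phi f x.
Proof.
suff I0 y : rel_ideal y -> free_lift phi f y = 0.
  by apply/eqP; rewrite -subr_eq0 -free_liftB I0 //; exact: repr_pi.
elim=> [|u v _ hu _ hv|a l r b /f_rels lr]; first exact: free_lift0.
  by rewrite free_liftD hu hv addr0.
by rewrite !free_liftM // free_liftB lr subrr mulr0 mul0r.
Qed.

Lemma pr_liftD x y : pr_lift (x + y) = pr_lift x + pr_lift y.
Proof.
by elim/presW: x => x; elim/presW: y => y; rewrite -piD !pr_lift_pi free_liftD.
Qed.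

Lemma pr_liftZ a x : pr_lift (a *: x) = phi a * pr_lift x.
Proof. by elim/presW: x => x; rewrite -piZ !pr_lift_pi free_liftZ. Qed.

Lemma pr_liftM x y : pr_lift (x * y) = pr_lift x * pr_lift y.
Proof.
by elim/presW: x => x; elim/presW: y => y; rewrite -piM !pr_lift_pi free_liftM.
Qed.

Lemma pr_lift1 : pr_lift 1 = 1.
Proof. by rewrite pr_lift_pi free_lift1. Qed.

Lemma pr_lift_gen x : pr_lift (gen x) = f x.
Proof. by rewrite pr_lift_pi free_lift_gen. Qed.

End PresentedLift.

End Presented.

Section Affine.
Context (K : fieldType) (N : nat).
Local Notation mat := 'M[K]_((Zp_trunc N).+2).

(* Matrix unit E_{i,j}, with indices read modulo N. *)
Definition Emx (i j : nat) : mat := delta_mx (i%:R : 'Z_N) (j%:R : 'Z_N).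

(* Generators of the enveloping algebra of the affinization of a Lie algebra g
   of matrices: X(s) = X (x) t^s with X in g, and the central element. *)
Inductive aff_gen (g : pred mat) : Type :=
| Loop (X : {X : mat | g X}) (s : int)
| Central.
HB.instance Definition _ g := gen_eqMixin (aff_gen g).
HB.instance Definition _ g := gen_choiceMixin (aff_gen g).

Section Relations.
Context (g : pred mat).
Local Notation LX X s := (fgen K (Loop X s)).
Local Notation cen := (fgen K (Central g)).

Inductive aff_rel : free_alg K (aff_gen g) -> free_alg K (aff_gen g) -> Prop :=
| aff_linear a X Y Z s : val Z = a *: val X + val Y ->
    aff_rel (LX Z s) (a *: LX X s + LX Y s)
| aff_bracket X Y Z r s : val Z = val X *m val Y - val Y *m val X ->
    aff_rel (commr (LX X r) (LX Y s))
      (LX Z (r + s)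
       + ((r + s == 0)%:R * (r%:~R * \tr (val X *m val Y))) *: cen)
| aff_central X s : aff_rel (commr cen (LX X s)) 0.

End Relations.

Definition traceless : pred mat := fun X => \tr X == 0.

Definition Usl := presented (@aff_rel traceless).

(* X(s) for X in sl_N, and 0 if X is not traceless. *)
Definition slX (X : mat) (s : int) : Usl :=
  if insub X is Some Z then gen _ (Loop Z s) else 0.

Definition slC : Usl := gen _ (Central traceless).

Inductive gl_rel (c : K) :
  free_alg K (aff_gen predT) -> free_alg K (aff_gen predT) -> Prop :=
| gl_aff l r : aff_rel l r -> gl_rel c l r
| gl_level : gl_rel c (fgen K (Central predT)) (c *: 1).

(* U(gl_N^) with the central element specialized to the scalar c. *)
Definition Ugl (c : K) := presented (gl_rel c).

Definition glX (c : K) (X : mat) (s : int) : Ugl c :=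
  gen _ (Loop (exist _ X isT) s).

Lemma gl_genE (c : K) (X : {X : mat | predT X}) s :
  gen (gl_rel c) (Loop X s) = glX c (val X) s.
Proof. by congr (gen _ (Loop _ s)); exact: val_inj. Qed.

Lemma gl_linear c a (X Y : mat) s :
  glX c (a *: X + Y) s = a *: glX c X s + glX c Y s.
Proof.
rewrite /glX /gen -piZ -piD; apply: pi_rel; apply: gl_aff.
exact: aff_linear.
Qed.

Lemma gl_center c : gen (gl_rel c) (Central predT) = c *: (1 : Ugl c).
Proof. by rewrite -piZ; apply: pi_rel; exact: gl_level. Qed.

Lemma gl_bracket c (X Y : mat) r s :
  commr (glX c X r) (glX c Y s) =
  glX c (X *m Y - Y *m X) (r + s)
  + ((r + s == 0)%:R * (r%:~R * \tr (X *m Y)) * c) *: (1 : Ugl c).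
Proof.
rewrite -scalerA -gl_center /glX /gen /commr -!piM -piN -piD -piZ -piD.
by apply: pi_rel; apply: gl_aff; exact: aff_bracket.
Qed.

End Affine.

Section Yangian.
Context (K : fieldType) (N : nat) (eps1 eps2 : K).

Definition cartan_a (i j : 'Z_N) : int :=
  if i == j then 2 else if (i == j + 1) || (i == j - 1) then -1 else 0.

Definition cartan_m (i j : 'Z_N) : int :=
  if j == i - 1 then 1 else if j == i + 1 then -1 else 0.

(* [YX true i r] is x^+_{i,r} and [YX false i r] is x^-_{i,r}. *)
Inductive yang_gen : Type :=
| YX (b : bool) (i : 'Z_N) (r : nat)
| YH (i : 'Z_N) (r : nat).
HB.instance Definition _ := gen_eqMixin yang_gen.
HB.instance Definition _ := gen_choiceMixin yang_gen.

Local Notation x b i r := (fgen K (YX b i r)).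
Local Notation h i r := (fgen K (YH i r)).
Local Notation sg b := (if b then 1 else -1 : K).
Local Notation a i j := ((cartan_a i j)%:~R : K).
Local Notation m i j := ((cartan_m i j)%:~R : K).

Inductive yang_rel : free_alg K yang_gen -> free_alg K yang_gen -> Prop :=
| yang_hh i j r s : yang_rel (commr (h i r) (h j s)) 0
| yang_xx i j r s :
    yang_rel (commr (x true i r) (x false j s))
             (if i == j then h i (r + s) else 0)
| yang_h0x b i j r :
    yang_rel (commr (h i 0) (x b j r)) ((sg b * a i j) *: x b j r)
| yang_hx b i j r s :
    yang_rel (commr (h i r.+1) (x b j s) - commr (h i r) (x b j s.+1))
      ((sg b * a i j * ((eps1 + eps2) / 2)) *: acommr (h i r) (x b j s)
       - (m i j * ((eps1 - eps2) / 2)) *: commr (h i r) (x b j s))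
| yang_xxb b i j r s :
    yang_rel (commr (x b i r.+1) (x b j s) - commr (x b i r) (x b j s.+1))
      ((sg b * a i j * ((eps1 + eps2) / 2)) *: acommr (x b i r) (x b j s)
       - (m i j * ((eps1 - eps2) / 2)) *: commr (x b i r) (x b j s))
| yang_serre b i j (n : nat) (r : 'I_n -> nat) s :
    i != j -> n%:Z = 1 - cartan_a i j ->
    yang_rel (\sum_(w : 'S_n)
      foldr (fun k u => commr (x b i (r (w k))) u) (x b j s) (enum 'I_n)) 0.

Definition Yangian := presented yang_rel.

Definition Yx (b : bool) (i : 'Z_N) (r : nat) : Yangian := gen _ (YX b i r).
Definition Yh (i : 'Z_N) (r : nat) : Yangian := gen _ (YH i r).

Definition Yht1 (i : 'Z_N) : Yangian :=
  Yh i 1 - ((eps1 + eps2) / 2) *: Yh i 0 ^+ 2.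

(* exp (ad x), a finite sum on every element when ad x is locally nilpotent. *)
Definition exp_ad (x y : Yangian) : Yangian :=
  \sum_(k \in [set: nat]) (k`!%:R^-1 : K) *: iter k (commr x) y.

Definition Tgen (i : 'Z_N) (y : Yangian) : Yangian :=
  exp_ad (Yx true i 0) (exp_ad (- Yx false i 0) (exp_ad (Yx true i 0) y)).

Definition Tword (s : seq 'Z_N) (y : Yangian) : Yangian := foldr Tgen y s.

End Yangian.

(* The affine Weyl group acting on the root lattice \bigoplus_i Z alpha_i, on
   which it is faithfully represented. *)
Section WeylGroup.
Context (N : nat).
Local Notation lattice := {ffun 'Z_N -> int}.

Definition alpha (i : 'Z_N) : lattice := [ffun j => (j == i)%:Z].

Definition delta : lattice := \sum_i alpha i.

Definition root_form (u v : lattice) : int :=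
  \sum_i \sum_j u i * cartan_a i j * v j.

Definition simple_refl (i : 'Z_N) (v : lattice) : lattice :=
  v - alpha i *~ root_form (alpha i) v.

(* This is t_alpha on all of the root lattice; it depends only on alpha modulo
   delta, as delta is in the radical of the form. *)
Definition transl (u v : lattice) : lattice := v - delta *~ root_form u v.

Definition word_act (s : seq 'Z_N) (v : lattice) : lattice :=
  foldr simple_refl v s.

Definition reduced_expr (w : lattice -> lattice) (s : seq 'Z_N) : Prop :=
  word_act s =1 w /\ forall s', word_act s' =1 w -> (size s <= size s')%N.

(* w(i,m) = t_{-alpha_{i+1}}^{m-1} s_{i+1} s_{i+2} ... s_{i-2} *)
Definition wgt_elt (i : 'Z_N) (m : nat) (v : lattice) : lattice :=
  iter m.-1 (transl (- alpha (i + 1)))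
    (word_act [seq i + k%:R | k <- iota 1 (N - 2)] v).

End WeylGroup.

(* The operator T_w, computed from a chosen reduced expression of w. *)
Definition Tw (K : fieldType) (N : nat) (eps1 eps2 : K)
    (w : {ffun 'Z_N -> int} -> {ffun 'Z_N -> int}) :
    Yangian N eps1 eps2 -> Yangian N eps1 eps2 :=
  @Tword K N eps1 eps2 (xget [::] [set s | reduced_expr w s]).

(* Finitely supported families indexed by int. *)
Section ZSum.
Context (V : zmodType).
Implicit Types f g : int -> V.

Definition vanishes_beyond (B : nat) f := forall e, (B < `|e|)%N -> f e = 0.

Definition zsum f : V := \sum_(e \in [set: int]) f e.

Lemma eq_zsum f g : f =1 g -> zsum f = zsum g.
Proof. by move=> /funext ->. Qed.

Let win (B : nat) : seq int := [seq i%:Z - B%:Z | i <- iota 0 (B.*2.+1)].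

Let win_uniq B : uniq (win B).
Proof. by rewrite map_inj_uniq ?iota_uniq // => i j; lia. Qed.

Let mem_win B e : (`|e| <= B)%N -> e \in win B.
Proof.
by move=> he; apply/mapP; exists (absz (e + B%:Z)); [rewrite mem_iota|]; lia.
Qed.

Lemma zsumE B f : vanishes_beyond B f -> zsum f = \sum_(e <- win B) f e.
Proof.
move=> fB; rewrite /zsum (fsbigE (win B)) //.
  by apply: eq_bigl => e; rewrite in_setT.
by move=> e _ he; apply: fB; rewrite ltnNge; exact: contra (@mem_win _ _) he.
Qed.

Lemma vanishes_leq B C f : (B <= C)%N -> vanishes_beyond B f ->
  vanishes_beyond C f.
Proof. by move=> BC fB e he; apply: fB; exact: leq_ltn_trans BC he. Qed.

Lemma zsumB B f g : vanishes_beyond B f -> vanishes_beyond B g ->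
  zsum (fun e => f e - g e) = zsum f - zsum g.
Proof.
move=> fB gB; rewrite (zsumE fB) (zsumE gB) (@zsumE B) ?sumrB //.
by move=> e he; rewrite fB ?gB ?subrr.
Qed.

Lemma zsumD B f g : vanishes_beyond B f -> vanishes_beyond B g ->
  zsum (fun e => f e + g e) = zsum f + zsum g.
Proof.
move=> fB gB; rewrite (zsumE fB) (zsumE gB) (@zsumE B) ?big_split //.
by move=> e he; rewrite fB ?gB ?addr0.
Qed.

Lemma zsum_exchange B (F : int -> int -> V) :
  (forall i, (B < `|i|)%N -> forall j, F i j = 0) ->
  (forall j, (B < `|j|)%N -> forall i, F i j = 0) ->
  zsum (fun i => zsum (F i)) = zsum (fun j => zsum (F^~ j)).
Proof.
move=> h1 h2.
rewrite (@zsumE B); last first.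
  by move=> e he; rewrite /zsum fsbig1 // => f _; exact: h1.
rewrite [RHS](@zsumE B); last first.
  by move=> e he; rewrite /zsum fsbig1 // => f _; exact: h2.
have E1 i : zsum (F i) = \sum_(j <- win B) F i j.
  by apply: zsumE => j hj; exact: h2.
have E2 j : zsum (F^~ j) = \sum_(i <- win B) F i j.
  by apply: zsumE => i hi; exact: h1.
rewrite (eq_bigr _ (fun i _ => E1 i)) [RHS](eq_bigr _ (fun j _ => E2 j)).
exact: exchange_big.
Qed.

Lemma zsum_reindex (h : int -> int) f : bijective h ->
  zsum f = zsum (fun e => f (h e)).
Proof. exact: reindex_fsbigT. Qed.

Lemma zsum1 (d : int) f : (forall e, e != d -> f e = 0) -> zsum f = f d.
Proof.
move=> fd; rewrite /zsum (fsbigE [:: d]) //.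
  by rewrite big_mkcond big_seq1 in_setT.
by move=> e _; rewrite inE => /fd.
Qed.

End ZSum.

Lemma zsum_mulr (V : pzRingType) (B : nat) (a : V) (f : int -> V) :
  vanishes_beyond B f -> a * zsum f = zsum (fun e => a * f e).
Proof.
move=> fB; rewrite (zsumE fB) (@zsumE _ B) ?mulr_sumr //.
by move=> e he; rewrite fB ?mulr0.
Qed.

Lemma zsumZ (K : pzRingType) (V : lmodType K) (B : nat) (a : K) (f : int -> V) :
  vanishes_beyond B f -> a *: zsum f = zsum (fun e => a *: f e).
Proof.
move=> fB; rewrite (zsumE fB) (@zsumE _ B) ?scaler_sumr //.
by move=> e he; rewrite fB ?scaler0.
Qed.

Lemma zsum_mull (V : pzRingType) (B : nat) (a : V) (f : int -> V) :
  vanishes_beyond B f -> zsum f * a = zsum (fun e => f e * a).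
Proof.
move=> fB; rewrite (zsumE fB) (@zsumE _ B) ?mulr_suml //.
by move=> e he; rewrite fB ?mul0r.
Qed.

Section Completion.
Context (K : fieldType) (N : nat) (c : K).
Local Notation U := (Ugl N c).
Implicit Types (d e r : int) (n k : nat).

(* The homogeneous component U[d], for deg X(s) = s. *)
Inductive udeg : int -> U -> Prop :=
| udeg0 d : udeg d 0
| udeg1 : udeg 0 1
| udegX X s : udeg s (glX c X s)
| udegD d u v : udeg d u -> udeg d v -> udeg d (u + v)
| udegZ d a u : udeg d u -> udeg d (a *: u)
| udegM d e u v : udeg d u -> udeg e v -> udeg (d + e) (u * v).

(* \sum_{r > n} U[d+r] U[-r] *)
Inductive ufil (d : int) (n : nat) : U -> Prop :=
| ufil0 : ufil d n 0
| ufilD u v : ufil d n u -> ufil d n v -> ufil d n (u + v)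
| ufilM r u v : n%:Z < r -> udeg (d + r) u -> udeg (- r) v ->
    ufil d n (u * v).

Lemma udegE d e u : udeg d u -> d = e -> udeg e u.
Proof. by move=> + <-. Qed.

Lemma udegN d u : udeg d u -> udeg d (- u).
Proof. by rewrite -scaleN1r; exact: udegZ. Qed.

Lemma udegB d u v : udeg d u -> udeg d v -> udeg d (u - v).
Proof. by move=> hu /udegN; exact: udegD. Qed.

Lemma ufilZ d n a u : ufil d n u -> ufil d n (a *: u).
Proof.
elim=> [|v w _ hv _ hw|r v w hr hv hw]; first by rewrite scaler0; exact: ufil0.
  by rewrite scalerDr; exact: ufilD.
by rewrite pr_scalerAl; apply: ufilM hr _ hw; exact: udegZ.
Qed.

Lemma ufilN d n u : ufil d n u -> ufil d n (- u).
Proof. by rewrite -scaleN1r; exact: ufilZ. Qed.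

Lemma ufilB d n u v : ufil d n u -> ufil d n v -> ufil d n (u - v).
Proof. by move=> hu /ufilN; exact: ufilD. Qed.

Lemma ufil_subE d n u v u' v' :
  u = u' -> v = v' -> ufil d n (u' - v') -> ufil d n (u - v).
Proof. by move=> -> ->. Qed.

Lemma ufil_leq d n k u : (k <= n)%N -> ufil d n u -> ufil d k u.
Proof.
move=> kn; elim=> [|v w _ hv _ hw|r v w hr hv hw]; first exact: ufil0.
  exact: ufilD.
by apply: ufilM hv hw; lia.
Qed.

Lemma ufilMl d e n u v : udeg e u -> ufil d n v -> ufil (e + d) n (u * v).
Proof.
move=> hu; elim=> [|x y _ hx _ hy|r x y hr hx hy].
- by rewrite mulr0; exact: ufil0.
- by rewrite mulrDr; exact: ufilD.
by rewrite mulrA; apply: ufilM hr _ hy; rewrite -addrA; exact: udegM.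
Qed.

Lemma ufilMr d e n k u v : (n + `|e| <= k)%N -> ufil d k u -> udeg e v ->
  ufil (d + e) n (u * v).
Proof.
move=> nk hu hv; elim: hu => [|x y _ hx _ hy|r x y hr hx hy].
- by rewrite mul0r; exact: ufil0.
- by rewrite mulrDl; exact: ufilD.
rewrite -mulrA; apply: (@ufilM _ _ (r - e)); first lia.
  by apply: udegE hx _; lia.
by apply: udegE (udegM hy hv) _; lia.
Qed.

Lemma ufilMB d e n k u u' v v' : (n + `|d - e| <= k)%N ->
  udeg e u' -> udeg (d - e) v ->
  ufil e k (u - u') -> ufil (d - e) n (v - v') ->
  ufil d n (u * v - u' * v').
Proof.
move=> nk hu hv huu hvv.
have -> : u * v - u' * v' = (u - u') * v + u' * (v - v').
  by rewrite mulrBl mulrBr addrA subrK.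
have de : e + (d - e) = d by lia.
by apply: ufilD; rewrite -[X in ufil X]de; [exact: ufilMr nk _ _|exact: ufilMl].
Qed.

Lemma ufil_sum (I : Type) (s : seq I) d n (F : I -> U) :
  (forall i, ufil d n (F i)) -> ufil d n (\sum_(i <- s) F i).
Proof.
by move=> hF; elim/big_rec: _ => [|i u _]; [exact: ufil0|exact: ufilD].
Qed.

Lemma udeg_sum (I : Type) (s : seq I) d (F : I -> U) :
  (forall i, udeg d (F i)) -> udeg d (\sum_(i <- s) F i).
Proof.
by move=> hF; elim/big_rec: _ => [|i u _]; [exact: udeg0|exact: udegD].
Qed.

(* Representatives of the elements of the direct sum over d of the inverse
   limits over n of U[d] / \sum_{r > n} U[d+r] U[-r]: [x d n] represents the
   component of x in the n-th quotient in degree d. *)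
Record precomp := PreComp {
  pc_fun :> int -> nat -> U;
  pc_deg : forall d n, udeg d (pc_fun d n);
  pc_coh : forall d n, ufil d n (pc_fun d n.+1 - pc_fun d n);
  pc_fin : exists B, forall n, vanishes_beyond B (pc_fun^~ n)
}.
HB.instance Definition _ := gen_eqMixin precomp.
HB.instance Definition _ := gen_choiceMixin precomp.

Implicit Types x y z : precomp.

Lemma precompP x y : (forall d n, x d n = y d n) -> x = y.
Proof.
case: x => xf x1 x2 x3; case: y => yf y1 y2 y3 /= h.
have E : xf = yf by apply/funext => d; apply/funext.
move: x1 x2 x3 y1 y2 y3; rewrite E => x1 x2 x3 y1 y2 y3.
by congr PreComp; exact: Prop_irrelevance.
Qed.

Lemma pc_coh_leq x d n k : (n <= k)%N -> ufil d n (x d k - x d n).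
Proof.
move=> /subnK <-; elim: (k - n)%N => [|j IH].
  by rewrite add0n subrr; exact: ufil0.
rewrite addSn -[X in X - _](subrK (x d (j + n))) -addrA; apply: ufilD IH.
by apply: ufil_leq (pc_coh x d (j + n)); exact: leq_addl.
Qed.

Definition pc_eqv : rel precomp :=
  fun x y => `[< forall d n, ufil d n (x d n - y d n) >].

Lemma pc_eqv_refl : reflexive pc_eqv.
Proof. by move=> x; apply/asboolP => d n; rewrite subrr; exact: ufil0. Qed.

Lemma pc_eqv_sym : symmetric pc_eqv.
Proof.
by move=> x y; apply/asboolP/asboolP => h d n; rewrite -opprB; exact: ufilN.
Qed.

Lemma pc_eqv_trans : transitive pc_eqv.
Proof.
move=> y x z /asboolP xy /asboolP yz; apply/asboolP => d n.
by have := ufilD (xy d n) (yz d n); rewrite addrA subrK.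
Qed.

Canonical pc_eqv_equiv := EquivRel pc_eqv pc_eqv_refl pc_eqv_sym pc_eqv_trans.

(* U(gl_N^)_{comp,-} *)
Definition Ucomp := {eq_quot pc_eqv}%qT.
HB.instance Definition _ := Choice.on Ucomp.
HB.instance Definition _ : EqQuotient _ pc_eqv Ucomp := EqQuotient.on Ucomp.

Local Notation pi := (\pi_(Ucomp))%qT.

Lemma uc_eq x y : (pi x = pi y) <-> (forall d n, ufil d n (x d n - y d n)).
Proof. by split => [/eqmodP/asboolP|h]; [|apply/eqmodP/asboolP]. Qed.

Lemma uc_repr x d n : ufil d n (repr (pi x) d n - x d n).
Proof. by move: d n; apply/uc_eq; rewrite reprK. Qed.

Lemma ucW (P : Ucomp -> Type) :
  (forall x, P (pi x)) -> forall u : Ucomp, P u.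
Proof. by move=> h u; rewrite -[u]reprK; exact: h. Qed.

Local Obligation Tactic := idtac.

Program Definition pc_hom d u (hu : udeg d u) : precomp :=
  @PreComp (fun e n => if e == d then u else 0) _ _ _.
Next Obligation. by move=> d u hu e n /=; case: (eqVneq e d) => [->|_] //; exact: udeg0. Qed.
Next Obligation. by move=> d u hu e n /=; rewrite subrr; exact: ufil0. Qed.
Next Obligation.
move=> d u hu; exists `|d|%N => n e he.
by rewrite /=; case: eqP => // ed; rewrite ed ltnn in he.
Qed.

Program Definition pc_add x y : precomp :=
  @PreComp (fun d n => x d n + y d n) _ _ _.
Next Obligation. by move=> x y d n /=; apply: udegD; exact: pc_deg. Qed.
Next Obligation.
by move=> x y d n /=; rewrite opprD addrACA; apply: ufilD; exact: pc_coh.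
Qed.
Next Obligation.
move=> x y; have [B xB] := pc_fin x; have [C yC] := pc_fin y.
exists (maxn B C) => n e; rewrite gtn_max => /andP[eB eC].
by rewrite /= xB ?yC ?addr0.
Qed.

Program Definition pc_scale a x : precomp :=
  @PreComp (fun d n => a *: x d n) _ _ _.
Next Obligation. by move=> a x d n /=; apply: udegZ; exact: pc_deg. Qed.
Next Obligation.
by move=> a x d n /=; rewrite -scalerBr; apply: ufilZ; exact: pc_coh.
Qed.
Next Obligation.
move=> a x; have [B xB] := pc_fin x.
by exists B => n e eB /=; rewrite xB ?scaler0.
Qed.

(* Modulo the n-th submodule of U[d], a product with right factor in U[d - e]
   depends only on the left factor modulo the (n + |d - e|)-th submodule of
   U[e] and on the right factor modulo the n-th submodule of U[d - e]. *)
Definition mul_term x y d n e : U := x e (n + `|d - e|)%N * y (d - e) n.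

Lemma mul_term_fin x y :
  exists B, forall d n, vanishes_beyond B (mul_term x y d n).
Proof.
have [B xB] := pc_fin x; exists B => d n e he.
by rewrite /mul_term xB ?mul0r.
Qed.

Program Definition pc_mul x y : precomp :=
  @PreComp (fun d n => zsum (mul_term x y d n)) _ _ _.
Next Obligation.
move=> x y d n /=; apply: udeg_sum => e.
by apply: udegE (udegM (pc_deg _ _ _) (pc_deg _ _ _)) _; lia.
Qed.
Next Obligation.
move=> x y d n /=; have [B xyB] := mul_term_fin x y.
rewrite -(zsumB (xyB d n.+1) (xyB d n)); apply: ufil_sum => e.
apply: ufilMB (leqnn _) (pc_deg _ _ _) (pc_deg _ _ _) _ (pc_coh _ _ _).
by rewrite addSn; exact: pc_coh.
Qed.
Next Obligation.
move=> x y; have [B xB] := pc_fin x; have [C yC] := pc_fin y.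
exists (B + C)%N => n d hd /=; rewrite /zsum fsbig1 // => e _; rewrite /mul_term.
have [eB|eB] := ltnP B `|e|; first by rewrite xB ?mul0r.
by rewrite yC ?mulr0 //; lia.
Qed.

Definition uc_add (x y : Ucomp) : Ucomp := pi (pc_add (repr x) (repr y)).
Definition uc_opp (x : Ucomp) : Ucomp := pi (pc_scale (-1) (repr x)).
Definition uc_scale (a : K) (x : Ucomp) : Ucomp := pi (pc_scale a (repr x)).
Definition uc_mul (x y : Ucomp) : Ucomp := pi (pc_mul (repr x) (repr y)).

Lemma uc_addE x y : uc_add (pi x) (pi y) = pi (pc_add x y).
Proof.
apply/uc_eq => d n /=; rewrite opprD addrACA.
by apply: ufilD; exact: uc_repr.
Qed.

Lemma uc_oppE x : uc_opp (pi x) = pi (pc_scale (-1) x).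
Proof. by apply/uc_eq => d n /=; rewrite -scalerBr; apply/ufilZ/uc_repr. Qed.

Lemma uc_scaleE a x : uc_scale a (pi x) = pi (pc_scale a x).
Proof. by apply/uc_eq => d n /=; rewrite -scalerBr; apply/ufilZ/uc_repr. Qed.

Lemma uc_mulE x y : uc_mul (pi x) (pi y) = pi (pc_mul x y).
Proof.
apply/uc_eq => d n /=.
have [B h] := mul_term_fin (repr (pi x)) (repr (pi y)).
have [C h'] := mul_term_fin x y.
rewrite -(@zsumB _ (maxn B C)).
- apply: ufil_sum => e.
  apply: ufilMB (leqnn _) (pc_deg _ _ _) (pc_deg _ _ _) _ (uc_repr _ _ _).
  exact: uc_repr.
- exact: vanishes_leq (leq_maxl _ _) (h d n).
- exact: vanishes_leq (leq_maxr _ _) (h' d n).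
Qed.

Let ucE := (uc_addE, uc_oppE, uc_scaleE, uc_mulE).

Local Notation pc0 := (pc_hom (udeg0 0)).
Local Notation pc1 := (pc_hom udeg1).

Lemma pc0E d n : pc0 d n = 0. Proof. by rewrite /=; case: (d == 0). Qed.

Lemma uc_addA : associative uc_add.
Proof.
elim/ucW=> x; elim/ucW=> y; elim/ucW=> z; rewrite !ucE.
by congr (pi _); apply: precompP => d n /=; rewrite addrA.
Qed.
Lemma uc_addC : commutative uc_add.
Proof.
elim/ucW=> x; elim/ucW=> y; rewrite !ucE.
by congr (pi _); apply: precompP => d n /=; rewrite addrC.
Qed.
Lemma uc_add0 : left_id (pi pc0) uc_add.
Proof.
elim/ucW=> x; rewrite !ucE; congr (pi _); apply: precompP => d n.
by rewrite /=; case: (d == 0); rewrite add0r.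
Qed.
Lemma uc_addN : left_inverse (pi pc0) uc_opp uc_add.
Proof.
elim/ucW=> x; rewrite !ucE; congr (pi _); apply: precompP => d n.
by rewrite pc0E /= scaleN1r addNr.
Qed.

HB.instance Definition _ :=
  GRing.isZmodule.Build Ucomp uc_addA uc_addC uc_add0 uc_addN.

Lemma uc_piD x y : pi (pc_add x y) = pi x + pi y.
Proof. by rewrite -uc_addE. Qed.

Lemma uc_mulA : associative uc_mul.
Proof.
elim/ucW=> x; elim/ucW=> y; elim/ucW=> z; rewrite !ucE; apply/uc_eq => d n.
have [B xB] := pc_fin x; have [C yC] := pc_fin y; have [D zD] := pc_fin z.
pose M := (B + C + D + `|d|)%N.
have MF (k1 : int -> int -> nat) (k2 : int -> nat) f e : ((M < `|e|) || (M < `|f|))%N ->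
    x f (k1 e f) * y (e - f) (k2 e) * z (d - e) n = 0.
  move=> he; have [fB|fB] := ltnP B `|f|; first by rewrite xB ?mul0r.
  have [eC|eC] := ltnP C `|e - f|; first by rewrite yC ?mulr0 ?mul0r.
  by have [eD|eD] := ltnP D `|d - e|; [rewrite zD ?mulr0|lia].
pose G1 (f e : int) : U := x f (n + `|d - f|)%N * y (e - f) (n + `|d - e|)%N * z (d - e) n.
pose G2 (f e : int) : U :=
  x f (n + `|d - e| + `|e - f|)%N * y (e - f) (n + `|d - e|)%N * z (d - e) n.
have MF1 f e : ((M < `|e|) || (M < `|f|))%N -> G1 f e = 0.
  exact: (MF (fun _ f => n + `|d - f|)%N (fun e => n + `|d - e|)%N).
have MF2 f e : ((M < `|e|) || (M < `|f|))%N -> G2 f e = 0.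
  exact: (MF (fun e f => n + `|d - e| + `|e - f|)%N (fun e => n + `|d - e|)%N).
have E1 : zsum (mul_term x (pc_mul y z) d n) = zsum (fun f => zsum (G1 f)).
  apply: eq_zsum => f; rewrite {1}/mul_term /=.
  rewrite (@zsum_mulr _ C); last first.
    by move=> e he; rewrite /mul_term yC ?mul0r.
  have bh : bijective (fun e => e - f).
    by exists (fun e => e + f) => e; rewrite ?subrK ?addrK.
  apply: (etrans (zsum_reindex _ bh)); apply: eq_zsum => e.
  by rewrite /mul_term /G1 mulrA (_ : d - f - (e - f) = d - e) //; lia.
have E2 : zsum (mul_term (pc_mul x y) z d n) = zsum (fun f => zsum (G2 f)).
  rewrite (@zsum_exchange _ M); first last.
  - by move=> e he f; apply: MF2; rewrite he.
  - by move=> f hf e; apply: MF2; rewrite hf orbT.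
  apply: eq_zsum => e; rewrite {1}/mul_term /=.
  rewrite (@zsum_mull _ B) //.
  by move=> f hf; rewrite /mul_term xB ?mul0r.
have van (G : int -> int -> U) :
    (forall f e, ((M < `|e|) || (M < `|f|))%N -> G f e = 0) ->
    vanishes_beyond M (fun f => zsum (G f)) /\ forall f, vanishes_beyond M (G f).
  move=> hG; split=> [f hf|f e he]; last by rewrite hG ?he.
  by rewrite /zsum fsbig1 // => e _; rewrite hG ?hf ?orbT.
have [G1v G1v'] := van G1 MF1.
have [G2v G2v'] := van G2 MF2.
apply: (ufil_subE E1 E2).
rewrite -(zsumB G1v G2v); apply: ufil_sum => f.
rewrite -(zsumB (G1v' f) (G2v' f)); apply: ufil_sum => e.
rewrite -opprB; apply: ufilN.
rewrite /G1 /G2 -mulrBl -mulrBl -mulrA.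
have df : d = f + (d - f) by lia.
rewrite [X in ufil X]df; apply: (@ufilMr _ _ _ (n + `|d - f|)%N) => //.
  by apply: pc_coh_leq; lia.
by apply: udegE (udegM (pc_deg y _ _) (pc_deg z _ _)) _; lia.
Qed.

Lemma uc_mul1l : left_id (pi pc1) uc_mul.
Proof.
elim/ucW=> x; rewrite uc_mulE; congr (pi _); apply: precompP => d n.
apply: (etrans (@zsum1 _ 0 _ _)); last first.
  by rewrite /mul_term /= mul1r subr0.
by move=> e /negPf he; rewrite /mul_term /= he mul0r.
Qed.

Lemma uc_mul1r : right_id (pi pc1) uc_mul.
Proof.
elim/ucW=> x; rewrite uc_mulE; apply/uc_eq => d n.
apply: (ufil_subE (_ : _ = x d (n + 0)%N) erefl); last first.
  by rewrite addn0 subrr; exact: ufil0.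
apply: (etrans (@zsum1 _ d _ _)); last first.
  by rewrite /mul_term /= subrr eqxx mulr1.
move=> e he; rewrite /mul_term /= subr_eq0 eq_sym (negPf he).
by rewrite mulr0.
Qed.

Lemma uc_mulDl : left_distributive uc_mul +%R.
Proof.
elim/ucW=> x; elim/ucW=> y; elim/ucW=> z.
rewrite -uc_piD !uc_mulE -uc_piD; congr (pi _); apply: precompP => d n.
have [B xB] := mul_term_fin x z; have [C yC] := mul_term_fin y z.
apply: (etrans _ (@zsumD _ (maxn B C) _ _ _ _)).
- by apply: eq_zsum => e; rewrite /mul_term /= mulrDl.
- exact: vanishes_leq (leq_maxl _ _) (xB d n).
- exact: vanishes_leq (leq_maxr _ _) (yC d n).
Qed.

Lemma uc_mulDr : right_distributive uc_mul +%R.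
Proof.
elim/ucW=> x; elim/ucW=> y; elim/ucW=> z.
rewrite -uc_piD !uc_mulE -uc_piD; congr (pi _); apply: precompP => d n.
have [B xB] := mul_term_fin x y; have [C yC] := mul_term_fin x z.
apply: (etrans _ (@zsumD _ (maxn B C) _ _ _ _)).
- by apply: eq_zsum => e; rewrite /mul_term /= mulrDr.
- exact: vanishes_leq (leq_maxl _ _) (xB d n).
- exact: vanishes_leq (leq_maxr _ _) (yC d n).
Qed.

HB.instance Definition _ := GRing.Zmodule_isPzRing.Build Ucomp
  uc_mulA uc_mul1l uc_mul1r uc_mulDl uc_mulDr.

Lemma uc_scaleA a b u : uc_scale a (uc_scale b u) = uc_scale (a * b) u.
Proof.
elim/ucW: u => x; rewrite !uc_scaleE; congr (pi _).
by apply: precompP => d n /=; rewrite scalerA.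
Qed.
Lemma uc_scale1 : left_id 1 uc_scale.
Proof.
elim/ucW=> x; rewrite uc_scaleE; congr (pi _).
by apply: precompP => d n /=; rewrite scale1r.
Qed.
Lemma uc_scaleDr : right_distributive uc_scale +%R.
Proof.
move=> a; elim/ucW=> x; elim/ucW=> y; rewrite -uc_piD !uc_scaleE -uc_piD.
by congr (pi _); apply: precompP => d n /=; rewrite scalerDr.
Qed.
Lemma uc_scaleDl u : {morph uc_scale^~ u : a b / a + b}.
Proof.
move=> a b; elim/ucW: u => x; rewrite !uc_scaleE -uc_piD; congr (pi _).
by apply: precompP => d n /=; rewrite scalerDl.
Qed.

HB.instance Definition _ := GRing.Zmodule_isLmodule.Build K Ucomp
  uc_scaleA uc_scale1 uc_scaleDr uc_scaleDl.

Lemma uc_piM x y : pi (pc_mul x y) = pi x * pi y.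
Proof. by rewrite -uc_mulE. Qed.

Lemma uc_piZ a x : pi (pc_scale a x) = a *: pi x.
Proof. by rewrite -uc_scaleE. Qed.

Lemma uc_scalerAl a (u v : Ucomp) : a *: (u * v) = (a *: u) * v.
Proof.
elim/ucW: u => x; elim/ucW: v => y; rewrite -uc_piM -!uc_piZ -uc_piM.
congr (pi _); apply: precompP => d n.
have [B xB] := mul_term_fin x y.
apply: (etrans (_ : _ = zsum (fun e => a *: mul_term x y d n e))).
  exact: (zsumZ _ (xB d n)).
by apply: eq_zsum => e; rewrite /mul_term /= pr_scalerAl.
Qed.

Lemma uc_scalerAr a (u v : Ucomp) : a *: (u * v) = u * (a *: v).
Proof.
elim/ucW: u => x; elim/ucW: v => y; rewrite -uc_piM -!uc_piZ -uc_piM.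
congr (pi _); apply: precompP => d n.
have [B xB] := mul_term_fin x y.
apply: (etrans (_ : _ = zsum (fun e => a *: mul_term x y d n e))).
  exact: (zsumZ _ (xB d n)).
by apply: eq_zsum => e; rewrite /mul_term /= pr_scalerAr.
Qed.

(* A homogeneous element of U as an element of the completion. *)
Definition uc_hom d u (hu : udeg d u) : Ucomp := pi (pc_hom hu).

Lemma uc_homE d e u v (hu : udeg d u) (hv : udeg e v) :
  d = e -> u = v -> uc_hom hu = uc_hom hv.
Proof.
by move=> de uv; congr (pi _); apply: precompP => i n /=; rewrite de uv.
Qed.

Lemma uc_homD d u v (hu : udeg d u) (hv : udeg d v) :
  uc_hom hu + uc_hom hv = uc_hom (udegD hu hv).
Proof.
rewrite -uc_piD; congr (pi _); apply: precompP => e n /=.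
by case: (e == d); rewrite ?addr0.
Qed.

Lemma uc_homZ d a u (hu : udeg d u) : a *: uc_hom hu = uc_hom (udegZ a hu).
Proof.
rewrite -uc_piZ; congr (pi _); apply: precompP => e n /=.
by case: (e == d); rewrite ?scaler0.
Qed.

Lemma uc_homM d e u v (hu : udeg d u) (hv : udeg e v) :
  uc_hom hu * uc_hom hv = uc_hom (udegM hu hv).
Proof.
rewrite -uc_piM; congr (pi _); apply: precompP => i n.
apply: (etrans (@zsum1 _ d _ _)).
  by move=> j /negPf hj; rewrite /mul_term /= hj mul0r.
rewrite /mul_term /= eqxx subr_eq addrC.
by rewrite addrC; case: (_ == _); rewrite ?mulr0.
Qed.

Definition uc_scalar (a : K) : Ucomp := a *: (1 : Ucomp).

Lemma uc_scalar_zmod : zmod_morphism uc_scalar.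
Proof. by move=> a b; rewrite /uc_scalar scalerBl. Qed.

Lemma uc_scalar_monoid : monoid_morphism uc_scalar.
Proof.
split=> [|a b]; first by rewrite /uc_scalar scale1r.
by rewrite /uc_scalar -uc_scalerAl mul1r scalerA.
Qed.

HB.instance Definition _ :=
  GRing.isZmodMorphism.Build K Ucomp uc_scalar uc_scalar_zmod.
HB.instance Definition _ :=
  GRing.isMonoidMorphism.Build K Ucomp uc_scalar uc_scalar_monoid.

Lemma uc_scalarC a (u : Ucomp) : uc_scalar a * u = u * uc_scalar a.
Proof. by rewrite -uc_scalerAl -uc_scalerAr mul1r mulr1. Qed.

Lemma uc_scalarE a (u : Ucomp) : uc_scalar a * u = a *: u.
Proof. by rewrite -uc_scalerAl mul1r. Qed.

Definition canon_gen (t : aff_gen (predT : pred 'M[K]_((Zp_trunc N).+2))) :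
    Ucomp :=
  match t with
  | Loop X s => uc_hom (udegX (val X) s)
  | Central => c *: (1 : Ucomp)
  end.

(* The canonical homomorphism from U(gl_N^) to its completion. *)
Definition canon : U -> Ucomp := pr_lift uc_scalar canon_gen.

Lemma canon_rels lhs rhs : gl_rel c lhs rhs ->
  free_lift uc_scalar canon_gen lhs = free_lift uc_scalar canon_gen rhs.
Proof.
pose F := free_lift uc_scalar canon_gen.
have FD u v : F (u + v) = F u + F v by exact: free_liftD.
have FZ a u : F (a *: u) = a *: F u.
  by rewrite -uc_scalarE; exact: free_liftZ.
have FC u v : F (commr u v) = commr (F u) (F v).
  exact: (@free_lift_commr K _ Ucomp uc_scalar canon_gen uc_scalarC u v).
have F0 : F 0 = 0 by exact: free_lift0.
have FX t : F (fgen K t) = canon_gen t by exact: free_lift_gen.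
have F1 : F 1 = 1 by exact: free_lift1.
rewrite -!/(F _); case=> {lhs rhs} [_ _ []|].
- move=> a X Y Z s E; rewrite [RHS]FD [X in _ = X + _]FZ !FX /=.
  rewrite uc_homZ uc_homD.
  by apply: uc_homE => //; rewrite E gl_linear.
- move=> X Y Z d e E; rewrite [LHS]FC [RHS]FD [X in _ = _ + X]FZ !FX /=.
  rewrite /commr 2!uc_homM -scaleN1r uc_homZ scalerA.
  have h2 : udeg (d + e) (-1 *: (glX c (val Y) e * glX c (val X) d)).
    by rewrite addrC; apply: udegZ; apply: udegM; exact: udegX.
  rewrite (uc_homE (udegZ _ _) h2 (addrC _ _) erefl) uc_homD.
  have [de|de] := eqVneq (d + e) 0; last first.
    rewrite mul0r mul0r scale0r addr0.
    apply: (uc_homE _ _ erefl); rewrite scaleN1r E.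
    have := gl_bracket c (val X) (val Y) d e.
    by rewrite (negPf de) !mul0r scale0r addr0.
  have h3 : udeg (d + e) (1 : U) by rewrite de; exact: udeg1.
  have e1 : (1 : Ucomp) = uc_hom h3 by exact: uc_homE.
  rewrite [X in _ = _ + _ *: X]e1.
  rewrite (uc_homZ _ h3) (uc_homD (udegX (val Z) (d + e))).
  apply: (uc_homE _ _ erefl); rewrite scaleN1r E.
  have := gl_bracket c (val X) (val Y) d e.
  by have -> : (d + e == 0) = true by rewrite de.
- move=> X s; rewrite [LHS]FC F0 !FX /= /commr.
  by rewrite -uc_scalarE mulr1 -uc_scalarC subrr.
by rewrite [RHS]FZ FX F1.
Qed.

Lemma canon_morphism : algebra_morphism canon.
Proof.
split=> [a u v|].
  by rewrite /canon (pr_liftD uc_scalarC canon_rels) (pr_liftZ uc_scalarC canon_rels) uc_scalarE.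
split=> [|u v]; first exact: (pr_lift1 uc_scalarC canon_rels).
exact: (pr_liftM uc_scalarC canon_rels).
Qed.

Lemma canonX X s : canon (glX c X s) = uc_hom (udegX X s).
Proof. by rewrite /canon (pr_lift_gen uc_scalarC canon_rels). Qed.

(* Convergence in the topology of the inverse limits. *)
Definition uc_cvg (f : nat -> Ucomp) (l : Ucomp) :=
  forall d n, exists k0, forall k, (k0 <= k)%N ->
    ufil d n (repr (f k) d n - repr l d n).

Lemma uc_cvg_unique f l l' : uc_cvg f l -> uc_cvg f l' -> l = l'.
Proof.
move=> h h'; rewrite -[l]reprK -[l']reprK; apply/uc_eq => d n.
have [k hk] := h d n; have [k' hk'] := h' d n.
have := ufilB (hk' _ (leq_maxr k k')) (hk _ (leq_maxl k k')).
by rewrite opprB addrCA addrAC subrr add0r addrC.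
Qed.

Definition uc_series (f : nat -> Ucomp) : Ucomp :=
  xget 0 [set l | uc_cvg (fun k => \sum_(0 <= s < k) f s) l].

End Completion.

(* The Chevalley generators, for i in {0, ..., N-1}, in terms of the elements
   X(s), given by [L X s], and of the central element [cc]. *)
Section Chevalley.
Context (K : fieldType) (N : nat) (A : zmodType).
Variables (L : 'M[K]_((Zp_trunc N).+2) -> int -> A) (cc : A).

Definition chev_x (b : bool) (i : 'Z_N) : A :=
  if i == 0 then (if b then L (Emx K N N 1) 1 else L (Emx K N 1 N) (-1))
  else (if b then L (Emx K N i i.+1) 0 else L (Emx K N i.+1 i) 0).

Definition chev_h (i : 'Z_N) : A :=
  if i == 0 then L (Emx K N N N - Emx K N 1 1) 0 + cc
  else L (Emx K N i i - Emx K N i.+1 i.+1) 0.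

End Chevalley.

Section Data.
Context (K : fieldType) (N : nat) (eps1 eps2 c : K).
Local Notation Y := (Yangian N eps1 eps2).
Local Notation Yx := (Yx eps1 eps2).
Local Notation Yh := (Yh eps1 eps2).
Local Notation hbar := (eps1 + eps2).

Definition is_omega (omega : Y -> Y) : Prop :=
  [/\ algebra_antimorphism omega,
      forall b i r, omega (Yx b i r) = Yx (~~ b) i r
    & forall i r, omega (Yh i r) = Yh i r].

(* The homomorphism U(sl_N^) -> Y given by the Chevalley generators. *)
Definition is_sl_map (iota : Usl K N -> Y) : Prop :=
  [/\ algebra_morphism iota,
      forall b i, iota (chev_x (@slX K N) b i) = Yx b i 0
    & forall i, iota (chev_h (@slX K N) (slC K N) i) = Yh i 0].

Definition ucX (X : 'M[K]_((Zp_trunc N).+2)) (s : int) : Ucomp N c :=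
  canon (glX c X s).
Local Notation E i j s := (ucX (Emx K N i j) s).

Record is_evaluation (ev : Y -> Ucomp N c) : Prop := IsEvaluation {
  ev_morphism : algebra_morphism ev;
  ev_x : forall b i, ev (Yx b i 0) = chev_x ucX b i;
  ev_h : forall i, ev (Yh i 0) = chev_h ucX (c *: (1 : Ucomp N c)) i;
  ev_xp01 : ev (Yx true 0 1) =
    (1 + N%:R * eps2) *: chev_x ucX true 0
    + hbar *: uc_series (fun s =>
        \sum_(1 <= k < N.+1) E k 1 (s%:Z + 1) * E N k (- s%:Z));
  ev_xm01 : ev (Yx false 0 1) =
    (1 + N%:R * eps2) *: chev_x ucX false 0
    + hbar *: uc_series (fun s =>
        \sum_(1 <= k < N.+1) E k N s%:Z * E 1 k (- s%:Z - 1));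
  ev_xp1 : forall i : nat, (1 <= i < N)%N -> ev (Yx true i%:R 1) =
    (1 + i%:R * eps2) *: chev_x ucX true i%:R
    + hbar *: uc_series (fun s =>
        \sum_(1 <= k < i.+1) E k i.+1 s%:Z * E i k (- s%:Z)
        + \sum_(i.+1 <= k < N.+1) E k i.+1 (s%:Z + 1) * E i k (- s%:Z - 1));
  ev_xm1 : forall i : nat, (1 <= i < N)%N -> ev (Yx false i%:R 1) =
    (1 + i%:R * eps2) *: chev_x ucX false i%:R
    + hbar *: uc_series (fun s =>
        \sum_(1 <= k < i.+1) E k i s%:Z * E i.+1 k (- s%:Z)
        + \sum_(i.+1 <= k < N.+1) E k i (s%:Z + 1) * E i.+1 k (- s%:Z - 1))
}.

Section Elements.
Variables (omega : Y -> Y) (iota : Usl K N -> Y).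

Local Notation EY i j s := (iota (slX (Emx K N i j) s)).
Local Notation hY i s := (iota (slX (Emx K N i i - Emx K N i.+1 i.+1) s)).
Local Notation T i m := (Tw (wgt_elt i m)).

Definition R_elt (m : nat) : Y :=
  (-1) ^+ m.-1 *: (\sum_(i : 'Z_N) Yx true i 0 * T i m (Yx true (i - 1) 0))
  + \sum_(1 <= p < m) \sum_(1 <= i < N) \sum_(i <= j < N)
      hY i p%:Z * hY j (m%:Z - p%:Z)
  - \sum_(p \in [set p : int | - m%:Z + 2 <= p <= m%:Z - 1])
      (EY 1 N (p - 1) * EY N 1 (m%:Z - p + 1)
       + \sum_(0 <= i < N.-1) EY i.+2 i.+1 p * EY i.+1 i.+2 (m%:Z - p))
  + \sum_(p \in [set p : int | - m%:Z + 2 <= p <= 0])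
      (EY 1 N.-1 (p - 1) * EY N.-1 1 (m%:Z - p + 1)
       + EY 2 N (p - 1) * EY N 2 (m%:Z - p + 1)
       + \sum_(0 <= i < N.-2)
           EY i.+3 i.+1 p * EY i.+1 i.+3 (m%:Z - p)).

Definition a_elt (m : int) : Y :=
  eps2^-1 *:
    (if 0 < m then
       (-1) ^ (m - 1) *:
         (\sum_(i : 'Z_N) commr (Yx true i 0) (T i `|m|%N (Yx true (i - 1) 1)))
       - hbar *: R_elt `|m|%N
     else if m == 0 then
       \sum_(i : 'Z_N) Yht1 eps1 eps2 i - (c + hbar / 2 * c ^+ 2) *: (1 : Y)
     else
       (-1) ^ (m - 1) *:
         (\sum_(i : 'Z_N) commr (T i `|m|%N (Yx false (i - 1) 1)) (Yx false i 0))
       - hbar *: omega (R_elt `|m|%N)).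

End Elements.
End Data.

(* Main.v *)
(** Index the affine matrix units by pairs of integers, [e a b] being
    [E_{a0,b0}(q - p)] for [a = a0 + N p] and [b = b0 + N q] with [a0, b0] in
    [1, N]. After a shift of the diagonal elements by scalars, the bracket becomes
    that of infinite matrices, and [T_w] acts, up to a sign, by the affine
    permutation [w] of the indices. So [ev (T_w x_{j,1})] is again a linear term
    plus a quadratic series, whose terms are permuted by [w]. The commutator with a
    simple root vector turns the sum over [j] of these series into a difference of
    two shifted copies of one series; it telescopes, the boundary terms being those
    of [R_m], while the linear terms sum by parts to [eps2 * 1(m)] since
    [hbar c = N eps2]. For [m < 0] the same computation takes place in the opposite
    algebra, reached through [omega]. Finally [1(s)] together with the image of
    [sl_N^] yields all matrix units. *)

From HB Require Import structures.
From mathcomp Require Import fingroup perm boolp classical_sets zify ring generic_quotient fsbigop monalg.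
Require Import Defs.
From mathcomp Require Import all_boot all_order all_algebra.
From mathcomp Require Import reals complex.
From Stdlib Require Setoid Ncring Ncring_tac.

Set Implicit Arguments.
Unset Strict Implicit.
Unset Printing Implicit Defensive.

Import Order.TTheory GRing.Theory Num.Theory.
Local Open Scope ring_scope.

(** * Affine permutations and reduced words *)

(** [Tw] is computed from a reduced word that is merely chosen. What evaluation sees of a word is an
    affine permutation and a sign; both are shown to depend on w alone, the sign being a parity of
    inversions. The exponential of ad x_i is multiplicative only where ad x_i is nilpotent, while
    the image of x_{i,1} is an infinite series. In the target it is replaced by its truncation at
    order 6, which is additive and continuous on the whole ring and agrees with the exponential on
    products of two matrix units, hence on their limits. The scalars removed from the diagonal come
    back as the only failure of periodicity, e(a+N, a+N) = e(a, a) - c. Sums over the cycle of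
    indices close up except for this jump; the weights 1 + i eps2 fail to close up by N eps2, and
    hbar c = N eps2 makes the two defects cancel. The computation takes place in a ring with a
    central scalar map and an abstract notion of null sequence, since these axioms survive the
    passage to the opposite ring. *)

Section AffinePermutations.
Context (N : nat) (N3 : (2 < N)%N).
Local Notation Z := 'Z_N.
Implicit Types (a b x y k : int) (i p q r : Z) (s : seq Z).

Lemma Zp_intE k : (k%:~R == 0 :> Z) = (N%:Z %| k)%Z.
Proof.
have N1 : (1 < N)%N by lia.
suff h (n : nat) : (n%:R == 0 :> Z) = (N %| n)%N.
  case: k => k; first by rewrite -pmulrn h.
  by rewrite NegzE mulrNz oppr_eq0 -pmulrn h dvdzE.
by rewrite -val_eqE /= val_Zp_nat.
Qed.

Lemma Zp_int_eqE a b : (a%:~R == b%:~R :> Z) = (N%:Z %| a - b)%Z.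
Proof. by rewrite -Zp_intE rmorphB subr_eq0. Qed.

Lemma Zp_intP a b : reflect (exists k, a = b + N%:Z * k) (a%:~R == b%:~R :> Z).
Proof.
rewrite Zp_int_eqE; apply: (iffP dvdzP) => -[k h]; exists k; lia.
Qed.

Lemma Zp_int_modulus k : (N%:Z * k)%:~R = 0 :> Z.
Proof. by apply/eqP; rewrite Zp_intE dvdz_mulr. Qed.

Lemma Zp_intDN a k : (a + N%:Z * k)%:~R = a%:~R :> Z.
Proof. by rewrite rmorphD /= Zp_int_modulus addr0. Qed.

Lemma Zp_valE i : (i : nat)%:Z%:~R = i.
Proof. by rewrite -pmulrn natr_Zp. Qed.

Lemma Zp_int_small k : `|k| < N%:Z -> (k%:~R == 0 :> Z) = (k == 0).
Proof.
move=> hk; rewrite Zp_intE; apply/idP/eqP => [/dvdzP[q E]|->]; last exact: dvdz0.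
by case: (eqVneq q 0) E => [->|q0] E; [rewrite E mul0r|nia].
Qed.

(** The simple reflection s_i as a permutation of the integers that commutes with translation by
    N. *)
Definition sp i a : int :=
  if a%:~R == i then a + 1 else if a%:~R == i + 1 then a - 1 else a.

Lemma Zp_S_neq i : (i + 1 == i) = false.
Proof.
rewrite -[X in _ == X]addr0 (inj_eq (addrI i)) -(mulr1z (1 : Z)).
by rewrite Zp_int_small //; lia.
Qed.

Lemma sp_perm i a : (sp i a)%:~R = tperm i (i + 1) a%:~R :> Z.
Proof.
rewrite /sp; case: eqP => [h|/eqP h1]; first by rewrite h tpermL rmorphD /= h.
case: eqP => [h|/eqP h2]; first by rewrite h tpermR rmorphB /= h addrK.
by rewrite tpermD // eq_sym.
Qed.

Lemma spDN i a k : sp i (a + N%:Z * k) = sp i a + N%:Z * k.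
Proof. by rewrite /sp Zp_intDN; do 2?case: ifP => _; lia. Qed.

Lemma spK i : involutive (sp i).
Proof.
move=> a; rewrite {1}/sp sp_perm.
case: (eqVneq (a%:~R : Z) i) => [h|h1].
  by rewrite h tpermL Zp_S_neq eqxx /sp h eqxx; lia.
case: (eqVneq (a%:~R : Z) (i + 1)) => [h|h2].
  by rewrite h tpermR eqxx /sp h Zp_S_neq eqxx; lia.
rewrite tpermD; [|by rewrite eq_sym|by rewrite eq_sym].
by rewrite (negPf h1) (negPf h2) /sp (negPf h1) (negPf h2).
Qed.

(** The largest k with y + N k <= x: it locates x among the translates of y. *)
Definition fl x y : int := ((x - y) %/ N%:Z)%Z.

Lemma flE x y k : 0 <= x - y - k * N%:Z < N%:Z -> fl x y = k.
Proof.
move=> h; rewrite /fl; have -> : x - y = k * N%:Z + (x - y - k * N%:Z) by lia.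
by rewrite divzMDl ?divz_small ?addr0 //; lia.
Qed.

Lemma fl_bound x y : 0 <= x - y - fl x y * N%:Z < N%:Z.
Proof.
have := divz_eq (x - y) N%:Z; have := @modz_ge0 (x - y) N%:Z.
have := @ltz_mod (x - y) N%:Z; rewrite /fl; lia.
Qed.

Lemma flDN x y k l : fl (x + N%:Z * k) (y + N%:Z * l) = fl x y + k - l.
Proof. by apply: flE; have := fl_bound x y; nia. Qed.

Lemma fl_anti x y : x%:~R != y%:~R :> Z -> fl y x = -1 - fl x y.
Proof.
rewrite Zp_int_eqE => h; apply: flE; have := fl_bound x y.
suff : x - y - fl x y * N%:Z != 0 by nia.
apply: contra h => /eqP h; apply/dvdzP; exists (fl x y); lia.
Qed.

(** Swapping neighbours moves x - y across a multiple of N only when x and y lie in the two classes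
    that are swapped. *)
Lemma fl_sp i x y : fl (sp i x) (sp i y) =
  fl x y + ((x%:~R == i) && (y%:~R == i + 1))%:Z
         - ((x%:~R == i + 1) && (y%:~R == i))%:Z.
Proof.
have b := fl_bound x y; set d := fl x y in b *.
have key (k : int) : `|k| <= 1 -> x - y - d * N%:Z - k = 0 \/
    x - y - d * N%:Z - k = N%:Z -> x%:~R = y%:~R + k%:~R :> Z.
  move=> hk h; apply/eqP; rewrite -rmorphD Zp_int_eqE.
  by case: h => h; apply/dvdzP; [exists d|exists (d + 1)]; lia.
have k0 := key 0 isT; have k1 := key 1 isT; have k2 := key (-1) isT.
have N1 := Zp_S_neq i.
have N1' : (i == i + 1) = false by rewrite eq_sym.
rewrite /sp.
have [xi|xi] := eqVneq (x%:~R : Z) i; [|have [xi1|xi1] := eqVneq (x%:~R : Z) (i + 1)];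
  (have [yi|yi] := eqVneq (y%:~R : Z) i; [|have [yi1|yi1] := eqVneq (y%:~R : Z) (i + 1)]);
  rewrite ?xi ?yi ?xi1 ?yi1 ?eqxx ?N1 ?N1' ?andbF /=.
- by apply: flE; lia.
- have : x%:~R == (y - 1)%:~R :> Z by rewrite rmorphB /= xi yi1 addrK.
  move=> /Zp_intP[k hk].
  suff : d = k - 1 by move=> ->; apply: flE; nia.
  by apply: flE; nia.
- apply: flE.
  have h1 : x - y - d * N%:Z + 1 <> N%:Z.
    move=> h; case/eqP: yi1; have := k2 (or_intror _); rewrite xi => ->; last lia.
    by rewrite mulrN1z subrK.
  lia.
- have : x%:~R == (y + 1)%:~R :> Z by rewrite rmorphD /= xi1 yi.
  move=> /Zp_intP[k hk].
  suff : d = k by move=> ->; apply: flE; nia.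
  by apply: flE; nia.
- by apply: flE; lia.
- apply: flE.
  have h1 : x - y - d * N%:Z <> 0.
    move=> h; case/eqP: yi1; have := k0 (or_introl _); rewrite xi1 => ->; last lia.
    by rewrite addr0.
  lia.
- apply: flE.
  have h1 : x - y - d * N%:Z <> 0.
    move=> h; case/eqP: xi; rewrite (k0 (or_introl _)) ?yi ?addr0 //; lia.
  lia.
- apply: flE.
  have h1 : x - y - d * N%:Z + 1 <> N%:Z.
    move=> h; case/eqP: xi; rewrite (k2 (or_intror _)) ?yi1 ?mulrN1z ?addrK //; lia.
  lia.
by rewrite addr0 subr0.
Qed.

(** The induced permutation u of the residues is carried along because it gives preimages of classes
    without an inverse of f. *)
Definition affine_perm (f : int -> int) (u : {perm Z}) : Prop :=
  (forall a k, f (a + N%:Z * k) = f a + N%:Z * k)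
  /\ forall a, (f a)%:~R = u a%:~R :> Z.

Definition rep i : int := (i : nat)%:Z.

Lemma repE i : (rep i)%:~R = i. Proof. exact: Zp_valE. Qed.

Lemma repP a : exists k, a = rep a%:~R + N%:Z * k.
Proof. by apply/Zp_intP; rewrite repE. Qed.

(** For an affine permutation f and a, b in different classes, this is the number of translates of b
    above a whose images lie below f a; a negative value counts the inversions the other way
    round. *)
Definition descent_shift (f : int -> int) a b : int := fl (f a) (f b) - fl a b.
Local Notation D := descent_shift.

Definition pos (k : int) : nat := if k is Posz n then n else 0.

(* For an affine permutation [f], the number of [b > a] with [f b < f a]. *)
Definition inversions (f : int -> int) a : nat := \sum_(r : Z) pos (D f a (rep r)).
Definition affine_length (f : int -> int) : nat := \sum_(a : Z) inversions f (rep a).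

Section OneStep.
Variables (f : int -> int) (u : {perm Z}).
Hypothesis fu : affine_perm f u.

Lemma DDN a b k l : D f (a + N%:Z * k) (b + N%:Z * l) = D f a b.
Proof. by rewrite /descent_shift !fu.1 !flDN; lia. Qed.

Lemma D_rep a b : D f a b = D f (rep a%:~R) (rep b%:~R).
Proof. by have [k ->] := repP a; have [l ->] := repP b; rewrite DDN !Zp_intDN !repE. Qed.

Lemma D_sp i a b : D (sp i \o f) a b =
  D f a b + (((f a)%:~R == i) && ((f b)%:~R == i + 1))%:Z
         - (((f a)%:~R == i + 1) && ((f b)%:~R == i))%:Z.
Proof. by rewrite /descent_shift /= fl_sp; lia. Qed.

Lemma D_anti a b : a%:~R != b%:~R :> Z -> D f b a = - D f a b.
Proof.
move=> h; rewrite /descent_shift !(@fl_anti a b) // (@fl_anti (f a)); first lia.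
by rewrite !fu.2 (inj_eq perm_inj).
Qed.

Lemma affine_perm_comp i : affine_perm (sp i \o f) (u * tperm i (i + 1))%g.
Proof.
split=> [a k|a] /=; first by rewrite fu.1 spDN.
by rewrite sp_perm fu.2 permM.
Qed.

Local Notation pre i := (rep ((u^-1)%g i)).

Lemma pre_eq i a : ((f a)%:~R == i) = (a%:~R == (u^-1)%g i).
Proof. by rewrite fu.2 -{1}(permKV u i) (inj_eq perm_inj). Qed.

(** Only the two classes sent to i and i + 1 change their relative order, and the hypothesis says
    that they form an ascent. The new inversion is booked on the class sent to i. *)
Lemma inversions_ascent i a : 0 <= D f (pre i) (pre (i + 1)) ->
  inversions (sp i \o f) a = (inversions f a + ((f a)%:~R == i))%N.
Proof.
set p := (u^-1)%g i; set q := (u^-1)%g (i + 1) => d0.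
have pq : p != q by rewrite (inj_eq perm_inj) eq_sym Zp_S_neq.
have qp : (q == p) = false by rewrite eq_sym; exact: negPf.
have Dqp : D f (rep q) (rep p) <= 0 by rewrite (@D_anti (rep p)) ?repE //; lia.
rewrite /inversions (bigD1 q) //= [in RHS](bigD1 q) //= addnAC; congr (_ + _)%N.
  rewrite D_sp !pre_eq repE -/p -/q eqxx qp !andbT andbF subr0.
  case: eqP => [ap|_]; last by rewrite addr0 addn0.
  by rewrite (D_rep a) ap repE; move: d0; case: (D f _ _) => n; rewrite /= ?addn1; lia.
apply: eq_bigr => r rq; rewrite D_sp !pre_eq repE -/p -/q (negPf rq) andbF addr0.
have [/andP[/eqP aq /eqP rp]|_] := boolP (_ && _); last by rewrite subr0.
rewrite (D_rep a) aq rp repE; case: (D f _ _) Dqp => // -[] //.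
Qed.

End OneStep.

(** The ascent case applied to s_i f, as s_i is an involution. *)
Lemma inversions_descent f u i a : affine_perm f u ->
  D f (rep ((u^-1)%g i)) (rep ((u^-1)%g (i + 1))) < 0 ->
  inversions f a = (inversions (sp i \o f) a + ((f a)%:~R == i + 1)%R)%N.
Proof.
move=> fu d0; have fu' := affine_perm_comp fu i.
have E : f =1 sp i \o (sp i \o f) by move=> x /=; rewrite spK.
have -> : inversions f a = inversions (sp i \o (sp i \o f)) a.
  by apply: eq_bigr => r _; rewrite /descent_shift !E.
rewrite (inversions_ascent fu'); last first.
  rewrite invMg tpermV !permM tpermL tpermR D_sp // !(fu.2, repE, permKV).
  rewrite !eqxx Zp_S_neq eq_sym Zp_S_neq addr0 (@D_anti _ u) ?repE //=; first by move: d0; case: (D f _ _) => n; lia.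
  by rewrite (inj_eq perm_inj) eq_sym Zp_S_neq.
by congr (_ + nat_of_bool _)%N; rewrite /= sp_perm (can2_eq (tpermK _ _) (tpermK _ _)) tpermL.
Qed.

Lemma sum_preim f u i : affine_perm f u ->
  (\sum_(a : Z) ((f (rep a))%:~R == i) = 1)%N.
Proof.
move=> fu; rewrite (bigD1 ((u^-1)%g i)) //= big1 => [|r /negPf h].
  by rewrite (pre_eq fu) repE eqxx.
by rewrite (pre_eq fu) repE h.
Qed.

Lemma affine_length_step f u i : affine_perm f u ->
  let d := D f (rep ((u^-1)%g i)) (rep ((u^-1)%g (i + 1))) in
  if 0 <= d then affine_length (sp i \o f) = (affine_length f).+1
  else affine_length f = (affine_length (sp i \o f)).+1.
Proof.
move=> fu d; case: ifP => [d0|/negbT]; last rewrite -ltNge => d0.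
  rewrite -addn1 -(sum_preim i fu) -big_split.
  by apply: eq_bigr => a _; rewrite (inversions_ascent fu).
rewrite -addn1 -(sum_preim (i + 1) fu) -big_split.
by apply: eq_bigr => a _; rewrite (inversions_descent _ fu d0).
Qed.

(** Degree zero singles out the products of the [sp i] among all affine permutations; it excludes
    the shifts a -> a + k. *)
Definition degree (f : int -> int) : int := \sum_(a : Z) (f (rep a) - rep a).

Lemma degree_sp f u i : affine_perm f u -> degree (sp i \o f) = degree f.
Proof.
move=> fu; apply/eqP; rewrite -subr_eq0 -sumrB /=.
rewrite (eq_bigr (fun a : Z => ((f (rep a))%:~R == i)%:Z - ((f (rep a))%:~R == i + 1)%:Z)).
  by rewrite sumrB -!(big_morph Posz PoszD (erefl 0)) !(sum_preim _ fu).
move=> a _; rewrite /sp; case: eqP => [->|_].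
  by rewrite eq_sym Zp_S_neq; lia.
by case: eqP => _; lia.
Qed.

(** Without descents the inverse of f is increasing. It advances by N over N steps, so each step is
    exactly 1 and f is a shift; degree zero makes the shift trivial. *)
Lemma affine_perm_id_of_ascents f u : affine_perm f u -> degree f = 0 ->
  (forall i, 0 <= D f (rep ((u^-1)%g i)) (rep ((u^-1)%g (i + 1)))) -> f =1 id.
Proof.
move=> fu f0 asc.
(* The inverse of f: [u^-1] finds the class of the preimage, then the multiple of N by which f
   misses x is subtracted. *)
pose g (x : int) : int := rep ((u^-1)%g x%:~R) - (f (rep ((u^-1)%g x%:~R)) - x).
have fK x : f (g x) = x.
  have : (f (rep ((u^-1)%g x%:~R)))%:~R == x%:~R :> Z by rewrite fu.2 repE permKV.
  case/Zp_intP => k; rewrite /g => hk.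
  have -> : f (rep ((u^-1)%g x%:~R)) - x = N%:Z * k by rewrite hk addrC addKr.
  by rewrite -mulrN fu.1 hk mulrN addrK.
have gmod x : (g x)%:~R = (u^-1)%g x%:~R :> Z.
  by apply/eqP; rewrite -(pre_eq fu) fK.
have gDN x k : g (x + N%:Z * k) = g x + N%:Z * k.
  by rewrite /g Zp_intDN; move: (rep _) => y; lia.
have gS x : g x < g (x + 1).
  have hx : x%:~R + 1 = (x + 1)%:~R :> Z by rewrite rmorphD.
  have := asc x%:~R; rewrite hx -!gmod -(D_rep fu).
  rewrite /descent_shift !fK (@flE x (x + 1) (-1)); last lia.
  have := fl_bound (g x) (g (x + 1)); nia.
have gD x (n : nat) : g x + n%:Z <= g (x + n%:Z).
  elim: n => [|n IH]; first by rewrite !addr0.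
  by have -> : x + n.+1%:Z = x + n%:Z + 1; [lia|have := gS (x + n%:Z); lia].
have gS1 x : g (x + 1) = g x + 1.
  have := gD (x + 1) N.-1; have -> : x + 1 + N.-1%:Z = x + N%:Z * 1 by lia.
  by rewrite gDN; have := gS x; lia.
have gE x : g x = x + g 0.
  elim/int_ind: x => [|n IH|n IH]; first by rewrite add0r.
    by have -> : n.+1%:Z = n%:Z + 1; [lia|rewrite gS1 IH; lia].
  by have := gS1 (- n.+1%:Z); have -> : - n.+1%:Z + 1 = - n%:Z; [lia|rewrite IH; lia].
have fE x : f x = x - g 0.
  by rewrite -[X in f X](subrK (g 0)) -gE fK.
suff : g 0 = 0 by move=> g0 x; rewrite fE g0 subr0.
move: f0; rewrite /degree (eq_bigr (fun=> - g 0)) => [|a _]; last by rewrite fE; lia.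
rewrite sumr_const card_ord (Zp_cast (ltnW N3)); lia.
Qed.

Fixpoint pw s a : int := if s is i :: s' then sp i (pw s' a) else a.

Lemma affine_perm_pw s : exists u, affine_perm (pw s) u.
Proof.
elim: s => [|i s [u IH]]; first by exists 1%g; split=> // a; rewrite perm1.
by exists (u * tperm i (i + 1))%g; exact: affine_perm_comp.
Qed.

Lemma affine_length_id f : f =1 id -> affine_length f = 0%N.
Proof.
move=> fE; rewrite /affine_length big1 // => a _; rewrite /inversions big1 // => r _.
by rewrite /descent_shift !fE subrr.
Qed.

Lemma degree_pw s : degree (pw s) = 0.
Proof.
elim: s => [|i s IH]; first by rewrite /degree big1 // => a _; rewrite subrr.
by have [u hu] := affine_perm_pw s; rewrite -IH -(degree_sp i hu).
Qed.

(** Removing a descent lowers the length by one, and only the identity has no descent. Together with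
    [affine_length_pw] this identifies the number of inversions with the Coxeter length. *)
Lemma affine_perm_word f u : affine_perm f u -> degree f = 0 ->
  exists2 s, pw s =1 f & size s = affine_length f.
Proof.
move: {2}(affine_length f).+1 (ltnSn (affine_length f)) => n.
elim: n f u => // n IH f u hn fu f0.
have [/forallP asc|] := boolP [forall i, 0 <= D f (rep ((u^-1)%g i)) (rep ((u^-1)%g (i + 1)))].
  have fE := affine_perm_id_of_ascents fu f0 asc.
  by exists [::] => [x|]; rewrite ?fE ?(affine_length_id fE).
rewrite negb_forall => /existsP[i hi].
have := affine_length_step i fu; rewrite /= (negPf hi) => E.
have [||s sE sz] := IH (sp i \o f) _ _ (affine_perm_comp fu i).
- by move: hn; rewrite E.
- by rewrite (degree_sp i fu).
exists (i :: s) => [x|]; first by rewrite /= sE /= spK.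
by rewrite /= sz E.
Qed.

(** The sign that the product of the T_i attaches to the index a: each letter i reached at a value
    congruent to i contributes -1, as in [Top_e]. *)
Fixpoint word_sign s a : bool :=
  if s is i :: s' then word_sign s' a (+) ((pw s' a)%:~R == i) else false.

Lemma affine_length_pw s : (affine_length (pw s) <= size s)%N.
Proof.
elim: s => [|i s IH]; first by rewrite affine_length_id.
have [u fu] := affine_perm_pw s.
have := affine_length_step i fu; rewrite /=; case: ifP => _; rewrite -/(pw (i :: s)) => E.
  by rewrite E ltnS.
by rewrite -ltnS -E; apply: leq_trans IH _; exact: leqW.
Qed.

(** In a word of minimal length every letter is an ascent, and then [inversions_ascent] adds an
    inversion exactly when [word_sign] flips. So the sign depends on the permutation and not on the
    word. *)
Lemma word_sign_minimal s a : size s = affine_length (pw s) ->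
  word_sign s a = odd (inversions (pw s) a).
Proof.
elim: s => [|i s IH] /= sz.
  by rewrite /inversions big1 // => r _; rewrite /descent_shift subrr.
have [u fu] := affine_perm_pw s.
have := affine_length_step i fu; rewrite /=.
have h := affine_length_pw s.
case: ifP => d; rewrite /comp /= -sz => E; last by lia.
rewrite IH; last by case: E.
by rewrite (inversions_ascent fu) // oddD oddb.
Qed.

End AffinePermutations.

(** * The affine Weyl group on the root lattice, read as affine permutations *)

Section RootLatticeAction.
Context (N : nat) (N3 : (2 < N)%N).
Local Notation Z := 'Z_N.
Local Notation fl := (fl N).
Implicit Types (a b x y k : int) (i p q r : Z) (s : seq Z).

Lemma sum_Zp (V : nmodType) (F : Z -> V) (j : int) :
  \sum_(r : Z) F r = \sum_(0 <= k < N) F (j + k%:Z)%:~R.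
Proof.
rewrite (reindex_inj (addrI (j%:~R : Z))) /=.
rewrite -[X in \sum_(0 <= k < X) _](Zp_cast (ltnW N3)) big_mkord.
by apply: eq_bigr => r _; rewrite rmorphD /= Zp_valE.
Qed.

Section RootLattice.
Local Notation lattice := {ffun Z -> int}.

Lemma fl_pred x y : fl x y = fl (x - 1) y + (x%:~R == y%:~R :> Z)%:Z.
Proof.
case: (Zp_intP N3 x y) => [[k ->]|h].
  by rewrite (@flE N N3 _ y k) ?(@flE N N3 _ y (k - 1)) //; lia.
rewrite addr0; apply: (flE N3); have := (fl_bound N3) (x - 1) y.
have [E|] := eqVneq (x - 1 - y - fl (x - 1) y * N%:Z) (N%:Z - 1); last lia.
by case: h; exists (fl (x - 1) y + 1); lia.
Qed.

(* [alpha_a = eps_a - eps_(a+1)] with [eps_(a+N) = eps_a - delta]. *)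
Definition eps_vec a : lattice := [ffun j => - fl (a - 1) (rep j)].

Lemma eps_vecS a : eps_vec a - eps_vec (a + 1) = alpha a%:~R.
Proof.
apply/ffunP => j; rewrite !ffunE addrK (fl_pred a) repE eq_sym.
by rewrite opprK addKr.
Qed.

Lemma deltaE j : delta N j = 1.
Proof.
rewrite /delta sum_ffunE (bigD1 j) //= big1 => [|i hi]; rewrite !ffunE ?eqxx //.
by rewrite eq_sym (negPf hi).
Qed.

Lemma eps_vecDN a k : eps_vec (a + N%:Z * k) = eps_vec a - delta N *~ k.
Proof.
apply/ffunP => j; rewrite !ffunE ffunMzE deltaE.
have -> : a + N%:Z * k - 1 = (a - 1) + N%:Z * k by lia.
by have := (flDN N3) (a - 1) (rep j) k 0; rewrite mulr0 addr0 => ->; lia.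
Qed.

Lemma root_form_alpha i (v : lattice) :
  root_form (alpha i) v = \sum_k cartan_a i k * v k.
Proof.
rewrite /root_form (bigD1 i) //= [X in _ + X]big1 => [|p hp].
  by rewrite addr0; apply: eq_bigr => k _; rewrite ffunE eqxx mul1r.
by apply: big1 => k _; rewrite ffunE (negPf hp) !mul0r.
Qed.

(** The pairing of alpha_i with eps_a. *)
Definition psi i a : int := (a%:~R == i)%:Z - (a%:~R == i + 1)%:Z.

Lemma Zp_addn_eq (i : Z) (k l : nat) : (k < N)%N -> (l < N)%N ->
  (i + k%:R == i + l%:R) = (k == l).
Proof.
move=> kN lN; rewrite (inj_eq (addrI i)) -subr_eq0 !pmulrn -rmorphB /=.
by rewrite (Zp_int_small N3) //; lia.
Qed.

Lemma cartan_psi i a : cartan_a i a%:~R = psi i a - psi i (a + 1).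
Proof.
rewrite /cartan_a /psi rmorphD /=; move: (a%:~R : Z) => j.
have h2 : (i + 1 + 1 == i) = false.
  have := @Zp_addn_eq i 2 0; rewrite addr0 mulr2n addrA => ->; lia.
rewrite (inj_eq (addIr 1)) [i == j - 1]eq_sym subr_eq [i == j]eq_sym [i == j + 1]eq_sym.
case: (eqVneq j i) => [->|h]; first by rewrite ![i == _]eq_sym (Zp_S_neq N3).
case: (eqVneq j (i + 1)) => [->|h']; first by rewrite h2.
by rewrite orbF; case: eqP.
Qed.

Lemma root_form_sub i (v w : lattice) :
  root_form (alpha i) (v - w) = root_form (alpha i) v - root_form (alpha i) w.
Proof.
rewrite !root_form_alpha -sumrB; apply: eq_bigr => k _.
by rewrite !ffunE mulrBr.
Qed.

Lemma int_const (V : zmodType) (f : int -> V) : (forall a, f a = f (a + 1)) ->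
  forall a b, f a = f b.
Proof.
move=> h; suff h0 a : f a = f 0 by move=> a b; rewrite !h0.
elim/int_ind: a => [|n IH|n IH] //.
  by rewrite -IH [RHS]h; congr f; lia.
by rewrite -IH [LHS]h; congr f; lia.
Qed.

(** A single eps_a sits in the root lattice only by a choice of origin, so the pairing is controlled
    on differences: both sides have the same increments by [cartan_psi]. *)
Lemma root_form_eps i a b :
  root_form (alpha i) (eps_vec a - eps_vec b) = psi i a - psi i b.
Proof.
pose f (x : int) := root_form (alpha i) (eps_vec x) - psi i x.
have /int_const/(_ a b) : forall x, f x = f (x + 1).
  move=> x; suff : root_form (alpha i) (eps_vec x - eps_vec (x + 1))
      = psi i x - psi i (x + 1) by rewrite /f root_form_sub; lia.
  rewrite eps_vecS root_form_alpha (bigD1 x%:~R) //= big1 => [|k hk].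
    by rewrite ffunE eqxx mulr1 addr0 cartan_psi.
  by rewrite ffunE (negPf hk) mulr0.
by rewrite /f root_form_sub; lia.
Qed.

Lemma eps_vec_sp i a : eps_vec (sp i a) = eps_vec a - alpha i *~ psi i a.
Proof.
rewrite /sp /psi; case: eqP => [h|_].
  by rewrite -h eq_sym (Zp_S_neq N3) mulr1z -eps_vecS subKr.
case: eqP => [h|_]; last by rewrite subrr mulr0z subr0.
have -> : i = (a - 1)%:~R by rewrite rmorphB /= h addrK.
by rewrite sub0r mulrN1z opprK -eps_vecS [a - 1 + 1]subrK addrCA subrr addr0.
Qed.

Lemma simple_refl_eps i a b :
  simple_refl i (eps_vec a - eps_vec b) = eps_vec (sp i a) - eps_vec (sp i b).
Proof.
rewrite /simple_refl root_form_eps !eps_vec_sp.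
move: (eps_vec a) (eps_vec b) (alpha i) => u v w; apply/ffunP => j.
by rewrite !(ffunE, ffunMzE, mulrzz); ring.
Qed.

Lemma word_act_eps s a b :
  word_act s (eps_vec a - eps_vec b) = eps_vec (pw s a) - eps_vec (pw s b).
Proof. by elim: s => //= i s ->; rewrite simple_refl_eps. Qed.

Lemma root_formNl (u v : lattice) : root_form (- u) v = - root_form u v.
Proof.
rewrite /root_form -sumrN; apply: eq_bigr => i _; rewrite -sumrN.
by apply: eq_bigr => j _; rewrite !ffunE !mulNr.
Qed.

(** The translation by -alpha_i: class i moves down by N and class i + 1 moves up by N. *)
Definition shift_perm i a : int := a - N%:Z * psi i a.

Lemma transl_eps i a b : transl (- alpha i) (eps_vec a - eps_vec b) =
  eps_vec (shift_perm i a) - eps_vec (shift_perm i b).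
Proof.
rewrite /transl root_formNl root_form_eps /shift_perm -!mulrN !eps_vecDN.
move: (eps_vec a) (eps_vec b) (delta N) => u v w; apply/ffunP => j.
by rewrite !(ffunE, ffunMzE, mulrzz); ring.
Qed.

Definition w_word i : seq Z := [seq i + n%:R | n <- iota 1 (N - 2)].

Definition w_perm i (m : nat) a : int :=
  iter m.-1 (shift_perm (i + 1)) (pw (w_word i) a).

Lemma wgt_elt_eps i m a b :
  wgt_elt i m (eps_vec a - eps_vec b) = eps_vec (w_perm i m a) - eps_vec (w_perm i m b).
Proof.
rewrite /wgt_elt /w_perm word_act_eps.
by elim: m.-1 => //= n ->; rewrite transl_eps.
Qed.

Lemma psiDN i a k : psi i (a + N%:Z * k) = psi i a.
Proof. by rewrite /psi (Zp_intDN N3). Qed.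

Lemma iter_shift_perm i n a :
  iter n (shift_perm i) a = a - N%:Z * (n%:Z * psi i a).
Proof.
elim: n => [|n IH]; first by rewrite mul0r mulr0 subr0.
by rewrite iterS IH {1}/shift_perm -mulrN psiDN; lia.
Qed.

Lemma affine_perm_shift i f (u : {perm Z}) : affine_perm f u -> affine_perm (shift_perm i \o f) u.
Proof.
move=> fu; split=> [a k|a]; rewrite /= /shift_perm.
  by rewrite fu.1 psiDN; lia.
by rewrite -mulrN (Zp_intDN N3) fu.2.
Qed.

Lemma degree_shift i f (u : {perm Z}) : affine_perm f u ->
  degree N (shift_perm i \o f) = degree N f.
Proof.
move=> fu; apply/eqP; rewrite -subr_eq0 -sumrB /=.
rewrite (eq_bigr (fun a : Z => (- N%:Z) * psi i (f (rep a)))) => [|a _].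
  by rewrite -mulr_sumr sumrB -!(big_morph Posz PoszD (erefl 0)) !(sum_preim _ fu) subrr mulr0.
by rewrite /shift_perm; lia.
Qed.

Lemma affine_perm_w i m : exists u : {perm Z}, affine_perm (w_perm i m) u.
Proof.
have [u hu] := affine_perm_pw N3 (w_word i); exists u; rewrite /w_perm.
by elim: m.-1 => [|n IH] //; exact: (affine_perm_shift (i + 1) IH).
Qed.

Lemma degree_w i m : degree N (w_perm i m) = 0.
Proof.
rewrite -(degree_pw N3 (w_word i)) /w_perm.
have [u hu] := affine_perm_pw N3 (w_word i).
suff [] : affine_perm (fun a => iter m.-1 (shift_perm (i + 1)) (pw (w_word i) a)) u
    /\ degree N (fun a => iter m.-1 (shift_perm (i + 1)) (pw (w_word i) a)) = degree N (pw (w_word i)) by [].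
elim: m.-1 => [|n [IH1 IH2]] //; split; first exact: (affine_perm_shift (i + 1) IH1).
by rewrite -IH2; exact: (degree_shift (i + 1) IH1).
Qed.

Lemma zmod_morphism_alpha (f g : lattice -> lattice) :
  zmod_morphism f -> zmod_morphism g -> (forall i, f (alpha i) = g (alpha i)) -> f =1 g.
Proof.
move=> hf hg fg v.
pose fa : {additive lattice -> lattice} :=
  HB.pack f (GRing.isZmodMorphism.Build _ _ f hf).
pose ga : {additive lattice -> lattice} :=
  HB.pack g (GRing.isZmodMorphism.Build _ _ g hg).
have -> : v = \sum_i alpha i *~ v i.
  apply/ffunP => j; rewrite sum_ffunE (bigD1 j) //= big1 => [|i hi].
    by rewrite !(ffunE, ffunMzE, mulrzz) eqxx mul1r addr0.
  by rewrite !(ffunE, ffunMzE, mulrzz) eq_sym (negPf hi) mul0r.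
rewrite -[LHS]/(fa _) -[RHS]/(ga _) !raddf_sum; apply: eq_bigr => i _.
by rewrite !raddfMz /= fg.
Qed.

Lemma word_act_zmod s : zmod_morphism (word_act s).
Proof.
elim: s => [|i s IH] v w //=; rewrite IH /simple_refl root_form_sub.
move: (word_act s v) (word_act s w) (alpha i) => x y z; apply/ffunP => j.
by rewrite !(ffunE, ffunMzE, mulrzz); ring.
Qed.

Lemma root_formNs i (v w : lattice) : root_form (- alpha i) (v - w) =
  root_form (- alpha i) v - root_form (- alpha i) w.
Proof. by rewrite !root_formNl root_form_sub; ring. Qed.

Lemma wgt_elt_zmod i m : zmod_morphism (@wgt_elt N i m).
Proof.
move=> v w; rewrite /wgt_elt word_act_zmod; elim: m.-1 => //= n ->.
rewrite /transl root_formNs; set x := iter n _ _; set y := iter n _ _.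
by apply/ffunP => j; rewrite !(ffunE, ffunMzE, mulrzz); ring.
Qed.

Lemma word_act_w s i m : pw s =1 w_perm i m -> word_act s =1 wgt_elt i m.
Proof.
move=> h; apply: zmod_morphism_alpha; [exact: word_act_zmod|exact: wgt_elt_zmod|].
by move=> k; rewrite -(Zp_valE k) -eps_vecS word_act_eps wgt_elt_eps !h.
Qed.

(** The height recovers b - a from the root, so the action on the lattice determines an affine
    permutation up to a common shift, which [degree] then removes. *)
Lemma height_eps a b : \sum_j (eps_vec a - eps_vec b) j = b - a.
Proof.
pose f (x : int) := \sum_j eps_vec x j + x.
have /int_const/(_ a b) : forall x, f x = f (x + 1).
  move=> x; have : \sum_j (eps_vec x - eps_vec (x + 1)) j = 1.
    rewrite eps_vecS (bigD1 (x%:~R : Z)) //= big1 => [|j hj]; rewrite ffunE ?eqxx //.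
    by rewrite (negPf hj).
  rewrite (eq_bigr (fun j => eps_vec x j - eps_vec (x + 1) j)) => [|j _]; last by rewrite !ffunE.
  by rewrite sumrB /f => /eqP; rewrite subr_eq => /eqP ->; ring.
rewrite /f => h; rewrite (eq_bigr (fun j => eps_vec a j - eps_vec b j)) => [|j _]; last by rewrite !ffunE.
by rewrite sumrB -[X in X - _](addrK a) h; ring.
Qed.

Lemma affine_perm_height f g : degree N f = 0 -> degree N g = 0 ->
  (forall a b, f b - f a = g b - g a) -> f =1 g.
Proof.
move=> f0 g0 h.
have hc a : f a = g a + (f 0 - g 0) by have := h 0 a; lia.
suff : f 0 - g 0 = 0 by move=> h0 a; rewrite hc h0 addr0.
move: f0; rewrite /degree (eq_bigr (fun a : Z => (g (rep a) - rep a) + (f 0 - g 0))).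
  rewrite big_split /= -/(degree N g) g0 sumr_const card_ord (Zp_cast (ltnW N3)).
  by rewrite add0r => /eqP; rewrite mulrn_eq0 => /orP[/eqP|/eqP//]; lia.
by move=> a _; rewrite hc; lia.
Qed.

Definition Tw_word i m : seq Z := xget [::] [set s | reduced_expr (wgt_elt i m) s].

(** Whichever reduced word is chosen, its permutation and its signs are those of w. Comparison with
    the word from [affine_perm_word] shows that a word reduced for the lattice action is minimal for
    the permutation. *)
Lemma Tw_wordP i m : pw (Tw_word i m) =1 w_perm i m /\
  forall a, word_sign (Tw_word i m) a = odd (inversions N (w_perm i m) a).
Proof.
have [u hu] := affine_perm_w i m.
have [s0 s0E sz0] := affine_perm_word N3 hu (degree_w i m).
have [s1 s1r] : exists s, reduced_expr (wgt_elt i m) s.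
  pose P n := `[< exists2 s, word_act s =1 wgt_elt i m & size s = n >].
  have exP : exists n, P n.
    by exists (size s0); apply/asboolP; exists s0 => //; exact: word_act_w.
  case: (ex_minnP exP) => n /asboolP[s sE <-] hmin; exists s; split=> // s' s'E.
  by apply: hmin; apply/asboolP; exists s'.
rewrite /Tw_word; set s := xget _ _.
(* A shortest word exists, so [xget] does not fall back on its default [[::]]. *)
have [sE smin] : reduced_expr (wgt_elt i m) s.
  by apply: (@xgetPex _ [::] [set s | reduced_expr (wgt_elt i m) s]); exists s1.
have pE : pw s =1 w_perm i m.
  apply: affine_perm_height; [exact: degree_pw|exact: degree_w|move=> a b].
  by rewrite -!height_eps -word_act_eps sE wgt_elt_eps.
split=> // a.
have lenE : affine_length N (pw s) = affine_length N (w_perm i m).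
  apply: eq_bigr => x _; apply: eq_bigr => y _.
  by rewrite /descent_shift !pE.
rewrite (word_sign_minimal N3).
  by congr odd; apply: eq_bigr => y _; rewrite /descent_shift !pE.
apply/eqP; rewrite eqn_leq (affine_length_pw N3) andbT lenE -sz0.
by apply: smin; exact: word_act_w.
Qed.

End RootLattice.

(** * The permutation w(j + 1, m) on one period *)

Section TranslatedCoxeterElement.
Variables (j : int) (m : nat).
Hypothesis m0 : (0 < m)%N.
Local Notation i := ((j + 1)%:~R : Z).

Lemma Zp_near (x y : int) : `|x - y| < N%:Z -> (x%:~R == y%:~R :> Z) = (x == y).
Proof. by move=> h; rewrite -subr_eq0 -rmorphB (Zp_int_small N3) // subr_eq0. Qed.

(** A run of n consecutive reflections is a cycle on n + 1 neighbours: all go up by one and the last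
    returns to the first place. *)
Lemma pw_interval (p n : nat) (x : nat) : (0 < p)%N -> (p + n < N)%N -> (x < N)%N ->
  pw [seq i + l%:R | l <- iota p n] (j + 1 + x%:Z) =
  if (p <= x < p + n)%N then j + 1 + x%:Z + 1
  else if (x == p + n)%N then j + 1 + x%:Z - n%:Z else j + 1 + x%:Z.
Proof.
have spE (q : nat) (y : int) : (q.+1 < N)%N -> 0 <= y < N%:Z ->
    sp (i + q%:R) (j + 1 + y) =
    if y == q%:Z then j + 1 + y + 1 else if y == q%:Z + 1 then j + 1 + y - 1 else j + 1 + y.
  move=> qN yN; rewrite /sp.
  have -> : i + q%:R = (j + 1 + q%:Z)%:~R by rewrite [RHS]rmorphD /= pmulrn.
  have -> : (j + 1 + q%:Z)%:~R + 1 = (j + 1 + (q%:Z + 1))%:~R :> Z by rewrite addrA [RHS]rmorphD.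
  by rewrite !Zp_near ?(inj_eq (addrI _)) //; lia.
elim: n p => [|n IH] p p0 pn xN.
  by rewrite addn0 subr0 /=; case: ifP => [|_]; [lia|case: ifP].
rewrite /= IH //; last lia.
case: ifP => h1; [|case: ifP => h2].
- have -> : j + 1 + x%:Z + 1 = j + 1 + (x%:Z + 1) by lia.
  by rewrite spE; do ?case: ifP => ?; lia.
- have -> : j + 1 + x%:Z - n%:Z = j + 1 + (x%:Z - n%:Z) by lia.
  by rewrite spE; do ?case: ifP => ?; lia.
by rewrite spE; do ?case: ifP => ?; lia.
Qed.

Lemma w_permE a : w_perm i m a =
  pw (w_word i) a - N%:Z * (m.-1%:Z * psi (i + 1) (pw (w_word i) a)).
Proof. exact: iter_shift_perm. Qed.

Lemma psi_near (a : int) : j + 1 < a < j + 1 + N%:Z + 1 ->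
  psi (i + 1) a = (a == j + 2)%:Z - (a == j + 3)%:Z.
Proof.
move=> h; rewrite /psi.
have -> : j + 2 = j + 1 + 1 by lia.
have -> : j + 3 = j + 1 + 1 + 1 by lia.
have S (y : int) : y%:~R + 1 = (y + 1)%:~R :> Z by rewrite [RHS]rmorphD.
by rewrite !S !Zp_near //; lia.
Qed.

(** After the cycle, the translation by -alpha_{j+2} moves only the classes of j + 2 and j + 3, in
    opposite directions. *)
Lemma w_perm_near (x : nat) : (x < N)%N -> w_perm i m (j + 1 + x%:Z) =
  if x == 0 then j + 1 else if x == 1 then j + 3 + N%:Z * m.-1%:Z
  else if x == N.-1 then j + 2 - N%:Z * m.-1%:Z else j + 2 + x%:Z.
Proof.
move=> xN; rewrite w_permE /w_word pw_interval //; last lia.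
have [u hu] := affine_perm_w i m.
case: ifP => h1; [|case: ifP => h2].
- rewrite psi_near; last lia.
  case: eqP => [|_]; first lia.
  case: eqP => h; do ?[case: eqP => ?]; lia.
- rewrite psi_near; last lia.
  by do ?[case: eqP => ?]; lia.
have -> : x = 0%N by lia.
rewrite addr0 eqxx -(psiDN _ _ 1) mulr1 psi_near; last lia.
by do ?[case: eqP => ?]; lia.
Qed.

Lemma w_permDN a k : w_perm i m (a + N%:Z * k) = w_perm i m a + N%:Z * k.
Proof. by have [u hu] := affine_perm_w i m; exact: hu.1. Qed.

(** With [w_perm1]: up to sign, T_w takes e(j, j + 1) to e(j + 2 - N m, j + 1), a root vector of
    mode m. The translation gives N (m - 1); the last N arises because j ends the previous
    period. *)
Lemma w_perm0 : w_perm i m j = j + 2 - N%:Z * m%:Z.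
Proof.
have e : j + 1 + N.-1%:Z + N%:Z * (-1) = j by lia.
rewrite -[X in w_perm _ _ X]e w_permDN w_perm_near; last lia.
by do ?[case: eqP => ?]; nia.
Qed.

Lemma w_perm1 : w_perm i m (j + 1) = j + 1.
Proof. by have := @w_perm_near 0; rewrite addr0; apply; lia. Qed.

Lemma inversions_near (x : nat) : inversions N (w_perm i m) (j + 1 + x%:Z) =
  (\sum_(0 <= k < N) pos (descent_shift N (w_perm i m) (j + 1 + x%:Z) (j + 1 + k%:Z)%R))%N.
Proof.
have [u hu] := affine_perm_w i m.
rewrite /inversions (sum_Zp _ (j + 1)); apply: eq_bigr => k _.
by rewrite (D_rep N3 hu) repE -(D_rep N3 hu).
Qed.

Lemma w_inversions0 : inversions N (w_perm i m) j = 0%N.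
Proof.
have [u hu] := affine_perm_w i m.
have -> : inversions N (w_perm i m) j = inversions N (w_perm i m) (j + 1 + N.-1%:Z).
  have e : j + 1 + N.-1%:Z + N%:Z * (-1) = j by lia.
  apply: eq_bigr => r _; rewrite -[X in descent_shift _ _ X _]e.
  by rewrite -[X in descent_shift _ _ _ X]addr0 -(mulr0 N%:Z) (DDN N3 hu).
rewrite inversions_near big_nat; apply: big1 => k /andP[_ kN].
suff : descent_shift N (w_perm i m) (j + 1 + N.-1%:Z) (j + 1 + k%:Z) <= 0.
  by case: descent_shift => // -[].
have M0 : (0 <= m.-1)%N by [].
rewrite /descent_shift !w_perm_near //; last lia.
rewrite (@flE N N3 (j + 1 + N.-1%:Z) _ 0); last lia.
have -> : (N.-1 == 0)%N = false by lia.
have -> : (N.-1 == 1)%N = false by lia.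
rewrite eqxx; case: eqP => k0; [|case: eqP => k1; [|case: eqP => k2]].
- by rewrite (@flE N N3 _ _ (- m.-1%:Z)); nia.
- by rewrite (@flE N N3 _ _ (-1 - 2 * m.-1%:Z)); nia.
- by rewrite (@flE N N3 _ _ 0); nia.
by rewrite (@flE N N3 _ _ (-1 - m.-1%:Z)); nia.
Qed.

(** The class of j is the only one with members falling below the fixed point j + 1, and m - 1 of
    them do. This is the origin of the sign (-1)^(m-1) in R_m and a_m. *)
Lemma w_inversions1 : inversions N (w_perm i m) (j + 1) = m.-1.
Proof.
rewrite -[X in inversions _ _ X]addr0 (inversions_near 0) addr0.
have N0 : N.-1.+1 = N by lia.
rewrite -[X in (\sum_(0 <= k < X) _)%N]N0 big_nat_recr //= big_nat big1 ?add0n => [|k /andP[_ kN]].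
  rewrite /descent_shift w_perm_near; last lia.
  rewrite w_perm1.
  rewrite eqxx; have -> : (N.-1 == 0)%N = false by lia.
  have -> : (N.-1 == 1)%N = false by lia.
  rewrite (@flE N N3 _ _ (m.-1%:Z - 1)); last lia.
  by rewrite (@flE N N3 _ _ (-1)); last lia; rewrite opprK subrK.
suff : descent_shift N (w_perm i m) (j + 1) (j + 1 + k%:Z) <= 0.
  by case: descent_shift => // -[].
rewrite /descent_shift w_perm_near; last lia.
rewrite w_perm1.
case: eqP => k0; [|case: eqP => k1; [|case: eqP => k2; first lia]].
- by rewrite (@flE N N3 _ _ 0) ?(@flE N N3 _ _ 0); lia.
- by rewrite (@flE N N3 _ _ (-1 - m.-1%:Z)) ?(@flE N N3 _ _ (-1)); nia.
by rewrite (@flE N N3 _ _ (-1)) ?(@flE N N3 _ _ (-1)); lia.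
Qed.

Lemma Tw_word_signs : word_sign (Tw_word i m) j (+) word_sign (Tw_word i m) (j + 1) = odd m.-1.
Proof. by rewrite !(Tw_wordP i m).2 w_inversions0 w_inversions1. Qed.

End TranslatedCoxeterElement.
End RootLatticeAction.

(** * Exponentials of nilpotent derivations *)

Section NoncommutativeRing.
Variable A : pzRingType.

#[local] Instance pz_ring_ops :
  @Ncring.Ring_ops A 0 1 +%R *%R (fun x y : A => x - y) -%R eq := {}.

#[local] Instance pz_ring : @Ncring.Ring _ _ _ _ _ _ _ _ pz_ring_ops.
Proof.
split.
- exact: RelationClasses.eq_equivalence.
- by move=> x y -> z t ->.
- by move=> x y -> z t ->.
- by move=> x y -> z t ->.
- by move=> x y ->.
- exact: add0r.
- exact: addrC.
- exact: addrA.
- exact: mul1r.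
- exact: mulr1.
- exact: mulrA.
- exact: mulrDl.
- by move=> x y z; exact: mulrDr.
- by [].
- exact: subrr.
Qed.

Implicit Types (x y z u v : A).

Lemma commrDr x u v : commr x (u + v) = commr x u + commr x v.
Proof. rewrite /commr; Ncring_tac.non_commutative_ring. Qed.

Lemma commrMr x u v : commr x (u * v) = commr x u * v + u * commr x v.
Proof. rewrite /commr; Ncring_tac.non_commutative_ring. Qed.

Lemma commrNl x u : commr (- x) u = - commr x u.
Proof. rewrite /commr; Ncring_tac.non_commutative_ring. Qed.

Lemma commr_anti x u : commr u x = - commr x u.
Proof. rewrite /commr; Ncring_tac.non_commutative_ring. Qed.

Lemma commr_zmod x : zmod_morphism (commr x).
Proof. move=> u v; rewrite /commr; Ncring_tac.non_commutative_ring. Qed.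

HB.instance Definition _ x :=
  GRing.isZmodMorphism.Build A A (commr x) (commr_zmod x).

Lemma iter_commr_zmod x n : zmod_morphism (iter n (commr x)).
Proof. by elim: n => [|n IH] u v //=; rewrite IH raddfB. Qed.

HB.instance Definition _ x n :=
  GRing.isZmodMorphism.Build A A (iter n (commr x)) (iter_commr_zmod x n).

Lemma iter_commr_le x n k u : (n <= k)%N -> iter n (commr x) u = 0 ->
  iter k (commr x) u = 0.
Proof. by move=> /subnK <- h; rewrite iterD h raddf0. Qed.

(** By the Leibniz rule, of n + k derivations at least n fall on u or at least k fall on v. *)
Lemma iter_commrM x n k u v : iter n (commr x) u = 0 -> iter k (commr x) v = 0 ->
  iter (n + k) (commr x) (u * v) = 0.
Proof.
move: {2}(n + k)%N (leqnn (n + k)) => d; elim: d n k u v => [|d IH] n k u v.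
  by case: n k => [|//] [|//] _ /= -> _; rewrite mul0r.
case: n => [|n] hd hu hv; first by rewrite /= in hu; rewrite hu mul0r raddf0.
case: k hd hv => [|k] hd hv; first by rewrite /= in hv; rewrite hv mulr0 raddf0.
rewrite addSn iterSr commrMr raddfD /=.
have h1 : (n + k.+1 <= d)%N by lia.
have h2 : (n.+1 + k <= d)%N by lia.
rewrite (IH n k.+1 (commr x u)) ?add0r // -?iterSr //.
by rewrite addnS -addSn (IH n.+1 k) // -iterSr.
Qed.

Definition ad_nilpotent x u := exists n, iter n (commr x) u = 0.

Lemma ad_nilpotentD x u v : ad_nilpotent x u -> ad_nilpotent x v -> ad_nilpotent x (u + v).
Proof.
move=> [n hn] [k hk]; exists (maxn n k); rewrite raddfD /=.
by rewrite (iter_commr_le (leq_maxl n k) hn) (iter_commr_le (leq_maxr n k) hk) addr0.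
Qed.

Lemma ad_nilpotentM x u v : ad_nilpotent x u -> ad_nilpotent x v -> ad_nilpotent x (u * v).
Proof. by move=> [n hn] [k hk]; exists (n + k)%N; exact: iter_commrM. Qed.

Lemma ad_nilpotent_commr x u : ad_nilpotent x (commr x u) -> ad_nilpotent x u.
Proof. by case=> n hn; exists n.+1; rewrite iterSr. Qed.

Lemma ad_nilpotentN x u : ad_nilpotent x u -> ad_nilpotent (- x) u.
Proof.
case=> n hn; exists n.
suff -> : iter n (commr (- x)) u = (-1) ^+ n * iter n (commr x) u by rewrite hn mulr0.
elim: n {hn} => [|n IH]; first by rewrite mul1r.
by rewrite !iterS IH commrNl raddfMsign exprS mulN1r mulNr.
Qed.

End NoncommutativeRing.

#[local] Existing Instance pz_ring_ops.
#[local] Existing Instance pz_ring.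
Local Ltac ncring := Ncring_tac.non_commutative_ring.

Section TruncatedExponential.
Context (K : numFieldType) (A : pzRingType) (phi : {rmorphism K -> A}).
Hypothesis phiC : forall k x, phi k * x = x * phi k.
Implicit Types (x u v : A).

Lemma phi_natM n x : phi n%:R * x = x *+ n.
Proof. by rewrite rmorph_nat mulr_natl. Qed.

Lemma phi_cancel n k x : (0 < k)%N ->
  phi ((n * k)%:R^-1) * (x *+ k) = phi (n%:R^-1) * x.
Proof.
move=> k0; rewrite -(phi_natM k) mulrA -rmorphM natrM invfM mulfVK //.
by rewrite pnatr_eq0 -lt0n.
Qed.

Lemma commr_phi x k u : commr x (phi k * u) = phi k * commr x u.
Proof. by rewrite /commr mulrBr -!mulrA (mulrA x) -(phiC k x) -mulrA. Qed.

Lemma iter_commr_phi x n k u : iter n (commr x) (phi k * u) = phi k * iter n (commr x) u.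
Proof. by elim: n => //= n ->; rewrite commr_phi. Qed.

(* Truncated at the order beyond which all the quadratic elements below vanish. *)
Definition expad x u := \sum_(0 <= k < 6) phi (k`!%:R^-1) * iter k (commr x) u.

Lemma expad_zmod x : zmod_morphism (expad x).
Proof.
by move=> u v; rewrite /expad -sumrB; apply: eq_bigr => k _; rewrite raddfB mulrBr.
Qed.

HB.instance Definition _ x :=
  GRing.isZmodMorphism.Build A A (expad x) (expad_zmod x).

Lemma expad_phi x k u : expad x (phi k * u) = phi k * expad x u.
Proof.
rewrite /expad mulr_sumr; apply: eq_bigr => n _.
by rewrite iter_commr_phi !mulrA -!rmorphM mulrC.
Qed.

Definition ad_cube0 x u := commr x (commr x (commr x u)) = 0.

Lemma expad_cube0 x u : ad_cube0 x u ->
  expad x u = u + commr x u + phi (2%:R^-1) * commr x (commr x u).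
Proof.
move=> h; rewrite /expad !big_nat_recr //= big_geq // h raddf0 !mulr0 !addr0.
by rewrite add0r !factS fact0 /= !invr1 rmorph1 !mul1r !raddf0 mulr0 addr0 !muln1.
Qed.

Lemma iter6_cube0 x u : ad_cube0 x u -> iter 6 (commr x) u = 0.
Proof. exact: (@iter_commr_le _ x 3 6). Qed.

Lemma iter6_cube0M x u v : ad_cube0 x u -> ad_cube0 x v -> iter 6 (commr x) (u * v) = 0.
Proof. exact: (@iter_commrM _ x 3 3). Qed.

(** The exponential of a nilpotent derivation is multiplicative. Here the Leibniz expansion stops at
    order four, where 6 / 4! is the square of 1 / 2. *)
Lemma expadM x u v : ad_cube0 x u -> ad_cube0 x v -> expad x (u * v) = expad x u * expad x v.
Proof.
move=> hu hv; rewrite (expad_cube0 hu) (expad_cube0 hv).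
rewrite /expad !big_nat_recr //= big_geq //.
rewrite add0r !factS fact0 /= !invr1 rmorph1 !mul1r.
move: hu hv; rewrite /ad_cube0.
set u1 := commr x u; set u2 := commr x u1; set u3 := commr x u2 => hu.
set v1 := commr x v; set v2 := commr x v1; set v3 := commr x v2 => hv.
have -> : commr x (u * v) = u1 * v + u * v1 by rewrite commrMr.
have -> : commr x (u1 * v + u * v1) = u2 * v + u1 * v1 *+ 2 + u * v2.
  by rewrite commrDr !commrMr -/u2 -/v2 mulr2n; ncring.
have -> : commr x (u2 * v + u1 * v1 *+ 2 + u * v2) = (u2 * v1 + u1 * v2) *+ 3.
  rewrite mulr2n !commrDr !commrMr -/u2 -/v2 -/u3 -/v3 hu hv mul0r mulr0 addr0 add0r.
  by rewrite !mulrS mulr0n; ncring.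
have -> : commr x ((u2 * v1 + u1 * v2) *+ 3) = (u2 * v2) *+ 6.
  rewrite !mulrS mulr0n addr0 !commrDr !commrMr -/u2 -/v2 -/u3 -/v3 hu hv mul0r mulr0 addr0 add0r.
  by ncring.
have -> : commr x ((u2 * v2) *+ 6) = 0.
  by rewrite !mulrS mulr0n addr0 !commrDr commrMr -/u3 -/v3 hu hv mul0r mulr0 !addr0.
rewrite mulr0 addr0.
rewrite !muln1 (phi_cancel 2 _ (isT : (0 < 3)%N)) (phi_cancel 4 _ (isT : (0 < 6)%N)).
rewrite (_ : 4%:R^-1 = 2%:R^-1 * 2%:R^-1 :> K) ?rmorphM; last by rewrite -invfM -natrM.
have h2 : u1 * v1 = phi (2%:R^-1) * (u1 * v1 *+ 2).
  by rewrite -{1}[2%N]/(1 * 2)%N phi_cancel // invr1 rmorph1 mul1r.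
have E : phi 2%:R^-1 * (u2 * v + u1 * v1 *+ 2 + u * v2) = 
    phi 2%:R^-1 * (u2 * v) + u1 * v1 + phi 2%:R^-1 * (u * v2).
  by rewrite mulrDr mulrDr -h2.
rewrite E; move: (phi 2%:R^-1) (phiC 2%:R^-1) => c cC.
clear h2 E hu hv u3 v3; clearbody u2 v2; clearbody u1 v1.
rewrite !mulrDl !mulrDr (mulrA u c) -(cC u) (mulrA u1 c) -(cC u1).
by rewrite -(mulrA c u2 (c * v2)) (mulrA u2) -(cC u2); ncring.
Qed.

End TruncatedExponential.

(** * Affine families of matrix units *)

(** Sequences tending to zero in a topology that is left implicit; [nul_const] makes limits unique.
    The axioms are symmetric in left and right, so they hold in the opposite ring as well. *)
Record null_sequences (A : pzRingType) (nul : (nat -> A) -> Prop) : Prop := NullSequences {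
  nulB : forall f g, nul f -> nul g -> nul (fun n => f n - g n);
  nulMl : forall x f, nul f -> nul (fun n => x * f n);
  nulMr : forall x f, nul f -> nul (fun n => f n * x);
  nul_eventually0 : forall f n0, (forall n, (n0 <= n)%N -> f n = 0) -> nul f;
  nul_const : forall x, nul (fun=> x) -> x = 0
}.

(* [e a b], for integers [a = a0 + N p] and [b = b0 + N q] with [a0, b0] in [1, N],
   stands for [E_{a0,b0}(q - p)], minus the scalar [p c] when [a = b]. With this
   correction the central term of the bracket becomes invisible. *)
Record affine_family (K : numFieldType) (A : pzRingType) (phi : K -> A) (N : nat) (c : K)
    (nul : (nat -> A) -> Prop) (e : int -> int -> A) : Prop := AffineFamily {
  af_shift : forall a b k, e (a + N%:Z * k) (b + N%:Z * k) =
    e a b - (if a == b then phi (c * k%:~R) else 0);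
  af_bracket : forall a b p q, commr (e a b) (e p q) =
    (if b%:~R == p%:~R :> 'Z_N then e a (q + b - p) else 0)
    - (if a%:~R == q%:~R :> 'Z_N then e (p + a - q) b else 0);
  af_null : forall a b p q,
    nul (fun n => e a (b + N%:Z * n%:Z) * e p (q - N%:Z * n%:Z))
}.

Section AffineFamily.
Context (K : numFieldType) (A : pzRingType) (phi : {rmorphism K -> A}).
Hypothesis phiC : forall k x, phi k * x = x * phi k.
Context (N : nat) (N3 : (2 < N)%N) (c : K).
Context (nul : (nat -> A) -> Prop) (e : int -> int -> A).
Hypothesis eP : affine_family phi N c nul e.
Implicit Types (x u v w : A) (a b p q k l : int).
Local Notation Z := 'Z_N.
Local Notation expad := (expad phi).

Lemma af_shift_neq a b k : a != b -> e (a + N%:Z * k) (b + N%:Z * k) = e a b.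
Proof. by move=> /negPf h; rewrite (af_shift eP) h subr0. Qed.

Definition root_p a := e a (a + 1).
Definition root_m a := e (a + 1) a.

(** In this form the affected index moves by one and the other stays, in contrast to [af_bracket].
    When both residues match, the two diagonal corrections cancel. *)
Lemma commr_root_p p a b : commr (root_p p) (e a b) =
  (if a%:~R == p%:~R + 1 :> Z then e (a - 1) b else 0)
  - (if b%:~R == p%:~R :> Z then e a (b + 1) else 0).
Proof.
have hp : p%:~R + 1 = (p + 1)%:~R :> Z by rewrite rmorphD.
rewrite (af_bracket eP) hp [(p + 1)%:~R == _]eq_sym [p%:~R == _]eq_sym.
case: (Zp_intP N3 a) => [[k ->]|h1]; case: (Zp_intP N3 b) => [[l ->]|h2].
- have -> : p + N%:Z * l + (p + 1) - (p + 1 + N%:Z * k) = p + N%:Z * (l - k) by lia.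
  have -> : p + 1 + N%:Z * k + p - (p + N%:Z * l) = p + 1 + N%:Z * (k - l) by lia.
  have -> : e (p + 1 + N%:Z * k - 1) (p + N%:Z * l) =
      e (p + N%:Z * k) (p + N%:Z * (l - k) + N%:Z * k) by congr e; lia.
  have -> : e (p + 1 + N%:Z * k) (p + N%:Z * l + 1) =
      e (p + 1 + N%:Z * (k - l) + N%:Z * l) (p + 1 + N%:Z * l) by congr e; lia.
  rewrite !(af_shift eP).
  have -> : (p == p + N%:Z * (l - k)) = (k == l) by apply/eqP/eqP => h; nia.
  have -> : (p + 1 + N%:Z * (k - l) == p + 1) = (k == l) by apply/eqP/eqP => h; nia.
  by case: eqP => [->|_]; rewrite ?subr0 //; ncring.
- rewrite !subr0.
  have -> : e (p + 1 + N%:Z * k - 1) b = e (p + N%:Z * k) (b - N%:Z * k + N%:Z * k) by congr e; lia.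
  rewrite af_shift_neq; first by congr e; lia.
  by apply/eqP => h; apply: h2; exists k; lia.
- rewrite !sub0r; congr (- _).
  have -> : e a (p + N%:Z * l + 1) = e (a - N%:Z * l + N%:Z * l) (p + 1 + N%:Z * l) by congr e; lia.
  rewrite af_shift_neq; first by congr e; lia.
  by apply/eqP => h; apply: h1; exists l; lia.
by [].
Qed.

Lemma commr_root_m p a b : commr (root_m p) (e a b) =
  (if a%:~R == p%:~R :> Z then e (a + 1) b else 0)
  - (if b%:~R == p%:~R + 1 :> Z then e a (b - 1) else 0).
Proof.
have hp : p%:~R + 1 = (p + 1)%:~R :> Z by rewrite rmorphD.
rewrite (af_bracket eP) hp [(p + 1)%:~R == _]eq_sym [p%:~R == _]eq_sym.
case: (Zp_intP N3 a) => [[k ->]|h1]; case: (Zp_intP N3 b) => [[l ->]|h2].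
- have -> : p + 1 + N%:Z * l + p - (p + N%:Z * k) = p + 1 + N%:Z * (l - k) by lia.
  have -> : p + N%:Z * k + (p + 1) - (p + 1 + N%:Z * l) = p + N%:Z * (k - l) by lia.
  have -> : e (p + N%:Z * k + 1) (p + 1 + N%:Z * l) =
      e (p + 1 + N%:Z * k) (p + 1 + N%:Z * (l - k) + N%:Z * k) by congr e; lia.
  have -> : e (p + N%:Z * k) (p + 1 + N%:Z * l - 1) =
      e (p + N%:Z * (k - l) + N%:Z * l) (p + N%:Z * l) by congr e; lia.
  rewrite !(af_shift eP).
  have -> : (p + 1 == p + 1 + N%:Z * (l - k)) = (k == l) by apply/eqP/eqP => h; nia.
  have -> : (p + N%:Z * (k - l) == p) = (k == l) by apply/eqP/eqP => h; nia.
  by case: eqP => [->|_]; rewrite ?subr0 //; ncring.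
- rewrite !subr0.
  have -> : e (p + N%:Z * k + 1) b = e (p + 1 + N%:Z * k) (b - N%:Z * k + N%:Z * k) by congr e; lia.
  rewrite af_shift_neq; first by congr e; lia.
  by apply/eqP => h; apply: h2; exists k; lia.
- rewrite !sub0r; congr (- _).
  have -> : e a (p + 1 + N%:Z * l - 1) = e (a - N%:Z * l + N%:Z * l) (p + N%:Z * l) by congr e; lia.
  rewrite af_shift_neq; first by congr e; lia.
  by apply/eqP => h; apply: h1; exists l; lia.
by [].
Qed.

Lemma root_p_rep a : root_p (rep (a%:~R : Z)) = root_p a.
Proof.
have [k] := repP N3 a; rewrite /root_p; set r := rep _ => E.
have -> : e a (a + 1) = e (r + N%:Z * k) (r + 1 + N%:Z * k) by congr e; lia.
by rewrite af_shift_neq //; lia.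
Qed.

Lemma root_m_rep a : root_m (rep (a%:~R : Z)) = root_m a.
Proof.
have [k] := repP N3 a; rewrite /root_m; set r := rep _ => E.
have -> : e (a + 1) a = e (r + 1 + N%:Z * k) (r + N%:Z * k) by congr e; lia.
by rewrite af_shift_neq //; lia.
Qed.

Section Reflection.
Variable i : Z.
Local Notation X := (root_p (rep i)).
Local Notation Y := (root_m (rep i)).

Lemma Zp_1neq : (i == i + 1) = false.
Proof. by rewrite eq_sym (Zp_S_neq N3). Qed.

Lemma commr_X a b : commr X (e a b) =
  (if a%:~R == i + 1 then e (a - 1) b else 0) - (if b%:~R == i then e a (b + 1) else 0).
Proof. by rewrite commr_root_p repE. Qed.

Lemma commr_Y a b : commr (- Y) (e a b) =
  - (if a%:~R == i then e (a + 1) b else 0) + (if b%:~R == i + 1 then e a (b - 1) else 0).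
Proof. by rewrite commrNl commr_root_m repE opprB addrC. Qed.

Lemma Zp_pred a : ((a - 1)%:~R == i :> Z) = (a%:~R == i + 1).
Proof. by rewrite rmorphB /= subr_eq. Qed.

Lemma Zp_succ a : ((a + 1)%:~R == i + 1 :> Z) = (a%:~R == i).
Proof. by rewrite rmorphD /= (inj_eq (addIr 1)). Qed.

Lemma Zp_pred1 a : a%:~R == i + 1 -> ((a - 1)%:~R == i + 1 :> Z) = false.
Proof. by move=> /eqP h; rewrite rmorphB /= h addrK Zp_1neq. Qed.

Lemma Zp_succ1 a : a%:~R == i -> ((a + 1)%:~R == i :> Z) = false.
Proof. by move=> /eqP h; rewrite rmorphD /= h (Zp_S_neq N3). Qed.

Lemma commrNr x u : commr x (- u) = - commr x u. Proof. exact: raddfN. Qed.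
Lemma commr0 x : commr x 0 = 0. Proof. exact: raddf0. Qed.
Lemma half_double x : phi 2%:R^-1 * (- x - x) = - x.
Proof.
rewrite -opprD mulrN -mulr2n; congr (- _).
by have := @phi_cancel _ _ phi 1 2 x isT; rewrite invr1 rmorph1 mul1r => ->.
Qed.

(* [D] is kept opaque, as rewriting would otherwise unfold [commr x]. *)
Lemma expad_cube0_by (D : A -> A) x u v : D = commr x ->
  D (D (D u)) = 0 /\ u + D u + phi 2%:R^-1 * D (D u) = v ->
  ad_cube0 x u /\ expad x u = v.
Proof. by move=> -> [h <-]; split; rewrite // (expad_cube0 phi h). Qed.

Local Ltac ad_simpl D0 DN DD De ha hb ha1 hb1 :=
  do 4 rewrite ?D0 ?DN ?DD ?De ?ha ?hb ?ha1 ?hb1 /= ?subr0 ?sub0r ?oppr0 ?addr0 ?add0r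
    ?opprK ?subrr ?mulr0.

Lemma expad_X a b : ad_cube0 X (e a b) /\ expad X (e a b) =
  e a b + (if a%:~R == i + 1 then e (a - 1) b else 0)
  - (if b%:~R == i then e a (b + 1) else 0)
  - (if (a%:~R == i + 1) && (b%:~R == i) then e (a - 1) (b + 1) else 0).
Proof.
have [D ED] : exists D, D = commr X by exists (commr X).
have D0 : D 0 = 0 by rewrite ED commr0.
have DN u : D (- u) = - D u by rewrite ED commrNr.
have DD u v : D (u + v) = D u + D v by rewrite ED commrDr.
have De p q : D (e p q) = (if p%:~R == i + 1 then e (p - 1) q else 0)
  - (if q%:~R == i then e p (q + 1) else 0) by rewrite ED commr_X.
apply: (expad_cube0_by ED); clear ED.
case: (boolP (a%:~R == i + 1)) => [ha|/negPf ha]; [have ha1 := Zp_pred1 ha|have ha1 := erefl true];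
  (case: (boolP (b%:~R == i)) => [hb|/negPf hb]; [have hb1 := Zp_succ1 hb|have hb1 := erefl true]);
  ad_simpl D0 DN DD De ha hb ha1 hb1; split => //.
by rewrite half_double !addrA.
Qed.

Lemma expad_Y a b : ad_cube0 (- Y) (e a b) /\ expad (- Y) (e a b) =
  e a b - (if a%:~R == i then e (a + 1) b else 0)
  + (if b%:~R == i + 1 then e a (b - 1) else 0)
  - (if (a%:~R == i) && (b%:~R == i + 1) then e (a + 1) (b - 1) else 0).
Proof.
have [D ED] : exists D, D = commr (- Y) by exists (commr (- Y)).
have D0 : D 0 = 0 by rewrite ED commr0.
have DN u : D (- u) = - D u by rewrite ED commrNr.
have DD u v : D (u + v) = D u + D v by rewrite ED commrDr.
have De p q : D (e p q) = - (if p%:~R == i then e (p + 1) q else 0)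
  + (if q%:~R == i + 1 then e p (q - 1) else 0) by rewrite ED commr_Y.
apply: (expad_cube0_by ED); clear ED.
case: (boolP (a%:~R == i)) => [ha|/negPf ha]; [have ha1 := Zp_succ1 ha|have ha1 := erefl true];
  (case: (boolP (b%:~R == i + 1)) => [hb|/negPf hb]; [have hb1 := Zp_pred1 hb|have hb1 := erefl true]);
  ad_simpl D0 DN DD De ha hb ha1 hb1; split => //.
  by rewrite oppr0.
by rewrite half_double !addrA.
Qed.

(** Additive combinations of matrix units: ad is cube-zero on them and the exponentials preserve
    them, so [expadM] can be applied three times in a row. *)
Inductive e_span : A -> Prop :=
| e_span_e a b : e_span (e a b)
| e_spanB u v : e_span u -> e_span v -> e_span (u - v).

Lemma e_span0 : e_span 0.
Proof. by rewrite -(subrr (e 0 0)); apply: e_spanB; exact: e_span_e. Qed.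

Lemma e_spanN u : e_span u -> e_span (- u).
Proof. by rewrite -(sub0r u); apply: e_spanB; exact: e_span0. Qed.

Lemma e_spanD u v : e_span u -> e_span v -> e_span (u + v).
Proof. by move=> hu /e_spanN; rewrite -{2}(opprK v); exact: e_spanB. Qed.

Lemma e_span_if (t : bool) a b : e_span (if t then e a b else 0).
Proof. by case: t; [exact: e_span_e|exact: e_span0]. Qed.

Lemma ad_cube0B x u v : ad_cube0 x u -> ad_cube0 x v -> ad_cube0 x (u - v).
Proof.
rewrite /ad_cube0 => hu hv; rewrite (commr_zmod x u v) (commr_zmod x (commr x u)).
by rewrite (commr_zmod x (commr x (commr x u))) hu hv subrr.
Qed.

Lemma e_span_X u : e_span u -> ad_cube0 X u /\ e_span (expad X u).
Proof.
elim=> [a b|v w _ [hv1 hv2] _ [hw1 hw2]].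
  have [h ->] := expad_X a b; split=> //.
  by do 2 (apply: e_spanB; last exact: e_span_if); apply: e_spanD (e_span_if _ _ _); exact: e_span_e.
by split; [exact: ad_cube0B|rewrite raddfB; exact: e_spanB].
Qed.

Lemma e_span_Y u : e_span u -> ad_cube0 (- Y) u /\ e_span (expad (- Y) u).
Proof.
elim=> [a b|v w _ [hv1 hv2] _ [hw1 hw2]].
  have [h ->] := expad_Y a b; split=> //.
  apply: e_spanB; last exact: e_span_if.
  by apply: e_spanD (e_span_if _ _ _); apply: e_spanB (e_span_e _ _) (e_span_if _ _ _).
by split; [exact: ad_cube0B|rewrite raddfB; exact: e_spanB].
Qed.

(** The counterpart of T_i in the target, additive on the whole ring; [Top_ok] states when the
    truncations compute the true exponentials. *)
Definition Top u := expad X (expad (- Y) (expad X u)).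

Definition Top_ok u := [/\ iter 6 (commr X) u = 0, iter 6 (commr (- Y)) (expad X u) = 0
  & iter 6 (commr X) (expad (- Y) (expad X u)) = 0].

Lemma Top_zmod : zmod_morphism Top.
Proof. by move=> u v; rewrite /Top !raddfB. Qed.

HB.instance Definition _ := GRing.isZmodMorphism.Build A A Top Top_zmod.

Lemma Top_phi (t : K) u : Top (phi t * u) = phi t * Top u.
Proof. by rewrite /Top !expad_phi. Qed.

Lemma Top_okB u v : Top_ok u -> Top_ok v -> Top_ok (u - v).
Proof.
move=> [a1 a2 a3] [b1 b2 b3]; split.
- by rewrite (iter_commr_zmod X 6 u v) a1 b1 subrr.
- by rewrite expad_zmod (iter_commr_zmod (- Y) 6) a2 b2 subrr.
by rewrite !expad_zmod (iter_commr_zmod X 6) a3 b3 subrr.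
Qed.

Lemma Top_ok_phi (t : K) u : Top_ok u -> Top_ok (phi t * u).
Proof.
by move=> [a1 a2 a3]; split; rewrite ?expad_phi // iter_commr_phi // ?a1 ?a2 ?a3 mulr0.
Qed.

Lemma Top_ok_span u : e_span u -> Top_ok u.
Proof.
move=> /e_span_X[h1 /e_span_Y[h2 /e_span_X[h3 _]]].
by split; exact: iter6_cube0.
Qed.

Lemma Top_okM u v : e_span u -> e_span v -> Top_ok (u * v).
Proof.
move=> /e_span_X[h1 /e_span_Y[h2 /e_span_X[h3 _]]] /e_span_X[k1 /e_span_Y[k2 /e_span_X[k3 _]]].
by split; rewrite ?expadM //; exact: iter6_cube0M.
Qed.

Lemma TopM u v : e_span u -> e_span v -> Top (u * v) = Top u * Top v.
Proof.
move=> /e_span_X[h1 /e_span_Y[h2 /e_span_X[h3 _]]] /e_span_X[k1 /e_span_Y[k2 /e_span_X[k3 _]]].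
by rewrite /Top !expadM.
Qed.

(** T_i acts on each index separately: residue i goes to i + 1 with a minus sign, and i + 1 goes to
    i with a plus sign. *)
Lemma Top_e a b : Top (e a b) =
  (-1) ^+ ((a%:~R == i) (+) (b%:~R == i)) * e (sp i a) (sp i b).
Proof.
rewrite mulr_sign /Top.
have EX p q := (expad_X p q).2; have EY p q := (expad_Y p q).2.
have [F EF] : exists F, F = expad X by exists (expad X).
have [G EG] : exists G, G = expad (- Y) by exists (expad (- Y)).
rewrite -EF -EG; rewrite -EF in EX; rewrite -EG in EY.
have F0 : F 0 = 0 by rewrite EF raddf0.
have G0 : G 0 = 0 by rewrite EG raddf0.
have FN u : F (- u) = - F u by rewrite EF raddfN.
have GN u : G (- u) = - G u by rewrite EG raddfN.
have FD u v : F (u + v) = F u + F v by rewrite EF raddfD.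
have GD u v : G (u + v) = G u + G v by rewrite EG raddfD.
clear EF EG; rewrite /sp.
have split3 p : [\/ [/\ (p%:~R == i) = true, (p%:~R == i + 1) = false,
      ((p + 1)%:~R == i :> Z) = false & ((p + 1)%:~R == i + 1 :> Z) = true],
    [/\ (p%:~R == i) = false, (p%:~R == i + 1) = true,
      ((p - 1)%:~R == i :> Z) = true & ((p - 1)%:~R == i + 1 :> Z) = false]
    | (p%:~R == i) = false /\ (p%:~R == i + 1) = false].
  case: (boolP (p%:~R == i)) => [h|/negPf h].
    by constructor 1; rewrite (Zp_succ1 h) Zp_succ (eqP h) Zp_1neq eqxx.
  case: (boolP (p%:~R == i + 1)) => [h'|/negPf h']; last by constructor 3.
  by constructor 2; rewrite (Zp_pred1 h') Zp_pred h'.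
have [[a1 a2 a3 a4]|[a1 a2 a3 a4]|[a1 a2]] := split3 a; try have [a3 a4] := (erefl true, erefl true);
have [[b1 b2 b3 b4]|[b1 b2 b3 b4]|[b1 b2]] := split3 b; try have [b3 b4] := (erefl true, erefl true);
  do 8 rewrite ?F0 ?G0 ?FN ?GN ?FD ?GD ?EX ?EY ?a1 ?a2 ?a3 ?a4 ?b1 ?b2 ?b3 ?b4 /=
    ?addrK ?subrK ?subr0 ?addr0 ?sub0r ?add0r ?oppr0;
  ncring.
Qed.

End Reflection.
End AffineFamily.

(** * Calculus of null sequences *)

Section NullSequences.
Context (A : pzRingType) (nul : (nat -> A) -> Prop).
Hypothesis nulP : null_sequences nul.
Implicit Types (x y : A) (f g h : nat -> A).

Lemma nul0 : nul (fun=> 0).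
Proof. by apply: (@nul_eventually0 _ _ nulP _ 0%N). Qed.

Lemma nul_eq f g n0 : nul f -> (forall n, (n0 <= n)%N -> f n = g n) -> nul g.
Proof.
move=> hf fg; have -> : g = (fun n => f n - (f n - g n)) by apply/funext => n; rewrite subKr.
apply: nulB => //; apply: (@nul_eventually0 _ _ nulP _ n0) => n hn.
by rewrite fg ?subrr.
Qed.

Lemma nul_ext f g : f =1 g -> nul f -> nul g.
Proof. by move=> /funext ->. Qed.

Lemma nulN f : nul f -> nul (fun n => - f n).
Proof. by move=> hf; apply: nul_ext (nulB nulP nul0 hf) => n; rewrite sub0r. Qed.

Lemma nulD f g : nul f -> nul g -> nul (fun n => f n + g n).
Proof. by move=> hf /nulN hg; apply: nul_ext (nulB nulP hf hg) => n; rewrite opprK. Qed.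

Lemma nul_sum (I : Type) (r : seq I) (F : I -> nat -> A) :
  (forall i, nul (F i)) -> nul (fun n => \sum_(i <- r) F i n).
Proof.
move=> hF; elim: r => [|i r IH].
  by apply: nul_ext nul0 => n; rewrite big_nil.
by apply: nul_ext (nulD (hF i) IH) => n; rewrite big_cons.
Qed.

Lemma nul_commr x f : nul f -> nul (fun n => commr x (f n)).
Proof. by move=> hf; apply: nulB => //; [apply: nulMl|apply: nulMr]. Qed.

Lemma nul_iter_commr x k f : nul f -> nul (fun n => iter k (commr x) (f n)).
Proof. by elim: k => // k IH hf; apply: nul_commr; exact: IH. Qed.

Definition asym f g := nul (fun n => f n - g n).

Lemma asym_refl f : asym f f.
Proof. by apply: nul_ext nul0 => n; rewrite subrr. Qed.

Lemma asym_sym f g : asym f g -> asym g f.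
Proof. by move=> h; apply: nul_ext (nulN h) => n; rewrite opprB. Qed.

Lemma asym_trans f g h : asym f g -> asym g h -> asym f h.
Proof. by move=> h1 h2; apply: nul_ext (nulD h1 h2) => n; rewrite addrA subrK. Qed.

Lemma asymB f f' g g' : asym f g -> asym f' g' ->
  asym (fun n => f n - f' n) (fun n => g n - g' n).
Proof.
move=> h1 h2; apply: nul_ext (nulB nulP h1 h2) => n.
by ncring.
Qed.

Lemma asymD f f' g g' : asym f g -> asym f' g' ->
  asym (fun n => f n + f' n) (fun n => g n + g' n).
Proof. by move=> h1 h2; apply: nul_ext (nulD h1 h2) => n; rewrite opprD addrACA. Qed.

Lemma asym_sum (I : Type) (r : seq I) (F G : I -> nat -> A) :
  (forall i, asym (F i) (G i)) ->
  asym (fun n => \sum_(i <- r) F i n) (fun n => \sum_(i <- r) G i n).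
Proof. by move=> h; apply: nul_ext (nul_sum r h) => n; rewrite sumrB. Qed.

Lemma asym_eq f g n0 : (forall n, (n0 <= n)%N -> f n = g n) -> asym f g.
Proof.
by move=> h; apply: (@nul_eventually0 _ _ nulP _ n0) => n hn; rewrite h ?subrr.
Qed.

Lemma asym_const x y : asym (fun=> x) (fun=> y) -> x = y.
Proof. by move=> /(nul_const nulP)/eqP; rewrite subr_eq0 => /eqP. Qed.

(** Sliding a window of length n up by k gains k terms at the top and loses k terms at the bottom;
    the lost ones tend to zero. *)
Lemma window_shift (W : int -> A) (s : int) (k : nat) :
  (forall s, nul (fun n => W (s - n%:Z))) ->
  asym (fun n => \sum_(0 <= l < n) W (s + k%:Z - l%:Z))
       (fun n => \sum_(0 <= l < n) W (s - l%:Z) + \sum_(0 <= t < k) W (s + 1 + t%:Z)).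
Proof.
move=> hW; elim: k s => [|k IH] s.
  apply: (@asym_eq _ _ 0%N) => n _.
  by rewrite [X in _ = _ + X]big_geq // !addr0.
have h1 : asym (fun n => \sum_(0 <= l < n) W (s + k.+1%:Z - l%:Z))
    (fun n => \sum_(0 <= l < n) W (s + k%:Z - l%:Z) + W (s + k.+1%:Z)).
  have E n : \sum_(0 <= l < n) W (s + k.+1%:Z - l%:Z) + W (s + k.+1%:Z - n%:Z) =
      \sum_(0 <= l < n) W (s + k%:Z - l%:Z) + W (s + k.+1%:Z).
    rewrite -(@big_nat_recr _ _ _ n 0) //= big_nat_recl // subr0 addrC; congr (_ + _).
    by apply: eq_bigr => l _; congr W; lia.
  apply: nul_ext (nulN (hW (s + k.+1%:Z))) => n.
  by rewrite -E opprD addrA subrr sub0r.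
apply: asym_trans h1 _.
apply: nul_ext (IH s) => n.
rewrite [in RHS]big_nat_recr //= (_ : s + 1 + k%:Z = s + k.+1%:Z); last lia.
by ncring.
Qed.

End NullSequences.

(** * The operators T_w on quadratic series *)

Section QuadraticElements.
Context (K : numFieldType) (A : pzRingType) (phi : {rmorphism K -> A}).
Hypothesis phiC : forall k x, phi k * x = x * phi k.
Context (N : nat) (N3 : (2 < N)%N) (c : K).
Context (nul : (nat -> A) -> Prop) (e : int -> int -> A).
Hypothesis nulP : null_sequences nul.
Hypothesis eP : affine_family phi N c nul e.
Implicit Types (x u v : A) (f : nat -> A) (a b : int) (s : seq 'Z_N) (i : 'Z_N).

Local Notation root_p := (root_p e).
Local Notation Top := (Top phi e).
Local Notation Top_ok := (Top_ok phi e).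

Fixpoint Tops s u : A := if s is i :: s' then Top i (Tops s' u) else u.

Fixpoint Tops_ok s u : Prop := if s is i :: s' then Tops_ok s' u /\ Top_ok i (Tops s' u) else True.

Lemma Top_ok_sign i (t : bool) u : Top_ok i u -> Top_ok i ((-1) ^+ t * u).
Proof.
move=> h; rewrite -(rmorphN1 phi) -rmorphXn; exact: Top_ok_phi.
Qed.

Lemma Top_sign i (t : bool) u : Top i ((-1) ^+ t * u) = (-1) ^+ t * Top i u.
Proof. by rewrite -(rmorphN1 phi) -rmorphXn Top_phi. Qed.

Lemma Top_okD i u v : Top_ok i u -> Top_ok i v -> Top_ok i (u + v).
Proof.
move=> hu hv; rewrite -(opprK v) -[- v]sub0r; apply: Top_okB => //; apply: Top_okB => //.
by apply: (Top_ok_span N3 eP); exact: e_span0.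
Qed.

Lemma Tops_e s a b : Tops_ok s (e a b) /\
  Tops s (e a b) = (-1) ^+ (word_sign s a (+) word_sign s b) * e (pw s a) (pw s b).
Proof.
elim: s => [|i s [IH1 IH2]] /=; first by rewrite mul1r.
rewrite IH2; split; first split=> //.
  by apply: Top_ok_sign; apply: (Top_ok_span N3 eP); exact: e_span_e.
rewrite Top_sign (Top_e N3 eP) mulrA -signr_addb; congr ((-1) ^+ _ * _).
by rewrite -!addbA; congr addb; rewrite addbCA.
Qed.

Lemma iter_commr_lim x k f S : (forall n, iter k (commr x) (f n) = 0) ->
  nul (fun n => f n - S) -> iter k (commr x) S = 0.
Proof.
move=> hf hS; apply: (nul_const nulP).
apply: nul_ext (nulN nulP (nul_iter_commr nulP x k hS)) => n.
by rewrite (iter_commr_zmod x k) hf sub0r opprK.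
Qed.

Lemma nul_expad x f : nul f -> nul (fun n => expad phi x (f n)).
Proof.
move=> hf; apply: nul_sum => // k; apply: nulMl => //; exact: nul_iter_commr.
Qed.

Lemma expad_lim x f S : nul (fun n => f n - S) ->
  nul (fun n => expad phi x (f n) - expad phi x S).
Proof. by move/(nul_expad x); apply: nul_ext => n; rewrite expad_zmod. Qed.

(** [Top] is a finite combination of iterated commutators, hence continuous; the vanishing of sixth
    powers passes to the limit because limits are unique. *)
Lemma Top_lim i f S : (forall n, Top_ok i (f n)) -> nul (fun n => f n - S) ->
  Top_ok i S /\ nul (fun n => Top i (f n) - Top i S).
Proof.
move=> hf hS; have h1 := expad_lim (root_p (rep i)) hS.
have h2 := expad_lim (- root_m e (rep i)) h1.
split; last exact: expad_lim.
split; [apply: (iter_commr_lim _ hS)|apply: (iter_commr_lim _ h1)|apply: (iter_commr_lim _ h2)];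
by move=> n; have [] := hf n.
Qed.

(* The partial sums of the quadratic part of [ev x_{i,1}^+] are [quad F i (i + 1)], with
   [F l = i - l], and those of its image under [T_w] have [w \o F] in place of [F]. *)
Definition quad (F : nat -> int) a b n := \sum_(0 <= l < N * n) e (F l) b * e a (F l).

(** The inner index occurs in both factors, so its sign is squared and only the signs of a and b
    remain. *)
Lemma Top_quad i F a b n : Top_ok i (quad F a b n) /\
  Top i (quad F a b n) = (-1) ^+ ((a%:~R == i) (+) (b%:~R == i))
     * quad (sp i \o F) (sp i a) (sp i b) n.
Proof.
rewrite /quad; elim: (N * n)%N => [|k [IH1 IH2]].
  rewrite !big_geq //; split; last by rewrite raddf0 mulr0.
  by apply: (Top_ok_span N3 eP); exact: e_span0.
rewrite !big_nat_recr //=; split.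
  by apply: Top_okD => //; apply: (Top_okM phiC N3 eP); exact: e_span_e.
rewrite [LHS]raddfD [X in X + _]IH2 mulrDr; congr (_ + _).
rewrite [LHS](TopM phiC N3 eP) ?(Top_e N3 eP); try exact: e_span_e.
rewrite !mulr_sign; case: (_ == i); case: (_ == i); case: (_ == i);
by rewrite /= ?mulrN ?mulNr ?opprK.
Qed.

Lemma Tops_quad s F a b (k h : K) S :
  nul (fun n => quad F a b n - S) ->
  let u := phi k * e a b + phi h * S in
  Tops_ok s u /\ exists2 S', nul (fun n => quad (pw s \o F) (pw s a) (pw s b) n - S') &
    Tops s u = (-1) ^+ (word_sign s a (+) word_sign s b)
      * (phi k * e (pw s a) (pw s b) + phi h * S').
Proof.
move=> hS u; elim: s => [|i s [IH1 [S' hS' IH2]]].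
  by split=> //; exists S => //; rewrite mul1r.
have [hT1 hT2] := Top_lim (fun n => (Top_quad i _ _ _ n).1) hS'.
split.
  split=> //; rewrite IH2; apply: Top_ok_sign; apply: Top_okD; apply: Top_ok_phi => //.
  by apply: (Top_ok_span N3 eP); exact: e_span_e.
set t := ((pw s a)%:~R == i) (+) ((pw s b)%:~R == i).
(* The sign of this letter is put into the limit, so that one sign factors out of the linear and the
   quadratic part together. *)
exists ((-1) ^+ t * Top i S').
  apply: nul_ext (nulMl nulP ((-1) ^+ t) hT2) => n.
  by rewrite (Top_quad i _ _ _ n).2 mulrBr mulrA -signr_addb addbb mul1r.
rewrite /= IH2 Top_sign [X in _ * X = _]raddfD /= !Top_phi // (Top_e N3 eP) -/t.
rewrite !mulr_sign /t; case: (word_sign s a); case: (word_sign s b);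
case: (_ == i); case: (_ == i); rewrite /= ?mulrN; ncring.
Qed.

End QuadraticElements.

(** * Rearranging sums over consecutive integers *)

Section IntSums.
Context (V : zmodType) (N : nat) (N3 : (2 < N)%N).
Implicit Types (G : int -> V).

Lemma sum_period_shift G : (forall b, G (b + N%:Z) = G b) ->
  \sum_(1 <= b < N.+1) G (b%:Z + 1) = \sum_(1 <= b < N.+1) G b%:Z.
Proof.
move=> GN; rewrite big_nat_recr /=; last lia.
rewrite [RHS]big_ltn; last lia.
rewrite [RHS]addrC [in RHS]big_add1 /=; congr (_ + _).
  by apply: eq_bigr => b _; congr G; lia.
by rewrite -[RHS]GN; congr G; lia.
Qed.

(** The classes are represented by j + 1, ..., j + N, the period on which [w_perm_near] is
    explicit. *)
Lemma sum_residues G (j : int) (n : nat) :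
  \sum_(0 <= l < N * n) G (j - l%:Z) =
  \sum_(0 <= x < N) \sum_(0 <= l < n) G (j + 1 + x%:Z + N%:Z * (-1 - l%:Z)).
Proof.
elim: n => [|n IH].
  by rewrite muln0 big_geq // big1 // => x _; rewrite big_geq.
rewrite mulnS addnC (@big_cat_nat _ _ _ (N * n)) ?leq_addr //= IH.
rewrite [RHS](eq_bigr (fun x : nat => \sum_(0 <= l < n) G (j + 1 + x%:Z + N%:Z * (-1 - l%:Z))
  + G (j + 1 + x%:Z + N%:Z * (-1 - n%:Z)))); last by move=> x _; rewrite big_nat_recr.
rewrite big_split /=; congr (_ + _).
rewrite -{1}[(N * n)%N]add0n big_addn addKn big_nat_rev /=.
by rewrite big_nat [RHS]big_nat; apply: eq_bigr => x xN; congr G; lia.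
Qed.

(** Isolates 0, 1 and N - 1, the exceptional cases of [w_perm_near]. *)
Lemma sum_ends (F : nat -> V) :
  \sum_(0 <= x < N) F x = F 0%N + F 1%N + \sum_(2 <= x < N.-1) F x + F N.-1.
Proof.
have N0 : N = N.-1.+1 by lia.
rewrite {1}N0 big_nat_recr //=; congr (_ + _).
by rewrite big_ltn ?(@big_ltn _ _ _ 1) ?addrA //; lia.
Qed.

End IntSums.

(** * Positive modes: commutators and telescoping *)

Section PositiveModes.
Context (K : numFieldType) (A : pzRingType) (phi : {rmorphism K -> A}).
Hypothesis phiC : forall k x, phi k * x = x * phi k.
Context (N : nat) (N3 : (2 < N)%N) (c : K).
Context (nul : (nat -> A) -> Prop) (e : int -> int -> A).
Hypothesis nulP : null_sequences nul.
Hypothesis eP : affine_family phi N c nul e.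
Implicit Types (a b p q t j x s : int).
Local Notation Z := 'Z_N.

Local Notation root_p := (root_p e).
Local Notation asym := (asym nul).

Lemma nul_far a b p q : nul (fun n => e (a - N%:Z * n%:Z) b * e p (q - N%:Z * n%:Z)).
Proof.
apply: (@nul_eq _ _ nulP _ _ (`|a - b|.+1)%N (af_null eP a b p q)) => n hn.
have h : a - N%:Z * n%:Z != b by apply/eqP => h; nia.
by rewrite -(af_shift_neq eP n%:Z h) subrK.
Qed.

Variables (m : nat) (m0 : (0 < m)%N).
Local Notation M := m.-1.

(** [Dg b] is E_{b,b}(m). [Pq b x] is a term of the commutator with inner index x, and [Vq] its case
    x = b modulo N; [Xq] comes from the root vector acting on the inner index; [Wq u] sums [Pq] over
    b at distance u modulo N. *)
Definition Dg b := e (b - N%:Z * m%:Z) b.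
Definition Pq b x := e x b * e (b - N%:Z * m%:Z) x.
Definition Vq b t := Pq b (b + N%:Z * t).
Definition Xq b t := e (b + N%:Z * t) b * e (b + 1 - N%:Z * m%:Z) (b + 1 + N%:Z * t).
Definition Wq (u : nat) t := \sum_(1 <= b < N.+1) Pq b%:Z (b%:Z + u%:Z + N%:Z * t).

Lemma PqDN b x : x != b -> x != b - N%:Z * m%:Z -> Pq (b + N%:Z) (x + N%:Z) = Pq b x.
Proof.
move=> h1 h2; rewrite /Pq; congr (_ * _).
  by have := af_shift_neq eP 1 h1; rewrite mulr1.
have -> : b + N%:Z - N%:Z * m%:Z = b - N%:Z * m%:Z + N%:Z * 1 by lia.
by have := @af_shift_neq _ _ _ _ _ _ _ eP _ _ 1 _; rewrite mulr1 => -> //; rewrite eq_sym.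
Qed.

Lemma nul_Pq b a s : nul (fun n => Pq b (a + N%:Z * (s - n%:Z))).
Proof.
apply: nul_ext (nul_far (a + N%:Z * s) b (b - N%:Z * m%:Z) (a + N%:Z * s)) => n.
by rewrite /Pq; congr (e _ _ * e _ _); lia.
Qed.

Lemma nul_Wq u s : nul (fun n => Wq u (s - n%:Z)).
Proof. by apply: nul_sum => // b; exact: nul_Pq. Qed.

Lemma nul_Xq b s : nul (fun n => Xq b (s - n%:Z)).
Proof.
apply: nul_ext (nul_far (b + N%:Z * s) b (b + 1 - N%:Z * m%:Z) (b + 1 + N%:Z * s)) => n.
by rewrite /Xq; congr (e _ _ * e _ _); lia.
Qed.

Lemma modulus_neq (u : nat) t : (0 < u < N)%N -> u%:Z + N%:Z * t != 0.
Proof. by move=> uN; apply/eqP => h; case: (ltrP t 0) => ht; nia. Qed.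

Lemma sum_Pq_shift (u : nat) t (d : nat) : (0 < u < N)%N -> (d <= 2)%N ->
  \sum_(1 <= j < N.+1) Pq (j%:Z + d%:Z) (j%:Z + d%:Z + u%:Z + N%:Z * t) = Wq u t.
Proof.
move=> uN; pose G b := Pq b (b + u%:Z + N%:Z * t).
have GN b : G (b + N%:Z) = G b.
  rewrite /G -[RHS]PqDN; first by congr (Pq _ _); lia.
    by apply/eqP => h; have := modulus_neq t uN; lia.
  by apply/eqP => h; have := modulus_neq (t + m%:Z) uN; lia.
have G1N b : G (b + N%:Z + 1) = G (b + 1) by rewrite addrAC GN.
have h1 := sum_period_shift N3 GN.
have h2 := @sum_period_shift _ _ N3 (fun b => G (b + 1)) G1N.
case: d => [|[|[|//]]] _; rewrite /Wq.
- by apply: eq_bigr => j _; rewrite addr0.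
- exact: h1.
rewrite -[RHS]h1 -[RHS]h2; apply: eq_bigr => j _.
by rewrite /G -!addrA.
Qed.

(** The two outer indices give the bulk terms; the inner index contributes only in the classes of j
    + 1 and j + 2. *)
Lemma commr_Pq j x : commr (root_p (j + 1)) (e x (j + 1) * e (j + 2 - N%:Z * m%:Z) x) =
  Pq (j + 1) x - Pq (j + 2) x
  + (if x%:~R == j%:~R + 2%:R :> Z then e (x - 1) (j + 1) * e (j + 2 - N%:Z * m%:Z) x else 0)
  - (if x%:~R == j%:~R + 1 :> Z then e x (j + 1) * e (j + 2 - N%:Z * m%:Z) (x + 1) else 0).
Proof.
have h1 : (j + 1)%:~R = j%:~R + 1 :> Z by rewrite rmorphD.
have h2 : (j + 2 - N%:Z * m%:Z)%:~R = j%:~R + 2%:R :> Z by rewrite -mulrN (Zp_intDN N3) rmorphD.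
rewrite commrMr !(commr_root_p N3 eP) !h1 h2 -addrA -mulr2n !eqxx.
have -> : j + 1 + 1 = j + 2 by lia.
have -> : j + 2 - N%:Z * m%:Z - 1 = j + 1 - N%:Z * m%:Z by lia.
by rewrite /Pq; case: (_ == _); case: (_ == _); ncring.
Qed.

Lemma commr_bigsum (u : A) (r : seq nat) (F : nat -> A) :
  commr u (\sum_(l <- r) F l) = \sum_(l <- r) commr u (F l).
Proof. exact: raddf_sum. Qed.

Definition window (G : int -> A) s (n : nat) : A := \sum_(0 <= l < n) G (s - l%:Z).

Local Notation w j := (w_perm ((j + 1)%:~R : Z) m).

(** The windows correspond to the classes x = 0, 1, 2..N-2 and N-1 of the inner index; their upper
    ends record how far w has translated each class. *)
Lemma commr_quad j n :
  commr (root_p (j + 1)) (quad N e (fun l => w j (j - l%:Z)) (j + 2 - N%:Z * m%:Z) (j + 1) n) =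
  (window (Vq (j + 1)) (-1) n
   + window (fun t => Pq (j + 1) (j + 1 + 2%:Z + N%:Z * t)) (M%:Z - 1) n
   + \sum_(2 <= x < N.-1) window (fun t => Pq (j + 1) (j + 1 + x.+1%:Z + N%:Z * t)) (-1) n
   + window (fun t => Pq (j + 1) (j + 1 + 1%:Z + N%:Z * t)) (- m%:Z) n)
  - (window (fun t => Pq (j + 2) (j + 2 + N.-1%:Z + N%:Z * t)) (-2) n
   + window (fun t => Pq (j + 2) (j + 2 + 1%:Z + N%:Z * t)) (M%:Z - 1) n
   + \sum_(2 <= x < N.-1) window (fun t => Pq (j + 2) (j + 2 + x%:Z + N%:Z * t)) (-1) n
   + window (Vq (j + 2)) (- m%:Z) n)
  + window (Xq (j + 1)) (- m%:Z) n - window (Xq (j + 1)) (-1) n.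
Proof.
pose G y := commr (root_p (j + 1)) (e (w j y) (j + 1) * e (j + 2 - N%:Z * m%:Z) (w j y)).
rewrite /quad commr_bigsum -/(\sum_(0 <= l < N * n) G (j - l%:Z)) (sum_residues N3 G).
rewrite (sum_ends N3).
have wE (x l : nat) : (x < N)%N -> w j (j + 1 + x%:Z + N%:Z * (-1 - l%:Z)) =
   (if x == 0 then j + 1 else if x == 1 then j + 3 + N%:Z * M%:Z
    else if x == N.-1 then j + 2 - N%:Z * M%:Z else j + 2 + x%:Z) + N%:Z * (-1 - l%:Z).
  by move=> xN; rewrite (w_permDN N3) (w_perm_near N3).
have N1 : (N.-1 == 0)%N = false by lia.
have N2 : (N.-1 == 1)%N = false by lia.
have flag (d k : int) : `|d - 2| < N%:Z -> `|d - 1| < N%:Z ->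
    ((j + d + N%:Z * k)%:~R == j%:~R + 2%:R :> Z) = (d == 2) /\
    ((j + d + N%:Z * k)%:~R == j%:~R + 1 :> Z) = (d == 1).
  move=> h1 h2; have S y : j%:~R + y%:~R = (j + y)%:~R :> Z by rewrite [RHS]rmorphD.
  rewrite (Zp_intDN N3) (S 2) (S 1) !(Zp_near N3) ?(inj_eq (addrI j)) //; lia.
have e0 : \sum_(0 <= l < n) G (j + 1 + 0%:Z + N%:Z * (-1 - l%:Z)) =
    window (Vq (j + 1)) (-1) n
    - window (fun t => Pq (j + 2) (j + 2 + N.-1%:Z + N%:Z * t)) (-2) n
    - window (Xq (j + 1)) (-1) n.
  rewrite /window -!sumrB; apply: eq_bigr => l _; rewrite /G wE ?eqxx; last lia.
  rewrite commr_Pq; have [-> ->] := flag 1 (-1 - l%:Z) ltac:(lia) ltac:(lia).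
  rewrite /= addr0; congr (Pq _ _ - Pq _ _ - e _ _ * e _ _); lia.
have e1 : \sum_(0 <= l < n) G (j + 1 + 1%:Z + N%:Z * (-1 - l%:Z)) =
    window (fun t => Pq (j + 1) (j + 1 + 2%:Z + N%:Z * t)) (M%:Z - 1) n
    - window (fun t => Pq (j + 2) (j + 2 + 1%:Z + N%:Z * t)) (M%:Z - 1) n.
  rewrite /window -!sumrB; apply: eq_bigr => l _; rewrite /G wE /=; last lia.
  have -> : j + 3 + N%:Z * M%:Z + N%:Z * (-1 - l%:Z) = j + 3 + N%:Z * (M%:Z - 1 - l%:Z) by lia.
  rewrite commr_Pq; have [-> ->] := flag 3 (M%:Z - 1 - l%:Z) ltac:(lia) ltac:(lia).
  rewrite /= addr0 subr0; congr (Pq _ _ - Pq _ _); lia.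
have ex (x : nat) : (2 <= x < N.-1)%N -> \sum_(0 <= l < n) G (j + 1 + x%:Z + N%:Z * (-1 - l%:Z)) =
    window (fun t => Pq (j + 1) (j + 1 + x.+1%:Z + N%:Z * t)) (-1) n
    - window (fun t => Pq (j + 2) (j + 2 + x%:Z + N%:Z * t)) (-1) n.
  move=> hx; rewrite /window -!sumrB; apply: eq_bigr => l _; rewrite /G wE; last lia.
  rewrite !ifF; try lia.
  have -> : j + 2 + x%:Z + N%:Z * (-1 - l%:Z) = j + (2 + x%:Z) + N%:Z * (-1 - l%:Z) by lia.
  rewrite commr_Pq; have [-> ->] := flag (2 + x%:Z) (-1 - l%:Z) ltac:(lia) ltac:(lia).
  rewrite !ifF ?addr0 ?subr0; try lia.
  by congr (Pq _ _ - Pq _ _); lia.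
have eN : \sum_(0 <= l < n) G (j + 1 + N.-1%:Z + N%:Z * (-1 - l%:Z)) =
    window (fun t => Pq (j + 1) (j + 1 + 1%:Z + N%:Z * t)) (- m%:Z) n
    - window (Vq (j + 2)) (- m%:Z) n + window (Xq (j + 1)) (- m%:Z) n.
  rewrite /window -!sumrB -big_split; apply: eq_bigr => l _; rewrite /G wE; last lia.
  rewrite N1 N2 eqxx.
  have -> : j + 2 - N%:Z * M%:Z + N%:Z * (-1 - l%:Z) = j + 2 + N%:Z * (- m%:Z - l%:Z).
    by (have -> : m%:Z = M%:Z + 1 by lia); lia.
  rewrite commr_Pq; have [-> ->] := flag 2 (- m%:Z - l%:Z) ltac:(lia) ltac:(lia).
  rewrite /= subr0; congr (Pq _ _ - Pq _ _ + e _ _ * e _ _); lia.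
rewrite e0 e1 eN big_nat (eq_bigr _ ex) -big_nat sumrB.
ncring.
Qed.

Lemma asym_window (G : int -> A) s (k : nat) : (forall s, nul (fun n => G (s - n%:Z))) ->
  asym (fun n => window G (s + k%:Z) n - window G s n) (fun=> \sum_(0 <= t < k) G (s + 1 + t%:Z)).
Proof.
move=> hG; apply: (@nul_ext A nul _ _ _ (window_shift nulP s k hG)) => n.
by rewrite /window; ncring.
Qed.

Lemma sum_window (u d : nat) s n : (0 < u < N)%N -> (d <= 2)%N ->
  \sum_(1 <= j < N.+1) window (fun t => Pq (j%:Z + d%:Z) (j%:Z + d%:Z + u%:Z + N%:Z * t)) s n
  = window (Wq u) s n.
Proof.
move=> hu hd; rewrite /window exchange_big; apply: eq_bigr => l _.
exact: sum_Pq_shift.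
Qed.

Lemma nul_Vq b s : nul (fun n => Vq b (s - n%:Z)).
Proof. exact: nul_Pq. Qed.

(** The sum closes up around the cycle except in the top term l = 0, whose second factor e(b - N m,
    b - N m) is diagonal: moving it by N costs c. *)
Lemma sum_Vq_telescope n : (0 < n)%N ->
  \sum_(1 <= j < N.+1) window (Vq (j%:Z + 1)) (- m%:Z) n
  - \sum_(1 <= j < N.+1) window (Vq (j%:Z + 2)) (- m%:Z) n = phi c * Dg 2.
Proof.
move=> n0; rewrite -sumrB.
rewrite (eq_bigr (fun j : nat => - (window (Vq (j.+1%:Z + 1)) (- m%:Z) n - window (Vq (j%:Z + 1)) (- m%:Z) n))).
  rewrite sumrN (@telescope_sumr _ 1 N.+1 (fun j : nat => window (Vq (j%:Z + 1)) (- m%:Z) n)) // opprB.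
  rewrite /window -sumrB -{1}(prednK n0) big_nat_recl // big1 ?addr0 => [|l _].
    rewrite /Vq /Pq.
    have -> : 1%:Z + 1 + N%:Z * - m%:Z = 2 - N%:Z * m%:Z by lia.
    have -> : 1%:Z + 1 - N%:Z * m%:Z = 2 - N%:Z * m%:Z by lia.
    have -> : N.+1%:Z + 1 + N%:Z * - m%:Z = 2 - N%:Z * m%:Z + N%:Z * 1 by lia.
    have -> : N.+1%:Z + 1 - N%:Z * m%:Z = 2 - N%:Z * m%:Z + N%:Z * 1 by lia.
    have -> : N.+1%:Z + 1 = 2 + N%:Z * 1 by lia.
    have h : (2 - N%:Z * m%:Z == 2) = false by apply/eqP => h; nia.
    rewrite !(af_shift eP) eqxx h subr0 mulr1 /Dg (_ : 1%:Z + 1 = 2) // phiC; ncring.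
  apply/eqP; rewrite subr_eq0; apply/eqP; rewrite /Vq.
  have -> : N.+1%:Z + 1 + N%:Z * (- m%:Z - l.+1%:Z) = 1%:Z + 1 + N%:Z * (- m%:Z - l.+1%:Z) + N%:Z by lia.
  have -> : N.+1%:Z + 1 = 1%:Z + 1 + N%:Z by lia.
  by rewrite PqDN //; apply/eqP => h; nia.
by move=> j _; rewrite opprB; congr (window (Vq _) _ _ - window (Vq _) _ _); lia.
Qed.

(* The image of [R_m]; the last two sums come from its Cartan part. *)
Definition Rq := Wq N.-1 (-1) - \sum_(0 <= t < M + M) Wq 1 (- m%:Z + 1 + t%:Z)
  + \sum_(0 <= t < M) Wq 2 t%:Z
  + (\sum_(1 <= j < N.+1) \sum_(0 <= t < M) Vq (j%:Z + 1) (- m%:Z + 1 + t%:Z)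
     - \sum_(1 <= j < N.+1) \sum_(0 <= t < M) Xq (j%:Z + 1) (- m%:Z + 1 + t%:Z)).

(** The middle classes telescope from [Wq 2] to [Wq N.-1]. There remain pairs of windows of [Wq 1],
    [Wq 2], [Wq N.-1], [Vq] and [Xq] with different upper ends, and each difference tends to a
    finite boundary sum. *)
Lemma asym_commr_quad :
  asym (fun n => \sum_(1 <= j < N.+1) commr (root_p (j%:Z + 1))
    (quad N e (fun l => w j%:Z (j%:Z - l%:Z)) (j%:Z + 2 - N%:Z * m%:Z) (j%:Z + 1) n))
  (fun=> phi c * Dg 2 + Rq).
Proof.
have h1 := @asym_window (Wq 2) (-1) M (nul_Wq 2).
have h2 := @asym_window (Wq N.-1) (-2) 1 (nul_Wq N.-1).
have h3 := @asym_window (Wq 1) (- m%:Z) (M + M) (nul_Wq 1).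
have h4 := asym_sum nulP (index_iota 1 N.+1)
  (fun j : nat => @asym_window (Vq (j%:Z + 1)) (- m%:Z) M (nul_Vq (j%:Z + 1))).
have h5 := asym_sum nulP (index_iota 1 N.+1)
  (fun j : nat => @asym_window (Xq (j%:Z + 1)) (- m%:Z) M (nul_Xq (j%:Z + 1))).
have h := asymD nulP (asymD nulP (asymB nulP (asymD nulP h1 h2) h3) (asymB nulP h4 h5))
  (asym_refl nulP (fun=> phi c * Dg 2)).
have E1 : - m%:Z + M%:Z = -1 by lia.
have E2 : -1 + M%:Z = M%:Z - 1 by lia.
have E3 : -2 + 1%:Z = -1 by [].
have E4 : - m%:Z + (M + M)%:Z = M%:Z - 1 by lia.
rewrite E1 E2 E3 E4 in h.
rewrite (_ : phi c * Dg 2 + Rq = \sum_(0 <= t < M) Wq 2 (-1 + 1 + t%:Z)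
    + \sum_(0 <= t < 1) Wq N.-1 (-1 + t%:Z)
    - \sum_(0 <= t < M + M) Wq 1 (- m%:Z + 1 + t%:Z)
    + (\sum_(1 <= j < N.+1) \sum_(0 <= t < M) Vq (j%:Z + 1) (- m%:Z + 1 + t%:Z)
     - \sum_(1 <= j < N.+1) \sum_(0 <= t < M) Xq (j%:Z + 1) (- m%:Z + 1 + t%:Z))
    + phi c * Dg 2); last first.
  rewrite /Rq [\sum_(0 <= t < 1) _]big_nat1 (_ : -1 + 0%:Z = -1) //.
  have -> : \sum_(0 <= t < M) Wq 2 (-1 + 1 + t%:Z) = \sum_(0 <= t < M) Wq 2 t%:Z.
    by apply: eq_bigr => t _; congr (Wq _ _); lia.
  ncring.
apply: (asym_trans nulP _ h); apply: (@asym_eq _ _ nulP _ _ 1%N) => n n0.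
under eq_bigr do rewrite commr_quad.
rewrite !(sumrB, big_split) /= -(sum_Vq_telescope n0).
have sw (u d : nat) s : (0 < u < N)%N -> (d <= 2)%N ->
  \sum_(1 <= j < N.+1) window (fun t => Pq (j%:Z + d%:Z) (j%:Z + d%:Z + u%:Z + N%:Z * t)) s n
  = window (Wq u) s n by exact: sum_window.
rewrite !(sw 1%N 2%N, sw 1%N 1%N, sw 2%N 1%N, sw N.-1 2%N) //; try lia.
have -> : \sum_(1 <= j < N.+1) \sum_(2 <= x < N.-1)
    window (fun t => Pq (j%:Z + 1) (j%:Z + 1 + x.+1%:Z + N%:Z * t)) (-1) n =
    \sum_(2 <= x < N.-1) window (Wq x.+1) (-1) n.
  by rewrite exchange_big_nat; apply: eq_big_nat => x hx; apply: (sw x.+1 1%N); lia.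
have -> : \sum_(1 <= j < N.+1) \sum_(2 <= x < N.-1)
    window (fun t => Pq (j%:Z + 2) (j%:Z + 2 + x%:Z + N%:Z * t)) (-1) n =
    \sum_(2 <= x < N.-1) window (Wq x) (-1) n.
  by rewrite exchange_big_nat; apply: eq_big_nat => x hx; apply: (sw x 2%N); lia.
have := @telescope_sumr _ 2 N.-1 (fun x : nat => window (Wq x) (-1) n) ltac:(lia).
rewrite sumrB => /eqP; rewrite subr_eq => /eqP ->.
ncring.
Qed.

(** Summation by parts: the weights grow by eps, which leaves eps on every diagonal element and two
    end terms. *)
Lemma sum_Dg_abel (eps : K) (n : nat) :
  \sum_(1 <= j < n.+1) phi (1 + j%:R * eps) * (Dg (j%:Z + 1) - Dg (j%:Z + 2)) =
  phi eps * \sum_(1 <= j < n.+1) Dg (j%:Z + 1) + Dg 2 - phi (1 + n%:R * eps) * Dg (n%:Z + 2).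
Proof.
elim: n => [|n IH].
  by rewrite !big_geq // mul0r addr0 rmorph1 mulr0 mul1r add0r subrr.
rewrite !(@big_nat_recr _ _ _ n.+1) //= IH.
have -> : n.+1%:Z + 1 = n%:Z + 2 by lia.
have -> : phi (1 + n.+1%:R * eps) = phi (1 + n%:R * eps) + phi eps.
  by rewrite -rmorphD -natr1 mulrDl mul1r addrA.
ncring.
Qed.

Lemma DgDN b : Dg (b + N%:Z) = Dg b.
Proof.
have h : b - N%:Z * m%:Z != b by apply/eqP => h; nia.
have := af_shift_neq eP 1 h; rewrite mulr1 /Dg => <-.
by congr e; lia.
Qed.

Lemma commr_phi_affine (k h : K) (x u v : A) :
  commr x (phi k * u + phi h * v) = phi k * commr x u + phi h * commr x v.
Proof. by rewrite commrDr !(commr_phi phiC). Qed.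

Lemma nul_sum_nat (a b : nat) (F : nat -> nat -> A) :
  (forall i, (a <= i < b)%N -> nul (F i)) -> nul (fun n => \sum_(a <= i < b) F i n).
Proof.
move=> h; apply: (@nul_ext _ _ (fun n => \sum_(a <= i < b) (if (a <= i < b)%N then F i n else 0))).
  by move=> n; apply: eq_big_nat => i ->.
apply: (nul_sum nulP) => i; case hi: (a <= i < b)%N; [exact: h|exact: (nul0 nulP)].
Qed.

(** For n = N the end terms of [sum_Dg_abel] amount to -N eps2 times [Dg 2], while the quadratic
    part contributes hbar c times [Dg 2]. *)
Lemma main_pos (eps2 hbar : K) (S : nat -> A) : hbar * c = N%:R * eps2 ->
  (forall j : nat, (1 <= j < N.+1)%N -> nul (fun n =>
    quad N e (fun l => w j%:Z (j%:Z - l%:Z)) (j%:Z + 2 - N%:Z * m%:Z) (j%:Z + 1) n - S j)) ->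
  \sum_(1 <= j < N.+1) commr (root_p (j%:Z + 1))
    (phi (1 + j%:R * eps2) * e (j%:Z + 2 - N%:Z * m%:Z) (j%:Z + 1) + phi hbar * S j) =
  phi eps2 * (\sum_(1 <= b < N.+1) Dg b%:Z) + phi hbar * Rq.
Proof.
move=> hc hS.
under eq_bigr do rewrite commr_phi_affine.
rewrite big_split /= -mulr_sumr.
have -> : \sum_(1 <= j < N.+1) commr (root_p (j%:Z + 1)) (S j) = phi c * Dg 2 + Rq.
  apply: (asym_const nulP); apply: (asym_trans nulP _ asym_commr_quad).
  apply: (asym_sym nulP); 
  pose F (j n : nat) := commr (root_p (j%:Z + 1))
    (quad N e (fun l => w j%:Z (j%:Z - l%:Z)) (j%:Z + 2 - N%:Z * m%:Z) (j%:Z + 1) n - S j).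
  have hF (j : nat) : (1 <= j < N.+1)%N -> nul (F j).
    by move=> hj; exact: (nul_commr nulP _ (hS j hj)).
  apply: (@nul_ext A nul _ _ _ (nul_sum_nat hF)).
  by move=> n; rewrite -sumrB; apply: eq_bigr => j _; exact: commr_zmod.
rewrite (eq_bigr (fun j : nat => phi (1 + j%:R * eps2) * (Dg (j%:Z + 1) - Dg (j%:Z + 2)))) => [|j _].
  rewrite sum_Dg_abel (sum_period_shift N3 DgDN) (addrC N%:Z) DgDN -hc.
  rewrite rmorphD rmorph1 rmorphM; ncring.
congr (_ * _); rewrite (commr_root_p N3 eP).
have h1 : (j%:Z + 1)%:~R + 1 = (j%:Z + 2)%:~R :> Z.
  by have -> : j%:Z + 2 = j%:Z + 1 + 1; [lia|rewrite [RHS]rmorphD].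
rewrite h1 -mulrN (Zp_intDN N3) !eqxx /Dg; congr (e _ _ - e _ _); lia.
Qed.

End PositiveModes.

(** * Mode zero: the Cartan elements *)

Section LevelZero.
Context (K : numFieldType) (A : pzRingType) (phi : {rmorphism K -> A}).
Hypothesis phiC : forall k x, phi k * x = x * phi k.
Context (N : nat) (N3 : (2 < N)%N) (c : K).
Context (nul : (nat -> A) -> Prop) (e : int -> int -> A).
Hypothesis nulP : null_sequences nul.
Hypothesis eP : affine_family phi N c nul e.
Implicit Types (a b t x s : int) (j : nat).
Local Notation Z := 'Z_N.

Local Notation root_m := (root_m e).
Local Notation asym := (asym nul).

Definition P0 b x := e x b * e b x.
Definition Z0 b t := e (b + 1 + N%:Z * t) (b + 1) * e b (b + N%:Z * t).

Lemma nul_Z0 b s : nul (fun n => Z0 b (s - n%:Z)).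
Proof.
apply: (@nul_ext A nul _ _ _ (nul_far N3 nulP eP (b + 1 + N%:Z * s) (b + 1) b (b + N%:Z * s))) => n.
by rewrite /Z0; congr (e _ _ * e _ _); lia.
Qed.

Lemma nul_P0 b a : nul (fun n => P0 b (a - N%:Z * n%:Z)).
Proof. exact: (nul_far N3 nulP eP a b b a). Qed.

Lemma commr_P0 b x : commr (e x (b + 1) * e b x) (root_m b) =
  P0 b x - P0 (b + 1) x
  + ((if x%:~R == b%:~R + 1 :> Z then e x (b + 1) * e b (x - 1) else 0)
  - (if x%:~R == b%:~R :> Z then e (x + 1) (b + 1) * e b x else 0)).
Proof.
have h1 : (b + 1)%:~R = b%:~R + 1 :> Z by rewrite rmorphD.
rewrite commr_anti commrMr !(commr_root_m N3 eP) !h1 !eqxx addrK /P0.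
by case: (_ == _); case: (_ == _); ncring.
Qed.

(** The inner index contributes only in the classes of b and b + 1, and there gives two windows of
    one sequence, with upper ends -1 and 0. *)
Lemma commr_quad0 b n :
  commr (quad N e (fun l => b - l%:Z) b (b + 1) n) (root_m b) =
  \sum_(0 <= l < N * n) (P0 b (b - l%:Z) - P0 (b + 1) (b - l%:Z))
  + (window (Z0 b) (-1) n - window (Z0 b) 0 n).
Proof.
rewrite /quad commr_anti (commr_bigsum (root_m b)) -sumrN.
pose G x := (if x%:~R == b%:~R + 1 :> Z then e x (b + 1) * e b (x - 1) else 0)
  - (if x%:~R == b%:~R :> Z then e (x + 1) (b + 1) * e b x else 0).
under eq_bigr do rewrite -commr_anti commr_P0.
rewrite big_split /=; congr (_ + _).
rewrite -/(\sum_(0 <= l < N * n) G (b - l%:Z)) (sum_residues N3 G) (sum_ends N3).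
have flag (d k : int) : `|d| < N%:Z -> `|d - 1| < N%:Z ->
    ((b + d + N%:Z * k)%:~R == b%:~R + 1 :> Z) = (d == 1) /\
    ((b + d + N%:Z * k)%:~R == b%:~R :> Z) = (d == 0).
  move=> h1 h2; have S y : b%:~R + y%:~R = (b + y)%:~R :> Z by rewrite [RHS]rmorphD.
  rewrite !(Zp_intDN N3) (S 1) !(Zp_near N3); [|lia|lia].
  by split; apply/eqP/eqP; lia.
have e0 : \sum_(0 <= l < n) G (b + 1 + 0%:Z + N%:Z * (-1 - l%:Z)) = window (Z0 b) (-1) n.
  apply: eq_bigr => l _; rewrite /G.
  have -> : b + 1 + 0%:Z + N%:Z * (-1 - l%:Z) = b + 1 + N%:Z * (-1 - l%:Z) by lia.
  have [-> ->] := flag 1 (-1 - l%:Z) ltac:(lia) ltac:(lia).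
  by rewrite /= subr0; congr (e _ _ * e _ _); lia.
have eN : \sum_(0 <= l < n) G (b + 1 + N.-1%:Z + N%:Z * (-1 - l%:Z)) = - window (Z0 b) 0 n.
  rewrite /window -sumrN; apply: eq_bigr => l _; rewrite /G.
  have -> : b + 1 + N.-1%:Z + N%:Z * (-1 - l%:Z) = b + 0 + N%:Z * (0 - l%:Z) by lia.
  have [-> ->] := flag 0 (0 - l%:Z) ltac:(lia) ltac:(lia).
  by rewrite /= sub0r; congr (- (e _ _ * e _ _)); lia.
have ex (x : nat) : (1 <= x < N.-1)%N -> \sum_(0 <= l < n) G (b + 1 + x%:Z + N%:Z * (-1 - l%:Z)) = 0.
  move=> hx; apply: big1 => l _; rewrite /G.
  have -> : b + 1 + x%:Z + N%:Z * (-1 - l%:Z) = b + (1 + x%:Z) + N%:Z * (-1 - l%:Z) by lia.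
  have [-> ->] := flag (1 + x%:Z) (-1 - l%:Z) ltac:(lia) ltac:(lia).
  by rewrite !ifF ?subr0 //; lia.
rewrite e0 eN (ex 1%N); last lia.
rewrite big_nat big1 => [|x hx]; last by apply: ex; lia.
ncring.
Qed.

Lemma P0DN b x : x != b -> P0 (b + N%:Z) (x + N%:Z) = P0 b x.
Proof.
move=> h; have h' : b != x by rewrite eq_sym.
have := af_shift_neq eP 1 h; have := af_shift_neq eP 1 h'.
by rewrite mulr1 /P0 => -> ->.
Qed.

(** Each new term cancels the previous end term after b is shifted around the cycle. [P0DN] permits
    this off the diagonal; the diagonal term itself is never moved. *)
Lemma sum_P0 (L : nat) :
  \sum_(1 <= j < N.+1) \sum_(0 <= l < L) (P0 j%:Z (j%:Z - l%:Z) - P0 (j%:Z + 1) (j%:Z - l%:Z)) =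
  \sum_(1 <= j < N.+1) (P0 j%:Z j%:Z - P0 j%:Z (j%:Z - L%:Z)).
Proof.
elim: L => [|L IH].
  by rewrite !big1 // => j _; rewrite ?big_geq // subr0 subrr.
under eq_bigr do rewrite big_nat_recr //=.
rewrite big_split /= IH -big_split /=.
pose G b := P0 b (b - L.+1%:Z).
have GN b : G (b + N%:Z) = G b.
  rewrite /G -[RHS]P0DN; first by congr P0; lia.
  by apply/eqP; lia.
rewrite [RHS]sumrB -(sum_period_shift N3 GN) -sumrB; apply: eq_bigr => j _.
rewrite /G (_ : j%:Z + 1 - L.+1%:Z = j%:Z - L%:Z); last lia.
ncring.
Qed.

Lemma diag_comm a b : `|a - b| < N%:Z -> e a a * e b b = e b b * e a a.
Proof.
move=> h; have [->//|ab] := eqVneq a b.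
apply/eqP; rewrite -subr_eq0 -/(commr (e a a) (e b b)) (af_bracket eP) (Zp_near N3) //.
by rewrite (negPf ab) subr0.
Qed.

Lemma sum_diag_abel (eps : K) (n : nat) :
  \sum_(1 <= j < n.+1) phi (1 + j%:R * eps) * (e j%:Z j%:Z - e (j%:Z + 1) (j%:Z + 1)) =
  phi eps * \sum_(1 <= j < n.+1) e j%:Z j%:Z + e 1 1 - phi (1 + n%:R * eps) * e (n%:Z + 1) (n%:Z + 1).
Proof.
elim: n => [|n IH].
  by rewrite !big_geq // mul0r addr0 rmorph1 mulr0 mul1r add0r subrr.
rewrite !(@big_nat_recr _ _ _ n.+1) //= IH.
have -> : n.+1%:Z = n%:Z + 1 by lia.
have -> : phi (1 + n.+1%:R * eps) = phi (1 + n%:R * eps) + phi eps.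
  by rewrite -rmorphD -natr1 mulrDl mul1r addrA.
ncring.
Qed.

Lemma sum_commr_S0 (S : nat -> A) :
  (forall j, (1 <= j < N.+1)%N -> nul (fun n =>
    quad N e (fun l => j%:Z - l%:Z) j%:Z (j%:Z + 1) n - S j)) ->
  \sum_(1 <= j < N.+1) commr (S j) (root_m j%:Z) =
  \sum_(1 <= j < N.+1) (e j%:Z j%:Z * e j%:Z j%:Z - e (j%:Z + 1) (j%:Z + 1) * e j%:Z j%:Z).
Proof.
move=> hS; apply: (asym_const nulP).
pose F (j n : nat) := commr (quad N e (fun l => j%:Z - l%:Z) j%:Z (j%:Z + 1) n - S j) (root_m j%:Z).
have hF (j : nat) : (1 <= j < N.+1)%N -> nul (F j).
  move=> hj; apply: (@nul_ext A nul _ _ _ (nulN nulP (nul_commr nulP (root_m j%:Z) (hS j hj)))) => n.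
  by rewrite /F [RHS]commr_anti.
have h1 : asym (fun n => \sum_(1 <= j < N.+1) commr (quad N e (fun l => j%:Z - l%:Z) j%:Z (j%:Z + 1) n) (root_m j%:Z))
   (fun=> \sum_(1 <= j < N.+1) commr (S j) (root_m j%:Z)).
  apply: (@nul_ext A nul _ _ _ (nul_sum_nat nulP hF)) => n.
  by rewrite -sumrB; apply: eq_bigr => j _; rewrite /F /commr; ncring.
apply: (asym_trans nulP (asym_sym nulP h1)).
have h2 := asym_sum nulP (index_iota 1 N.+1)
  (fun j : nat => asym_window nulP (-1) 1 (nul_Z0 j%:Z)).
have h3 : nul (fun n => \sum_(1 <= j < N.+1) P0 j%:Z (j%:Z - N%:Z * n%:Z)).
  by apply: (nul_sum nulP) => j; exact: nul_P0.
apply: (@nul_ext A nul _ _ _ (nulN nulP (nulD nulP h2 h3))) => n.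
under [X in _ = X - _]eq_bigr do rewrite commr_quad0.
rewrite [X in _ = X - _]big_split /= sum_P0 !sumrB.
rewrite (_ : -1 + 1%:Z = 0) //.
have -> : \sum_(1 <= j < N.+1) P0 j%:Z (j%:Z - (N * n)%N%:Z) =
  \sum_(1 <= j < N.+1) P0 j%:Z (j%:Z - N%:Z * n%:Z) by apply: eq_bigr => j _; rewrite PoszM.
have -> : \sum_(1 <= j < N.+1) \sum_(0 <= t < 1) Z0 j%:Z (-1 + 1 + t%:Z) =
    \sum_(1 <= j < N.+1) e (j%:Z + 1) (j%:Z + 1) * e j%:Z j%:Z.
  by apply: eq_bigr => j _; rewrite big_nat1 /Z0 !mulr0 !addr0.
rewrite /P0; ncring.
Qed.

(** Subtracting (hbar / 2) h_j^2 turns hbar (e_j^2 - e_{j+1} e_j) into (hbar / 2) (e_j^2 -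
    e_{j+1}^2), which telescopes. Since e_{N+1} = e_1 - c, the ends together with those of
    [sum_diag_abel] leave the constant c + (hbar / 2) c^2 of a_0. *)
Lemma main_zero (eps2 hbar : K) (S : nat -> A) : hbar * c = N%:R * eps2 ->
  (forall j, (1 <= j < N.+1)%N -> nul (fun n =>
    quad N e (fun l => j%:Z - l%:Z) j%:Z (j%:Z + 1) n - S j)) ->
  \sum_(1 <= j < N.+1) (commr (phi (1 + j%:R * eps2) * e j%:Z (j%:Z + 1) + phi hbar * S j) (root_m j%:Z)
    - phi (hbar / 2) * (e j%:Z j%:Z - e (j%:Z + 1) (j%:Z + 1)) ^+ 2) =
  phi (c + hbar / 2 * c ^+ 2) + phi eps2 * (\sum_(1 <= b < N.+1) e b%:Z b%:Z).
Proof.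
move=> hc hS.
rewrite (eq_bigr (fun j => phi (1 + j%:R * eps2) * (e j%:Z j%:Z - e (j%:Z + 1) (j%:Z + 1))
   + phi hbar * commr (S j) (root_m j%:Z)
   - phi (hbar / 2) * (e j%:Z j%:Z - e (j%:Z + 1) (j%:Z + 1)) ^+ 2)) => [|j _]; last first.
  congr (_ - _); rewrite commr_anti (commr_phi_affine phiC) (commr_root_m N3 eP).
  rewrite (_ : (j%:Z + 1)%:~R = j%:Z%:~R + 1 :> Z) ?rmorphD // !eqxx addrK.
  rewrite [commr (S j) _]commr_anti; ncring.
rewrite sumrB big_split /= -[\sum_(1 <= j < N.+1) phi hbar * _]mulr_sumr (sum_commr_S0 hS).
have h2 : phi hbar = phi (hbar / 2) + phi (hbar / 2) by rewrite -rmorphD -splitr.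
have E : phi hbar * (\sum_(1 <= j < N.+1) (e j%:Z j%:Z * e j%:Z j%:Z - e (j%:Z + 1) (j%:Z + 1) * e j%:Z j%:Z))
    - \sum_(1 <= j < N.+1) phi (hbar / 2) * (e j%:Z j%:Z - e (j%:Z + 1) (j%:Z + 1)) ^+ 2 =
    phi (hbar / 2) * (e 1 1 * e 1 1)
    - phi (hbar / 2) * (e (N%:Z + 1) (N%:Z + 1) * e (N%:Z + 1) (N%:Z + 1)).
  rewrite mulr_sumr -sumrB.
  rewrite (eq_bigr (fun j => - (phi (hbar / 2) * (e (j.+1)%:Z (j.+1)%:Z * e (j.+1)%:Z (j.+1)%:Z)
     - phi (hbar / 2) * (e j%:Z j%:Z * e j%:Z j%:Z)))) => [|j _].
    rewrite sumrN (@telescope_sumr _ 1 N.+1 (fun j : nat => phi (hbar / 2) * (e j%:Z j%:Z * e j%:Z j%:Z))) // opprB.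
    by rewrite (_ : N.+1%:Z = N%:Z + 1) //; lia.
  have -> : j.+1%:Z = j%:Z + 1 by lia.
  rewrite expr2 !mulrBl !mulrBr (@diag_comm j%:Z (j%:Z + 1)) ?h2; [|lia].
  ncring.
rewrite -addrA E sum_diag_abel.
have -> : N%:Z + 1 = 1 + N%:Z * 1 by lia.
rewrite (af_shift eP) eqxx mulr1 -hc.
have -> : phi (1 + hbar * c) = 1 + (phi (hbar / 2) + phi (hbar / 2)) * phi c.
  by rewrite rmorphD rmorph1 rmorphM h2.
have -> : phi (c + hbar / 2 * c ^+ 2) = phi c + phi (hbar / 2) * (phi c * phi c).
  by rewrite rmorphD rmorphM rmorphXn expr2.
move: (phi (hbar / 2)) => k; rewrite !mulrBl !mulrBr -(phiC c (e 1 1)).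
ncring.
Qed.

End LevelZero.

(** * The operators [T_w] on the Yangian *)

(** Scalars act through [phi], the target being only a ring; the record thus serves for maps into
    the opposite ring too. *)
Record algebra_map (K : fieldType) (X : choiceType) (rels : free_alg K X -> free_alg K X -> Prop)
    (A : pzRingType) (phi : K -> A) (g : presented rels -> A) : Prop := AlgebraMap {
  map_zmod : zmod_morphism g;
  map_mul : forall x y, g (x * y) = g x * g y;
  map_one : g 1 = 1;
  map_scale : forall a x, g (a *: x) = phi a * g x
}.

Section PresentedAlgebra.
Context (K : numFieldType) (X : choiceType) (rels : free_alg K X -> free_alg K X -> Prop).
Local Notation P := (presented rels).
Implicit Types (x y : P).

Lemma pr_commrZ (a : K) x y : commr x (a *: y) = a *: commr x y.
Proof. by rewrite /commr scalerBr -pr_scalerAr -pr_scalerAl. Qed.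

Lemma pi_commr (u v : free_alg K X) :
  commr (\pi_P u : P)%qT (\pi_P v)%qT = (\pi_P (commr u v))%qT :> P.
Proof. by rewrite /commr piD piN (piM rels u v) (piM rels v u). Qed.

Lemma pi_acommr (u v : free_alg K X) :
  acommr (\pi_P u : P)%qT (\pi_P v)%qT = (\pi_P (acommr u v))%qT :> P.
Proof. by rewrite /acommr piD (piM rels u v) (piM rels v u). Qed.

Lemma pi_rel_acommr (k1 k2 : K) (u v u' v' s t : free_alg K X) :
  rels (commr u v - commr u' v') (k1 *: acommr s t - k2 *: commr s t) ->
  commr (\pi_P u : P)%qT (\pi_P v)%qT - commr (\pi_P u' : P)%qT (\pi_P v')%qT =
  k1 *: acommr (\pi_P s : P)%qT (\pi_P t)%qT - k2 *: commr (\pi_P s : P)%qT (\pi_P t)%qT.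
Proof.
move=> /pi_rel E; rewrite (pi_commr u v) (pi_commr u' v') (pi_commr s t) (pi_acommr s t).
rewrite -(piZ rels k1) -(piZ rels k2) -(piN rels (commr u' v')) -(piN rels (k2 *: _)).
by rewrite -(piD rels (commr u v)) -(piD rels (k1 *: _)).
Qed.

Lemma pi_foldr_commr (T : Type) (u v : free_alg K X) (r : seq T) :
  (\pi_P (foldr (fun _ u' => commr u u') v r))%qT = iter (size r) (commr (\pi_P u : P)%qT) (\pi_P v)%qT.
Proof. by elim: r => [|k r IH]; [exact: erefl|rewrite [size _]/= iterS -IH pi_commr]. Qed.

Lemma pi_natZ_eq0 (n : nat) (u : free_alg K X) : (0 < n)%N ->
  (\pi_P (u *+ n) : P)%qT = (\pi_P 0)%qT -> (\pi_P u : P)%qT = 0.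
Proof.
move=> n0; rewrite -scaler_nat (piZ rels n%:R u) => E.
have := congr1 (GRing.scale (n%:R^-1 : K)) E.
rewrite scalerA mulVf ?pnatr_eq0 -?lt0n // scale1r => ->.
by rewrite -(piZ rels) scaler0.
Qed.

Lemma ad_nilpotentZ (a : K) x y : ad_nilpotent x y -> ad_nilpotent x (a *: y).
Proof.
case=> n hn; exists n.
suff -> : iter n (commr x) (a *: y) = a *: iter n (commr x) y by rewrite hn scaler0.
elim: n {hn} => [|n IH]; first exact: erefl.
rewrite iterS IH pr_commrZ -iterS; exact: erefl.
Qed.

Context (A : pzRingType) (phi : {rmorphism K -> A}) (g : P -> A).
Hypothesis gP : algebra_map phi g.

Lemma map_commr x y : g (commr x y) = commr (g x) (g y).
Proof.
rewrite /commr (map_zmod gP (x * y) (y * x)) (map_mul gP x y) (map_mul gP y x).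
exact: erefl.
Qed.

Lemma map0 : g 0 = 0.
Proof. by rewrite -(subrr 0) (map_zmod gP 0 0) subrr. Qed.

Lemma mapN x : g (- x) = - g x.
Proof. by rewrite -(sub0r x) (map_zmod gP 0 x) map0 sub0r. Qed.

Lemma mapD x y : g (x + y) = g x + g y.
Proof. by rewrite -[in LHS](opprK y) (map_zmod gP x (- y)) mapN opprK. Qed.

Lemma map_sum (I : Type) (r : seq I) (C : pred I) (F : I -> P) :
  g (\sum_(i <- r | C i) F i) = \sum_(i <- r | C i) g (F i).
Proof. exact: (big_morph g mapD map0). Qed.

Lemma map_iter_commr n x y : g (iter n (commr x) y) = iter n (commr (g x)) (g y).
Proof. by elim: n => //= n <-; exact: map_commr. Qed.

End PresentedAlgebra.

Lemma eqD_of_sub (V : zmodType) (a b r : V) : a - b = r -> a = b + r.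
Proof. by move=> <-; rewrite addrCA subrr addr0. Qed.

Lemma half_of_double (K : numFieldType) (V : lmodType K) (z w : V) :
  z + z = w -> z = 2%:R^-1 *: w.
Proof. by move=> <-; rewrite -mulr2n -scaler_nat scalerA mulVf ?pnatr_eq0 // scale1r. Qed.

Lemma commr_double (B : pzRingType) (x y q : B) :
  commr y x = commr x y + q -> commr y x + commr y x = q.
Proof. by move=> E; rewrite {1}E (commr_anti y x) addrAC addNr add0r. Qed.

Lemma ad_nilpotent_step (B : pzRingType) (x u : B) : ad_nilpotent x u -> ad_nilpotent x (commr x u).
Proof.
by case=> n hn; exists n; rewrite -iterSr; apply: iter_commr_le hn.
Qed.

Section YangianOperators.
Context (K : numFieldType) (N : nat) (N3 : (2 < N)%N) (eps1 eps2 : K).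
Local Notation Z := 'Z_N.
Local Notation Y := (Yangian N eps1 eps2).
Local Notation Yx := (Yx eps1 eps2).
Local Notation Yh := (Yh eps1 eps2).
Local Notation sg b := (if b then 1 else -1 : K).
Local Notation ca i j := ((cartan_a i j)%:~R : K).
Implicit Types (x y : Y) (i j : Z) (b : bool).

Lemma Y_xx i j r s : commr (Yx true i r) (Yx false j s) = if i == j then Yh i (r + s) else 0.
Proof.
rewrite pi_commr (pi_rel (yang_xx eps1 eps2 i j r s)); by case: eqP.
Qed.

Lemma Y_h0x b i j r : commr (Yh i 0) (Yx b j r) = (sg b * ca i j) *: Yx b j r.
Proof. by rewrite pi_commr (pi_rel (yang_h0x eps1 eps2 b i j r)) piZ. Qed.

(** For nilpotency only the shape of the right-hand side matters, hence the existential constants,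
    here and in [Y_xx1]. *)
Lemma Y_hx b i j : exists k1 k2 : K, commr (Yh i 1) (Yx b j 0) =
  commr (Yh i 0) (Yx b j 1) + (k1 *: acommr (Yh i 0) (Yx b j 0)
  - k2 *: commr (Yh i 0) (Yx b j 0)).
Proof.
have E := pi_rel_acommr (yang_hx eps1 eps2 b i j 0 0).
by exists (sg b * ca i j * ((eps1 + eps2) / 2)), ((cartan_m i j)%:~R * ((eps1 - eps2) / 2));
  apply: eqD_of_sub; exact: E.
Qed.

Lemma Y_xx1 b i : exists k1 k2 : K, commr (Yx b i 1) (Yx b i 0) =
  commr (Yx b i 0) (Yx b i 1) + (k1 *: acommr (Yx b i 0) (Yx b i 0)
  - k2 *: commr (Yx b i 0) (Yx b i 0)).
Proof.
have E := pi_rel_acommr (yang_xxb eps1 eps2 b i i 0 0).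
by exists (sg b * ca i i * ((eps1 + eps2) / 2)), ((cartan_m i i)%:~R * ((eps1 - eps2) / 2));
  apply: eqD_of_sub; exact: E.
Qed.

(** When all the indices r vanish, the Serre sum is n! copies of one iterated commutator, and n! is
    invertible. *)
Lemma Y_serre b i j s : i != j -> exists n, iter n (commr (Yx b i 0)) (Yx b j s) = 0.
Proof.
move=> ij; have [n hn] : exists n : nat, n%:Z = 1 - cartan_a i j.
  by rewrite /cartan_a (negPf ij); case: ifP => _; [exists 2|exists 1].
exists n; have := pi_rel (yang_serre eps1 eps2 b (fun _ : 'I_n => 0%N) s ij hn).
rewrite sumr_const => E; have := pi_natZ_eq0 _ E.
rewrite pi_foldr_commr size_enum_ord; apply.
by rewrite card_Sn fact_gt0.
Qed.

(* The exponentials of [ad x_i] are multiplicative only where [ad x_i] is nilpotent; it is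
   nilpotent on the subalgebra below, which contains everything that [T_w] meets. *)
Inductive good : Y -> Prop :=
| good_x b i r : (r <= 1)%N -> good (Yx b i r)
| good_h i r : (r <= 1)%N -> good (Yh i r)
| good_D x y : good x -> good y -> good (x + y)
| good_Z (a : K) x : good x -> good (a *: x)
| good_M x y : good x -> good y -> good (x * y).

Lemma good_N x : good x -> good (- x).
Proof. by move=> /(good_Z (-1)); rewrite scaleN1r. Qed.

Lemma good_commr x y : good x -> good y -> good (commr x y).
Proof. by move=> hx hy; apply: good_D; [|apply: good_N]; apply: good_M. Qed.

Lemma ad_nilpotent_self x : ad_nilpotent x x.
Proof. by exists 1%N; exact: subrr. Qed.

Lemma ad_nilpotent_opp x y : ad_nilpotent x y -> ad_nilpotent x (- y).
Proof. by move=> /(ad_nilpotentZ (-1)); rewrite scaleN1r. Qed.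

Lemma ad_nilpotent_h0 b i j : ad_nilpotent (Yx b i 0) (Yh j 0).
Proof.
apply: ad_nilpotent_commr; rewrite commr_anti; apply: ad_nilpotent_opp.
by rewrite Y_h0x; apply: ad_nilpotentZ; exact: ad_nilpotent_self.
Qed.

Lemma ad_nilpotent_acommr x y : ad_nilpotent x y -> ad_nilpotent x (acommr y x).
Proof.
by move=> h; apply: ad_nilpotentD; apply: ad_nilpotentM => //; exact: ad_nilpotent_self.
Qed.

Lemma ad_nilpotent_commr_sym x y : ad_nilpotent x (commr y x) -> ad_nilpotent x y.
Proof.
by move=> /ad_nilpotent_opp; rewrite -commr_anti; exact: ad_nilpotent_commr.
Qed.

(** The quadratic relation for i = j expresses 2 [x_{i,1}, x_{i,0}] through x_{i,0} alone, with
    which x_{i,0} commutes. *)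
Lemma ad_nilpotent_x1 b i : ad_nilpotent (Yx b i 0) (Yx b i 1).
Proof.
have [k1 [k2 E]] := Y_xx1 b i; set x0 := Yx b i 0 in E *; set x1 := Yx b i 1 in E *.
apply: ad_nilpotent_commr_sym; rewrite (half_of_double (commr_double E)).
apply: ad_nilpotentZ; apply: ad_nilpotentD.
  by apply: ad_nilpotentZ; apply: ad_nilpotent_acommr; exact: ad_nilpotent_self.
apply: ad_nilpotent_opp; apply: ad_nilpotentZ.
exact: ad_nilpotent_step (ad_nilpotent_self _).
Qed.

Lemma ad_nilpotent_h1 b i j : ad_nilpotent (Yx b i 0) (Yh j 1).
Proof.
apply: ad_nilpotent_commr_sym; have [k1 [k2 ->]] := Y_hx b j i.
have h0 := ad_nilpotent_h0 b i j.
have hc : ad_nilpotent (Yx b i 0) (commr (Yh j 0) (Yx b i 0)).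
  by rewrite commr_anti; apply: ad_nilpotent_opp; exact: ad_nilpotent_step.
apply: ad_nilpotentD.
  by rewrite Y_h0x; apply: ad_nilpotentZ; exact: ad_nilpotent_x1.
apply: ad_nilpotentD; first by apply: ad_nilpotentZ; exact: ad_nilpotent_acommr.
by apply: ad_nilpotent_opp; exact: ad_nilpotentZ.
Qed.

Lemma ad_nilpotent_h b i j r : (r <= 1)%N -> ad_nilpotent (Yx b i 0) (Yh j r).
Proof. by case: r => [|[|//]] _; [exact: ad_nilpotent_h0|exact: ad_nilpotent_h1]. Qed.

Lemma ad_nilpotent_0 (B : pzRingType) (x : B) : ad_nilpotent x 0.
Proof. by exists 0%N. Qed.

Lemma ad_nilpotent_x b i b' j r : (r <= 1)%N -> ad_nilpotent (Yx b i 0) (Yx b' j r).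
Proof.
move=> r1; have [->|bb] := eqVneq b' b.
  have [->|ij] := eqVneq i j; last by have [n hn] := Y_serre b r ij; exists n.
  by case: r r1 => [|[|//]] _; [exact: ad_nilpotent_self|exact: ad_nilpotent_x1].
apply: ad_nilpotent_commr.
case: b b' bb => -[] // _.
  by rewrite Y_xx; case: eqP => _; [exact: ad_nilpotent_h|exact: ad_nilpotent_0].
rewrite commr_anti Y_xx addn0; apply: ad_nilpotent_opp.
by case: eqP => _; [exact: ad_nilpotent_h|exact: ad_nilpotent_0].
Qed.

Lemma good_nilpotent b i y : good y -> ad_nilpotent (Yx b i 0) y.
Proof.
elim=> [b' j r r1|j r r1|u v _ hu _ hv|a u _ hu|u v _ hu _ hv].
- exact: ad_nilpotent_x.
- exact: ad_nilpotent_h.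
- exact: ad_nilpotentD.
- exact: ad_nilpotentZ.
exact: ad_nilpotentM.
Qed.

Lemma exp_adE n x y : iter n (commr x) y = 0 ->
  exp_ad x y = \sum_(0 <= k < n) (k`!%:R^-1 : K) *: iter k (commr x) y.
Proof.
move=> hn; rewrite /exp_ad (fsbigE (iota 0 n)) ?iota_uniq //.
  by rewrite /index_iota subn0; apply: eq_bigl => k; rewrite classical_sets.in_setT.
move=> k _; rewrite mem_iota add0n -leqNgt => nk.
by rewrite (iter_commr_le nk hn) scaler0.
Qed.

Lemma good_iter x n y : good x -> good y -> good (iter n (commr x) y).
Proof. by move=> hx hy; elim: n => [//|n IH]; rewrite iterS; exact: good_commr. Qed.

Lemma good_0 : good 0.
Proof. by rewrite -(scale0r (Yx true 0 0)); apply: good_Z; exact: good_x. Qed.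

Lemma good_exp_ad x y n : good x -> good y -> iter n (commr x) y = 0 -> good (exp_ad x y).
Proof.
move=> hx hy hn; rewrite (exp_adE hn); elim/big_rec: _ => [|k u _ hu]; first exact: good_0.
by apply: good_D => //; apply: good_Z; exact: good_iter.
Qed.

Context (A : pzRingType) (phi : {rmorphism K -> A}) (g : Y -> A).
Hypothesis gP : algebra_map phi g.

(** The nilpotency order in the Yangian is some unknown n, in the image it is at most 6; the sums
    are compared at the larger of the two. *)
Lemma map_exp_ad x y : ad_nilpotent x y -> iter 6 (commr (g x)) (g y) = 0 ->
  g (exp_ad x y) = expad phi (g x) (g y).
Proof.
case=> n hn h6; rewrite (exp_adE (iter_commr_le (leq_maxl n 6) hn)) (map_sum gP).
have E k : g ((k`!%:R^-1 : K) *: iter k (commr x) y) = phi k`!%:R^-1 * iter k (commr (g x)) (g y).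
  by rewrite (map_scale gP) (map_iter_commr gP).
rewrite (eq_bigr _ (fun k _ => E k)) (@big_cat_nat _ _ _ 6) ?leq_maxr //=.
have -> : \sum_(6 <= k < maxn n 6) phi k`!%:R^-1 * iter k (commr (g x)) (g y) = 0.
  rewrite big_nat big1 // => k /andP[k6 _].
  by rewrite (iter_commr_le k6 h6) mulr0.
exact: addr0.
Qed.

Context (e : int -> int -> A).
Hypothesis g_root_p : forall i, g (Yx true i 0) = root_p e (rep i).
Hypothesis g_root_m : forall i, g (Yx false i 0) = root_m e (rep i).

Lemma map_Tgen i y : good y -> Top_ok phi e i (g y) ->
  good (Tgen i y) /\ g (Tgen i y) = Top phi e i (g y).
Proof.
move=> hy [h1 h2 h3]; rewrite /Tgen.
have gx : good (Yx true i 0) by exact: good_x.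
have gy : good (- Yx false i 0) by apply: good_N; exact: good_x.
have n1 := good_nilpotent true i hy; have [k1 e1] := n1.
rewrite -(g_root_p i) in h1 h2 h3 *.
have E1 := map_exp_ad n1 h1; have good1 := good_exp_ad gx hy e1.
have n2 := ad_nilpotentN (good_nilpotent false i good1); have [k2 e2] := n2.
have gN : g (- Yx false i 0) = - root_m e (rep i) by rewrite (mapN gP) g_root_m.
rewrite -E1 -gN in h2.
have E2 := map_exp_ad n2 h2; have good2 := good_exp_ad gy good1 e2.
have n3 := good_nilpotent true i good2; have [k3 e3] := n3.
rewrite -E1 -gN -E2 in h3.
split; first exact: good_exp_ad gx good2 e3.
by rewrite (map_exp_ad n3 h3) E2 gN E1 g_root_p.
Qed.

Lemma map_Tword s y : good y -> Tops_ok phi e s (g y) ->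
  good (Tword s y) /\ g (Tword s y) = Tops phi e s (g y).
Proof.
move=> hy; elim: s => [|i s IH] /=; first by [].
by case=> /IH[IH1 IH2]; rewrite -IH2 => /(map_Tgen IH1).
Qed.

End YangianOperators.

(** * The completed enveloping algebra *)

Section CompletionTopology.
Context (K : numFieldType) (N : nat) (N3 : (2 < N)%N) (c : K).
Local Notation U := (Ugl N c).
Local Notation UC := (Ucomp N c).
Local Notation pi := (\pi_(UC))%qT.
Implicit Types (d : int) (n k s : nat) (u v : UC) (f g : nat -> UC).

Definition in_fil d n u : Prop := ufil d n (repr u d n).

Lemma in_fil_pi d n (x : precomp N c) : in_fil d n (pi x) <-> ufil d n (x d n).
Proof.
have h := uc_repr x d n; split => hx.
  by have := ufilB hx h; rewrite opprB addrCA subrr addr0.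
by have := ufilD h hx; rewrite subrK.
Qed.

Lemma in_filB d n u v : in_fil d n u -> in_fil d n v -> in_fil d n (u - v).
Proof.
move=> hu hv.
have -> : u - v = pi (pc_add (repr u) (pc_scale (-1) (repr v))).
  by rewrite uc_piD reprK uc_piZ reprK scaleN1r.
by apply/in_fil_pi; apply: ufilD hu _; apply: ufilZ.
Qed.

Lemma in_fil0 d n : in_fil d n 0.
Proof.
have -> : (0 : UC) = pi (pc_scale 0 (repr (0 : UC))) by rewrite uc_piZ scale0r.
by apply/in_fil_pi; rewrite /= scale0r; exact: ufil0.
Qed.

Lemma in_fil_eq0 u : (forall d n, in_fil d n u) -> u = 0.
Proof.
move=> h; have -> : (0 : UC) = pi (pc_scale 0 (repr u)) by rewrite uc_piZ scale0r.
rewrite -[LHS]reprK; apply/uc_eq => d n /=; rewrite scale0r subr0; exact: h.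
Qed.

Definition uc_null f := forall d n, exists k0, forall k, (k0 <= k)%N -> in_fil d n (f k).

(** A product in the completion is a finite sum over degrees, so convergence has to be uniform over
    the degrees in the support of the fixed factor. *)
Lemma uniform_bound (P : int -> nat -> Prop) :
  (forall e, exists k0, forall k, (k0 <= k)%N -> P e k) ->
  forall B, exists k0, forall k, (k0 <= k)%N -> forall e, (`|e| <= B)%N -> P e k.
Proof.
move=> h; elim=> [|B [k0 IH]].
  have [k0 hk] := h 0; exists k0 => k /hk + e; rewrite leqn0 absz_eq0 => + /eqP ->.
  exact.
have [k1 h1] := h B.+1%:Z; have [k2 h2] := h (- B.+1%:Z).
exists (maxn k0 (maxn k1 k2)) => k; rewrite !geq_max => /and3P[l0 l1 l2] e.
rewrite leq_eqVlt ltnS => /orP[/eqP he|]; last exact: IH.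
have [->|->] : e = B.+1%:Z \/ e = - B.+1%:Z by lia.
  exact: h1.
exact: h2.
Qed.

Lemma uc_null_Ml u f : uc_null f -> uc_null (fun n => u * f n).
Proof.
move=> hf d n; elim/ucW: u => x.
have [B xB] := pc_fin x.
have [k0 hk] := uniform_bound (fun e => hf (d - e) n) B.
exists k0 => k /hk h.
have -> : pi x * f k = pi (pc_mul x (repr (f k))) by rewrite uc_piM reprK.
apply/in_fil_pi; apply: ufil_sum => e; rewrite /mul_term.
have [eB|eB] := leqP `|e| B; last by rewrite xB // mul0r; exact: ufil0.
have de : e + (d - e) = d by lia.
rewrite -[X in ufil X]de; apply: ufilMl; [exact: pc_deg|exact: h].
Qed.

Lemma uc_null_Mr u f : uc_null f -> uc_null (fun n => f n * u).
Proof.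
move=> hf d n; elim/ucW: u => x.
have [B xB] := pc_fin x.
(* Right multiplication by an element of degree e can lower the filtration by |e|, so a smaller
   neighbourhood is taken at the start. *)
have [k0 hk] := uniform_bound (fun e => hf (d - e) (n + `|e|)%N) B.
exists k0 => k /hk h.
have -> : f k * pi x = pi (pc_mul (repr (f k)) x) by rewrite uc_piM reprK.
apply/in_fil_pi; apply: ufil_sum => e; rewrite /mul_term.
have [eB|eB] := leqP `|d - e| B; last by rewrite (xB n) // mulr0; exact: ufil0.
have de : e + (d - e) = d by lia.
rewrite -[X in ufil X]de; apply: (@ufilMr _ _ _ _ _ _ (n + `|d - e|)%N) => //.
  have := h _ eB; rewrite /in_fil (_ : d - (d - e) = e) //; lia.
exact: pc_deg.
Qed.

Lemma uc_nullP : null_sequences uc_null.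
Proof.
split.
- move=> f g hf hg d n; have [k1 h1] := hf d n; have [k2 h2] := hg d n.
  exists (maxn k1 k2) => k; rewrite geq_max => /andP[l1 l2].
  by apply: in_filB; [exact: h1|exact: h2].
- exact: uc_null_Ml.
- exact: uc_null_Mr.
- by move=> f n0 hf d n; exists n0 => k /hf ->; exact: in_fil0.
by move=> x hx; apply: in_fil_eq0 => d n; have [k0 h] := hx d n; exact: (h k0).
Qed.

Lemma canon_hom d (u : U) (hu : udeg d u) : canon u = uc_hom hu.
Proof.
have [cl [c1 cM]] := canon_morphism N c.
have cZ a (x : U) : canon (a *: x) = a *: canon x.
  have := cl a x 0; rewrite addr0 => ->.
  have := cl 1 0 0; rewrite !scale1r addr0 => c0.
  by rewrite -[canon 0](addrK (canon 0)) -c0 subrr addr0.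
have cD (x y : U) : canon (x + y) = canon x + canon y.
  by have := cl 1 x y; rewrite !scale1r.
have c0 : canon (0 : U) = 0 by have := cZ 0 (0 : U); rewrite !scale0r.
suff [h E] : exists h : udeg d u, canon u = uc_hom h by rewrite E; exact: uc_homE.
elim: {u d} hu => [d||X s|d u v _ [hu IHu] _ [hv IHv]|d a u _ [hu IHu]|d e u v _ [hu IHu] _ [hv IHv]].
- exists (udeg0 N c d); rewrite c0 -[LHS](scale0r (uc_hom (udeg0 N c d))) uc_homZ.
  by apply: uc_homE; rewrite // scale0r.
- by exists (udeg1 N c); rewrite c1.
- by exists (udegX c X s); exact: canonX.
- by exists (udegD hu hv); rewrite cD IHu IHv uc_homD.
- by exists (udegZ a hu); rewrite cZ IHu uc_homZ.
by exists (udegM hu hv); rewrite cM IHu IHv uc_homM.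
Qed.

Lemma in_fil_canon d e n (u : U) : udeg d u -> (e = d -> ufil d n u) -> in_fil e n (canon u).
Proof.
move=> hu h; rewrite (canon_hom hu) /uc_hom; apply/in_fil_pi => /=.
by case: eqP => [ed|_]; [rewrite ed; exact: (h ed)|exact: ufil0].
Qed.

Lemma glX_mul_fil (X Y : 'M[K]_((Zp_trunc N).+2)) p q n : n%:Z < - q ->
  ufil (p + q) n (glX c X p * glX c Y q).
Proof.
move=> h; apply: ufilM h _ _.
  by apply: udegE (udegX c X p) _; lia.
by apply: udegE (udegX c Y q) _; lia.
Qed.

Lemma ucX_mulE (X Y : 'M[K]_((Zp_trunc N).+2)) p q :
  ucX c X p * ucX c Y q = canon (glX c X p * glX c Y q).
Proof. by have [_ [_ cM]] := canon_morphism N c; rewrite cM. Qed.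

Lemma ucX_mul_null (X Y : 'M[K]_((Zp_trunc N).+2)) p q :
  uc_null (fun n => ucX c X (p + n%:Z) * ucX c Y (q - n%:Z)).
Proof.
move=> d n; exists (`|q| + n).+1 => k hk; rewrite ucX_mulE.
apply: in_fil_canon (udegM (udegX c X _) (udegX c Y _)) _ => _.
by apply: glX_mul_fil; lia.
Qed.

Lemma canon_sum (r : seq nat) (F : nat -> U) : canon (\sum_(s <- r) F s) = \sum_(s <- r) canon (F s).
Proof.
have [cl [c1 cM]] := canon_morphism N c.
have cD (x y : U) : canon (x + y) = canon x + canon y.
  by have := cl 1 x y; rewrite !scale1r.
have c0 : canon (0 : U) = 0.
  by apply: (addIr (canon (0 : U))); rewrite -cD addr0 add0r.
exact: (big_morph _ cD c0).
Qed.

Section Series.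
Variables (X Y : 'M[K]_((Zp_trunc N).+2)) (p q : int).
Let term (s : nat) : U := glX c X (p + s%:Z) * glX c Y (q - s%:Z).

Let term_deg (s : nat) : udeg (p + q) (term s).
Proof. by apply: udegE (udegM (udegX c X _) (udegX c Y _)) _; lia. Qed.

Let term_fil (s n : nat) : (n + `|q| < s)%N -> ufil (p + q) n (term s).
Proof.
move=> h; have -> : p + q = (p + s%:Z) + (q - s%:Z) by lia.
by apply: glX_mul_fil; lia.
Qed.

(** The sum of the series: a term with s > n + |q| has its right factor in degree below -n and
    vanishes in the n-th quotient. *)
Program Definition series_pc : precomp N c :=
  @PreComp _ _ _ (fun d n => if d == p + q then \sum_(0 <= s < (n + `|q|).+1) term s else 0) _ _ _.
Next Obligation.
by case: eqP => [->|_]; [apply: udeg_sum => s; exact: term_deg|exact: udeg0].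
Qed.
Next Obligation.
case: eqP => [->|_]; last by rewrite subrr; exact: ufil0.
rewrite addSn big_nat_recr // [X in ufil _ _ X]addrAC subrr add0r; apply: term_fil; lia.
Qed.
Next Obligation.
by exists (absz (p + q)) => n d hd; case: eqP => // h; rewrite h ltnn in hd.
Qed.

Lemma series_null : exists l, uc_null (fun n => \sum_(0 <= s < n) (ucX c X (p + s%:Z) * ucX c Y (q - s%:Z)) - l).
Proof.
exists (pi series_pc) => d n; exists (n + `|q|).+1 => k hk.
rewrite (eq_bigr (fun s => canon (term s))) => [|s _]; last exact: ucX_mulE.
have hs : udeg (p + q) (\sum_(0 <= s < k) term s) by apply: udeg_sum => s; exact: term_deg.
rewrite -canon_sum (canon_hom hs) /uc_hom.
have -> : pi (pc_hom hs) - pi series_pc =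
  pi (pc_add (pc_hom hs) (pc_scale (-1) series_pc)).
  by rewrite uc_piD uc_piZ scaleN1r.
apply/in_fil_pi => /=; rewrite scaleN1r.
case: eqP => [->|_]; last by rewrite subr0; exact: ufil0.
rewrite (@big_cat_nat _ _ _ (n + `|q|).+1) //= [X in ufil _ _ X]addrAC subrr add0r.
rewrite big_nat; elim/big_rec: _ => [|s u /andP[ns _] hu]; first exact: ufil0.
by apply: ufilD hu; apply: term_fil.
Qed.

End Series.

Definition summable f := exists l, uc_null (fun n => \sum_(0 <= s < n) f s - l).

(** Summability ensures that the value chosen by [xget] is a limit and not the default 0. *)
Lemma uc_seriesP f : summable f -> uc_null (fun n => \sum_(0 <= s < n) f s - uc_series f).
Proof.
have h (l : UC) : uc_cvg (fun n => \sum_(0 <= s < n) f s) l <->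
    uc_null (fun n => \sum_(0 <= s < n) f s - l).
  split=> H d n; have [k0 hk] := H d n; exists k0 => k /hk; move: (\sum_(_ <= _ < _) _) => u.
    have -> : u - l = pi (pc_add (repr u) (pc_scale (-1) (repr l))).
      by rewrite uc_piD reprK uc_piZ reprK scaleN1r.
    by move=> hh; apply/in_fil_pi; rewrite /= scaleN1r.
  have -> : u - l = pi (pc_add (repr u) (pc_scale (-1) (repr l))).
    by rewrite uc_piD reprK uc_piZ reprK scaleN1r.
  by move/in_fil_pi; rewrite /= scaleN1r.
move=> [l /h hl]; apply/h; rewrite /uc_series.
by apply: (@xgetPex _ 0 [set l | uc_cvg (fun k => \sum_(0 <= s < k) f s) l]%classic); exists l.
Qed.

Lemma summableD f g : summable f -> summable g -> summable (fun s => f s + g s).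
Proof.
move=> [l hl] [l' hl']; exists (l + l').
apply: (@nul_ext _ uc_null _ _ _ (nulD uc_nullP hl hl')) => n.
by rewrite big_split opprD addrACA.
Qed.

Lemma summable0 : summable (fun=> 0).
Proof.
exists 0; apply: (@nul_ext _ uc_null _ _ _ (nul0 uc_nullP)) => n.
by rewrite big1 // subr0.
Qed.

Lemma summable_sum (a b : nat) (F : nat -> nat -> UC) :
  (forall k, summable (F k)) -> summable (fun s => \sum_(a <= k < b) F k s).
Proof.
move=> hF; elim: (index_iota a b) => [|k r IH].
  have -> : (fun s => \sum_(k <- [::]) F k s) = (fun=> 0) by apply/funext => s; rewrite big_nil.
  exact: summable0.
have -> : (fun s => \sum_(k <- k :: r) F k s) = (fun s => F k s + \sum_(k <- r) F k s).
  by apply/funext => s; rewrite big_cons.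
exact: summableD.
Qed.

End CompletionTopology.

(** * The opposite ring and the transposed family *)

Section OppositeFamily.
Context (K : numFieldType) (A : pzRingType) (phi : {rmorphism K -> A}).
Hypothesis phiC : forall k x, phi k * x = x * phi k.

Lemma op_zmod : zmod_morphism (phi : K -> A^c). Proof. by move=> a b; exact: (rmorphB phi a b). Qed.

Lemma op_monoid : monoid_morphism (phi : K -> A^c).
Proof. by split=> [|a b]; [exact: (rmorph1 phi)|rewrite mulrC; exact: (rmorphM phi b a)]. Qed.

Definition op_scalar : {rmorphism K -> A^c} :=
  HB.pack (phi : K -> A^c) (GRing.isZmodMorphism.Build K A^c phi op_zmod)
    (GRing.isMonoidMorphism.Build K A^c phi op_monoid).

Lemma op_scalarC k (x : A^c) : op_scalar k * x = x * op_scalar k.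
Proof. exact: (esym (phiC k x)). Qed.

Lemma commr_op (x y : A) : commr (x : A^c) (y : A^c) = commr y x.
Proof. by []. Qed.

Context (nul : (nat -> A) -> Prop).

Lemma null_sequences_op : null_sequences nul -> @null_sequences A^c nul.
Proof.
by case=> h1 h2 h3 h4 h5; split.
Qed.

(** Reversing products and transposing indices together preserve the bracket, and the diagonal shift
    keeps its sign, so the level is still c. Modes change sign. *)
Lemma affine_family_op (N : nat) (c : K) (e : int -> int -> A) : (2 < N)%N ->
  null_sequences nul -> affine_family phi N c nul e -> @affine_family K A^c op_scalar N c nul (fun a b => e b a).
Proof.
move=> N3 nulP [h1 h2 h3]; split.
- by move=> a b k; rewrite h1 eq_sym; case: eqP => [->|].
- move=> a b p q; rewrite commr_op h2 [q%:~R == a%:~R]eq_sym [p%:~R == b%:~R]eq_sym.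
  case: (Zp_intP N3 a q) => [[k ->]|ha]; case: (Zp_intP N3 b p) => [[l ->]|hb].
  + have -> : q + N%:Z * k + p - (p + N%:Z * l) = q + N%:Z * (k - l) by lia.
    have -> : p + N%:Z * l + q - (q + N%:Z * k) = p + N%:Z * (l - k) by lia.
    have -> : e (q + (p + N%:Z * l) - p) (q + N%:Z * k) =
        e (q + N%:Z * l) (q + N%:Z * (k - l) + N%:Z * l) by congr e; lia.
    have -> : e (p + N%:Z * l) (p + (q + N%:Z * k) - q) =
        e (p + N%:Z * (l - k) + N%:Z * k) (p + N%:Z * k) by congr e; lia.
    rewrite !h1.
    have -> : (q == q + N%:Z * (k - l)) = (k == l) by apply/eqP/eqP => h; nia.
    have -> : (p + N%:Z * (l - k) == p) = (k == l) by apply/eqP/eqP => h; nia.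
    case: eqP => [->|_]; last by rewrite !subr0.
    by rewrite opprB addrA subrK.
  + rewrite sub0r sub0r; congr (- _).
    have -> : e b (p + (q + N%:Z * k) - q) = e (b - N%:Z * k + N%:Z * k) (p + N%:Z * k) by congr e; lia.
    rewrite h1 ifF ?subr0; first by congr e; lia.
    by apply/eqP => h; apply: hb; exists k; lia.
  + rewrite !subr0.
    have -> : e (q + (p + N%:Z * l) - p) a = e (q + N%:Z * l) (a - N%:Z * l + N%:Z * l) by congr e; lia.
    rewrite h1 ifF ?subr0; first by congr e; lia.
    by apply/eqP => h; apply: ha; exists l; lia.
  by [].
move=> a b p q; apply: (@nul_eq A nul nulP _ _ (`|q - p| + `|b - a|).+1 (h3 q p b a)) => n hn.
have -> : e b (a - N%:Z * n%:Z) = e (b + N%:Z * n%:Z) a.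
  rewrite -[in RHS](subrK (N%:Z * n%:Z) a) h1 ifF ?subr0 //.
  by apply/eqP => h; nia.
have -> : e q (p + N%:Z * n%:Z) = e (q - N%:Z * n%:Z) p.
  rewrite -{1}(subrK (N%:Z * n%:Z) q) h1 ifF ?subr0 //.
  by apply/eqP => h; nia.
by [].
Qed.

End OppositeFamily.

Lemma commr_central (B : pzRingType) (x y s t : B) :
  (forall z, s * z = z * s) -> (forall z, t * z = z * t) ->
  commr (x - s) (y - t) = commr x y.
Proof.
move=> hs ht; rewrite /commr !mulrBl !mulrBr (hs y) (hs t) (ht x).
Ncring_tac.non_commutative_ring.
Qed.

Lemma sub_cancel_if (V : zmodType) (u v x s t : V) (h : bool) :
  x = (if h then t - s else 0) ->
  u - v + x = u - (if h then s else 0) - (v - (if h then t else 0)).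
Proof.
move=> ->; case: h; last by rewrite addr0 !subr0.
by rewrite opprB addrACA [RHS]addrACA; congr (_ + _); rewrite addrC.
Qed.

(** * The affine family in the completed enveloping algebra *)

Section CompletedFamily.
Context (K : numFieldType) (N : nat) (N3 : (2 < N)%N) (c : K).
Local Notation U := (Ugl N c).
Local Notation UC := (Ucomp N c).
Local Notation Z := 'Z_N.
Local Notation mat := 'M[K]_((Zp_trunc N).+2).
Local Notation phi := (uc_scalar N c).
Local Notation ucX := (@ucX K N c).
Implicit Types (a b p q k : int) (X Y : mat).

(** The p in a = a0 + N p with a0 in [1, N], hence the subtraction of 1. *)
Definition level a : int := ((a - 1) %/ N%:Z)%Z.

Lemma levelDN a k : level (a + N%:Z * k) = level a + k.
Proof.
by rewrite /level -!/(fl N _ 1) -[X in fl N _ X]addr0 -(mulr0 N%:Z) (flDN N3) subr0.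
Qed.

Lemma level_near (n : nat) : (1 <= n < N.+1)%N -> level n%:Z = 0.
Proof. by move=> h; apply: (flE N3); lia. Qed.

Definition unit_mx a b : mat := delta_mx (a%:~R : Z) (b%:~R : Z).

Definition e_comp a b : UC :=
  ucX (unit_mx a b) (level b - level a) - (if a == b then phi (c * (level a)%:~R) else 0).

Lemma e_comp_neq a b : a != b -> e_comp a b = ucX (unit_mx a b) (level b - level a).
Proof. by move=> /negPf h; rewrite /e_comp h subr0. Qed.

Lemma unit_mxDN a b k l : unit_mx (a + N%:Z * k) (b + N%:Z * l) = unit_mx a b.
Proof. by rewrite /unit_mx !(Zp_intDN N3). Qed.

Lemma canonD (u v : U) : canon (u + v) = canon u + canon v.
Proof.
by have [cl _] := canon_morphism N c; have := cl 1 u v; rewrite (scale1r u) (scale1r (canon u)).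
Qed.

Lemma canon0 : canon (0 : U) = 0.
Proof. by apply: (addIr (canon (0 : U))); rewrite -canonD addr0 add0r. Qed.

Lemma canonZ (x : K) (u : U) : canon (x *: u) = x *: canon u.
Proof.
have [cl _] := canon_morphism N c; have := cl x u 0.
by rewrite (addr0 (x *: u)) canon0 addr0.
Qed.

Lemma canonB (u v : U) : canon (u - v) = canon u - canon v.
Proof. by rewrite -[- v]scaleN1r canonD canonZ scaleN1r. Qed.

Lemma canonM (u v : U) : canon (u * v) = canon u * canon v.
Proof. by have [_ [_ h]] := canon_morphism N c; exact: h. Qed.

Lemma canon1 : canon (1 : U) = 1.
Proof. by have [_ [h _]] := canon_morphism N c. Qed.

Lemma canon_commr (u v : U) : canon (commr u v) = commr (canon u) (canon v).
Proof.
exact: (etrans (canonB (u * v) (v * u)) (f_equal2 (fun x y => x - y) (canonM u v) (canonM v u))).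
Qed.

Lemma ucX_bracket X Y p q : commr (ucX X p) (ucX Y q) =
  ucX (X *m Y - Y *m X) (p + q) + phi ((p + q == 0)%:R * (p%:~R * \tr (X *m Y)) * c).
Proof.
apply: (etrans (esym (canon_commr (glX c X p) (glX c Y q)))).
apply: (etrans (congr1 (@canon K N c) (gl_bracket c X Y p q))).
apply: (etrans (canonD _ _)); congr (_ + _).
by apply: (etrans (canonZ _ _)); congr (_ *: _); exact: canon1.
Qed.

Lemma ucX_linear (x : K) X Y p : ucX (x *: X + Y) p = x *: ucX X p + ucX Y p.
Proof. by rewrite /Defs.ucX gl_linear canonD canonZ. Qed.

Lemma ucX0 p : ucX 0 p = 0.
Proof.
have := ucX_linear 1 0 0 p; rewrite !scale1r addr0 => h.
by apply: (addIr (ucX 0 p)); rewrite -h add0r.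
Qed.

Lemma ucXD X Y p : ucX (X + Y) p = ucX X p + ucX Y p.
Proof. by have := ucX_linear 1 X Y p; rewrite !scale1r. Qed.

Lemma ucXN X p : ucX (- X) p = - ucX X p.
Proof. by have := ucX_linear (-1) X 0 p; rewrite !scaleN1r addr0 ucX0 addr0. Qed.

Lemma ucXB X Y p : ucX (X - Y) p = ucX X p - ucX Y p.
Proof. by rewrite ucXD ucXN. Qed.

Lemma mxtrace_unit a b : \tr (unit_mx a b) = (a%:~R == b%:~R :> Z)%:R.
Proof.
rewrite /mxtrace /unit_mx (bigD1 (a%:~R : Z)) //= big1 => [|i /negPf hi]; rewrite !mxE.
  by rewrite eqxx addr0.
by rewrite hi.
Qed.

Lemma unit_mxM a b p q : unit_mx a b *m unit_mx p q =
  if b%:~R == p%:~R :> Z then unit_mx a q else 0.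
Proof. by rewrite /unit_mx mul_delta_mx_cond; case: eqP. Qed.

(** If both residues match, the cocycle of the affine algebra equals the difference of the two
    diagonal corrections. Otherwise the trace vanishes and no diagonal entry occurs. *)
Lemma e_comp_bracket a b p q : commr (e_comp a b) (e_comp p q) =
  (if b%:~R == p%:~R :> Z then e_comp a (q + b - p) else 0)
  - (if a%:~R == q%:~R :> Z then e_comp (p + a - q) b else 0).
Proof.
have cen (t : bool) x (z : UC) : (if t then phi x else 0) * z = z * (if t then phi x else 0).
  by case: t; [exact: uc_scalarC|rewrite mul0r mulr0].
have -> : commr (e_comp a b) (e_comp p q) =
    commr (ucX (unit_mx a b) (level b - level a)) (ucX (unit_mx p q) (level q - level p)).
  exact: (commr_central _ _ (cen _ _) (cen _ _)).
rewrite ucX_bracket !unit_mxM.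
have tr0 : \tr (0 : mat) = 0 by rewrite raddf0.
have phi0 : phi 0 = 0 by exact: raddf0.
rewrite [q%:~R == _]eq_sym.
case: (Zp_intP N3 b p) => [[k ->]|hb]; case: (Zp_intP N3 a q) => [[l ->]|ha].
- have -> : q + (p + N%:Z * k) - p = q + N%:Z * k by lia.
  have -> : p + (q + N%:Z * l) - q = p + N%:Z * l by lia.
  rewrite mxtrace_unit (Zp_intDN N3) eqxx mulr1 /e_comp /unit_mx !(Zp_intDN N3) !levelDN ucXB.
  have -> : (q + N%:Z * l == q + N%:Z * k) = (k == l) by apply/eqP/eqP => h; nia.
  have -> : (p + N%:Z * l == p + N%:Z * k) = (k == l) by apply/eqP/eqP => h; nia.
  have -> : level p + k - (level q + l) + (level q - level p) = k - l by lia.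
  have -> : level q + k - (level q + l) = k - l by lia.
  have -> : level p + k - (level p + l) = k - l by lia.
  rewrite subr_eq0.
  apply: sub_cancel_if; case: eqP => [->|_]; last first.
    by rewrite (_ : 0%:R * _ * c = 0) ?phi0 // mul0r mul0r.
  have -> : 1%:R * (level p + l - (level q + l))%:~R * c =
      c * (level p + l)%:~R - c * (level q + l)%:~R.
    by rewrite mul1r mulrC rmorphB mulrBr.
  exact: (rmorphB phi).
- have -> : q + (p + N%:Z * k) - p = q + N%:Z * k by lia.
  have haq : (a%:~R == q%:~R :> Z) = false by apply/negP => /(Zp_intP N3).
  rewrite mxtrace_unit haq.
  have -> : (level (p + N%:Z * k) - level a + (level q - level p) == 0)%:R *
    ((level (p + N%:Z * k) - level a)%:~R * false%:R) * c = 0 :> K by rewrite mulr0 mulr0 mul0r.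
  rewrite phi0 (subr0 (unit_mx a q)) (addr0 (ucX _ _)) (subr0 (e_comp _ _)).
  rewrite e_comp_neq; last by apply/eqP => h; apply: ha; exists k.
  by rewrite /unit_mx !(Zp_intDN N3) !levelDN; congr (ucX _ _); lia.
- have -> : p + (q + N%:Z * l) - q = p + N%:Z * l by lia.
  rewrite tr0.
  have -> : (level b - level (q + N%:Z * l) + (level q - level p) == 0)%:R *
    ((level b - level (q + N%:Z * l))%:~R * 0) * c = 0 :> K by rewrite mulr0 mulr0 mul0r.
  rewrite phi0 (sub0r (unit_mx p b)) (addr0 (ucX _ _)) (sub0r (e_comp _ _)) ucXN; congr (- _).
  rewrite e_comp_neq; last by apply/eqP => h; apply: hb; exists l.
  by rewrite /unit_mx !(Zp_intDN N3) !levelDN; congr (ucX _ _); lia.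
rewrite tr0.
have -> : (level b - level a + (level q - level p) == 0)%:R *
    ((level b - level a)%:~R * 0) * c = 0 :> K by rewrite mulr0 mulr0 mul0r.
by rewrite phi0 (subr0 (0 : mat)) ucX0 (addr0 (0 : UC)) (subr0 (0 : UC)).
Qed.

Lemma e_comp_family : affine_family phi N c (@uc_null K N c) e_comp.
Proof.
have phi0 : phi 0 = 0 by exact: raddf0.
split.
- move=> a b k; rewrite /e_comp (inj_eq (addIr _)) unit_mxDN !levelDN.
  have -> : level b + k - (level a + k) = level b - level a by lia.
  case: eqP => _; last by rewrite !subr0.
  by rewrite [(level a + k)%:~R]rmorphD mulrDr rmorphD opprD addrA.
- exact: e_comp_bracket.
move=> a b p q.
have h := ucX_mul_null N3 c (unit_mx a b) (unit_mx p q) (level b - level a) (level q - level p).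
have h' := @nul_eq _ _ (uc_nullP N3 c) _
  (fun n => e_comp a (b + N%:Z * n%:Z) * e_comp p (q - N%:Z * n%:Z)) (absz (a - b) + absz (p - q)).+1 h.
apply: h' => n hn.
rewrite !e_comp_neq; [|by apply/eqP => ?; nia|by apply/eqP => ?; nia].
rewrite -mulrN /unit_mx !(Zp_intDN N3) !levelDN.
have -> : level b + n%:Z - level a = level b - level a + n%:Z by lia.
have -> : level q + - n%:Z - level p = level q - level p - n%:Z by lia.
exact: erefl.
Qed.

End CompletedFamily.

(** The integers from j downwards form blocks of N; within a block the k <= j and the k > j differ
    by one level, which is the split of the inner sums in ev(x_{j,1}). *)
Lemma sum_cyclic (V : zmodType) (N : nat) (N3 : (2 < N)%N) (G : int -> V) (j n : nat) :
  (1 <= j < N.+1)%N ->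
  \sum_(0 <= l < N * n) G (j%:Z - l%:Z) =
  \sum_(0 <= s < n) (\sum_(1 <= k < j.+1) G (k%:Z - N%:Z * s%:Z)
    + \sum_(j.+1 <= k < N.+1) G (k%:Z - N%:Z * (s%:Z + 1))).
Proof.
move=> /andP[j1 jN]; rewrite (sum_residues N3) exchange_big_nat /=.
apply: eq_bigr => s _.
rewrite (@big_cat_nat _ _ _ (N - j)) //=; last lia.
rewrite addrC; congr (_ + _).
  rewrite [RHS]big_add1 /= -{1}(add0n (N - j)%N) big_addn (_ : (N - (N - j) = j)%N); last lia.
  by apply: eq_big_nat => k hk; congr G; lia.
rewrite -[X in index_iota X N.+1](add0n j.+1) [RHS]big_addn subSS.
by apply: eq_big_nat => k hk; congr G; lia.
Qed.

(** Representatives run over [1, N]: the node 0 becomes i = N, and the formulas for ev(x_{0,1})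
    become those for ev(x_{i,1}), including the weight 1 + i eps2. *)
Lemma Zp_ge1 (N : nat) (N3 : (2 < N)%N) (i : 'Z_N) : exists2 n : nat, (1 <= n < N.+1)%N & i = n%:R.
Proof.
have iN : (i < N)%N by case: i => i /= hi; rewrite Zp_cast in hi; lia.
have [i0|i0] := eqVneq i 0.
  by exists N; [lia|rewrite i0 pchar_Zp //; lia].
exists i; last by rewrite natr_Zp.
by rewrite lt0n ltnS (ltnW iN) andbT; apply: contra i0 => /eqP h; apply/eqP; apply: val_inj.
Qed.

Lemma Zp_nat_val (N : nat) (N3 : (2 < N)%N) (i : nat) : (i < N)%N -> (i%:R : 'Z_N) = i :> nat.
Proof. by move=> iN; rewrite val_Zp_nat ?modn_small //; lia. Qed.

(** * The evaluation map in terms of the affine family *)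

Section EvaluationData.
Context (K : numFieldType) (N : nat) (N3 : (2 < N)%N) (eps1 eps2 c : K).
Local Notation Y := (Yangian N eps1 eps2).
Local Notation Yx := (Yx eps1 eps2).
Local Notation Yh := (Yh eps1 eps2).
Local Notation hbar := (eps1 + eps2).
Local Notation UC := (Ucomp N c).
Local Notation Z := 'Z_N.
Local Notation phi := (uc_scalar N c).
Local Notation ucX := (@ucX K N c).
Local Notation Emx := (@Emx K N).
Local Notation e := (@e_comp K N c).
Implicit Types (i j s n k : nat) (l : int).

Lemma e_compE i j (k l : int) : (1 <= i < N.+1)%N -> (1 <= j < N.+1)%N ->
  (i%:Z + N%:Z * k != j%:Z + N%:Z * l) || (k == 0) ->
  e (i%:Z + N%:Z * k) (j%:Z + N%:Z * l) = ucX (Emx i j) (l - k).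
Proof.
move=> hi hj h; rewrite /e_comp (unit_mxDN K N3) !(levelDN N3) (level_near N3 hi) (level_near N3 hj) !add0r.
have -> : unit_mx K N i%:Z j%:Z = Emx i j by [].
case: eqP h => [E|_ _]; last by rewrite subr0.
move=> /= /eqP ->; rewrite mulr0.
have -> : phi 0 = 0 by exact: raddf0.
by rewrite subr0.
Qed.

(* The side condition excludes the diagonal entries carrying a central shift. *)
Lemma e_comp_mul i j i' j' (k l k' l' : int) (x y x' y' p p' : int) :
  [&& 1 <= i < N.+1, 1 <= j < N.+1, 1 <= i' < N.+1 & 1 <= j' < N.+1]%N ->
  x = i%:Z + N%:Z * k -> y = j%:Z + N%:Z * l -> x' = i'%:Z + N%:Z * k' -> y' = j'%:Z + N%:Z * l' ->
  (x != y) || (k == 0) -> (x' != y') || (k' == 0) -> p = l - k -> p' = l' - k' ->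
  e x y * e x' y' = ucX (Emx i j) p * ucX (Emx i' j') p'.
Proof.
case/and4P=> hi hj hi' hj' -> -> -> -> h h' -> ->.
by rewrite (e_compE hi hj h) (e_compE hi' hj' h').
Qed.

Lemma e_compE0 i j l : (1 <= i < N.+1)%N -> (1 <= j < N.+1)%N ->
  e i%:Z (j%:Z + N%:Z * l) = ucX (Emx i j) l.
Proof.
move=> hi hj; have := @e_compE i j 0 l hi hj; rewrite mulr0 addr0 subr0 eqxx orbT.
by apply.
Qed.

Lemma Zp_nat_neq0 i : (1 <= i < N)%N -> (i%:R == 0 :> Z) = false.
Proof.
move=> hi; apply/negP => /eqP /(congr1 (@nat_of_ord _)).
by rewrite Zp_nat_val //= ; lia.
Qed.

Lemma Zp_nat_eq0 : N%:R = 0 :> Z. Proof. by rewrite pchar_Zp //; lia. Qed.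

Lemma chev_xp i : (1 <= i < N.+1)%N -> chev_x ucX true i%:R = root_p e i%:Z.
Proof.
rewrite /chev_x /root_p; move=> hi; have [iN|iN] := eqVneq i N.
  rewrite iN Zp_nat_eq0 eqxx.
  have := @e_compE0 N 1 1; rewrite mulr1 addrC => -> //; lia.
rewrite Zp_nat_neq0; last lia.
rewrite Zp_nat_val //; last lia.
have -> : i%:Z + 1 = i.+1%:Z + N%:Z * 0 by lia.
by rewrite e_compE0 //; lia.
Qed.

Lemma chev_xm i : (1 <= i < N.+1)%N -> chev_x ucX false i%:R = root_m e i%:Z.
Proof.
rewrite /chev_x /root_m; move=> hi; have [iN|iN] := eqVneq i N.
  rewrite iN Zp_nat_eq0 eqxx.
  have -> : N%:Z + 1 = 1%:Z + N%:Z * 1 by lia.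
  have E : e (1%:Z + N%:Z * 1) (N%:Z + N%:Z * 0) = ucX (Emx 1 N) (0 - 1) by apply: e_compE; lia.
  by rewrite mulr0 addr0 sub0r in E; rewrite E.
rewrite Zp_nat_neq0; last lia.
rewrite Zp_nat_val //; last lia.
have -> : i%:Z + 1 = i.+1%:Z + N%:Z * 0 by lia.
have E : e (i.+1%:Z + N%:Z * 0) (i%:Z + N%:Z * 0) = ucX (Emx i.+1 i) (0 - 0) by apply: e_compE; lia.
by rewrite subr0 mulr0 (addr0 i%:Z) in E; rewrite mulr0 E.
Qed.

Lemma series_quad j (a b : int) (f : nat -> UC) : (1 <= j < N.+1)%N ->
  (forall s, f s =
     \sum_(1 <= k < j.+1) e (k%:Z - N%:Z * s%:Z) b * e a (k%:Z - N%:Z * s%:Z)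
     + \sum_(j.+1 <= k < N.+1) e (k%:Z - N%:Z * (s%:Z + 1)) b * e a (k%:Z - N%:Z * (s%:Z + 1))) ->
  summable f ->
  uc_null (fun n => quad N e (fun l : nat => j%:Z - l%:Z) a b n - uc_series f).
Proof.
move=> hj hf /uc_seriesP; apply: nul_ext => n; congr (_ - _).
by rewrite /quad (sum_cyclic N3 (fun x => e x b * e a x) n hj); apply: eq_bigr => s _.
Qed.

Lemma eq_summable (f g : nat -> UC) : f =1 g -> summable f -> summable g.
Proof. by move=> /funext ->. Qed.

Lemma summable_ucX (X X' : nat -> 'M[K]_((Zp_trunc N).+2)) (p q : int) (a b : nat) :
  summable (fun s => \sum_(a <= k < b) ucX (X k) (p + s%:Z) * ucX (X' k) (q - s%:Z)).
Proof. by apply: (summable_sum N3) => k; exact: (series_null N3). Qed.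

Lemma series_witness (a b : K) (x y : UC) (f T : nat -> UC) :
  y = a *: x + b *: uc_series f -> uc_null (fun n => T n - uc_series f) ->
  exists S, uc_null (fun n => T n - S) /\ y = phi a * x + phi b * S.
Proof. by move=> -> h; exists (uc_series f); split=> //; rewrite !uc_scalarE. Qed.

Context (ev : Y -> UC) (evP : is_evaluation ev).

Lemma ev_map : algebra_map phi ev.
Proof.
have [lin [e1 eM]] := ev_morphism evP.
have eD x y : ev (x + y) = ev x + ev y.
  by have := lin 1 x y; rewrite (scale1r x) (scale1r (ev x)).
have e0 : ev 0 = 0 by apply: (addIr (ev 0)); rewrite -eD (addr0 (0 : Y)) add0r.
have eZ (a : K) x : ev (a *: x) = a *: ev x.
  by have := lin a x 0; rewrite (addr0 (a *: x)) e0 addr0.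
split=> // [x y|a x]; first by rewrite eD -(scaleN1r y) eZ scaleN1r.
by rewrite eZ uc_scalarE.
Qed.

Lemma ev_root_p (i : Z) : ev (Yx true i 0) = root_p e (rep i).
Proof.
have [n hn ->] := Zp_ge1 N3 i; rewrite (ev_x evP) (chev_xp hn); apply: esym.
exact: (root_p_rep N3 (e_comp_family N3 c) n%:Z).
Qed.

Lemma ev_root_m (i : Z) : ev (Yx false i 0) = root_m e (rep i).
Proof.
have [n hn ->] := Zp_ge1 N3 i; rewrite (ev_x evP) (chev_xm hn); apply: esym.
exact: (root_m_rep N3 (e_comp_family N3 c) n%:Z).
Qed.

Lemma ev_xp i : (1 <= i < N.+1)%N -> exists S,
  uc_null (fun n => quad N e (fun l : nat => i%:Z - l%:Z) i%:Z (i%:Z + 1) n - S) /\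
  ev (Yx true i%:R 1) = phi (1 + i%:R * eps2) * e i%:Z (i%:Z + 1) + phi hbar * S.
Proof.
move=> hi; rewrite -/(root_p e i%:Z) -(chev_xp hi); have [iN|iN] := eqVneq i N.
  rewrite iN Zp_nat_eq0; apply: (series_witness (ev_xp01 evP)).
  apply: series_quad => [|s|]; [lia| |].
    rewrite [X in _ = _ + X]big_geq // [RHS]addr0; apply: eq_big_nat => k hk.
    by apply: esym; apply: (@e_comp_mul k 1 N k (- s%:Z) 1 0 (- s%:Z)); lia.
  have h := summable_ucX (fun k => Emx k 1) (fun k => Emx N k) 1 0 1 N.+1.
  apply: (eq_summable _ h) => s; apply: eq_bigr => k _.
  by rewrite sub0r addrC.
have iN' : (1 <= i < N)%N by lia.
apply: (series_witness (ev_xp1 evP iN')).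
apply: series_quad => [|s|]; [lia| |].
  congr (_ + _); apply: eq_big_nat => k hk.
    by apply: esym; apply: (@e_comp_mul k i.+1 i k (- s%:Z) 0 0 (- s%:Z)); lia.
  by apply: esym; apply: (@e_comp_mul k i.+1 i k (- s%:Z - 1) 0 0 (- s%:Z - 1)); lia.
apply: (summableD N3).
  have h := summable_ucX (fun k => Emx k i.+1) (fun k => Emx i k) 0 0 1 i.+1.
  apply: (eq_summable _ h) => s; apply: eq_bigr => k _.
  by rewrite sub0r add0r.
have h := summable_ucX (fun k => Emx k i.+1) (fun k => Emx i k) 1 (-1) i.+1 N.+1.
apply: (eq_summable _ h) => s; apply: eq_bigr => k _.
by rewrite [1 + _]addrC [-1 - _]addrC.
Qed.

Lemma ev_xm i : (1 <= i < N.+1)%N -> exists S,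
  uc_null (fun n => quad N e (fun l : nat => i%:Z - l%:Z) (i%:Z + 1) i%:Z n - S) /\
  ev (Yx false i%:R 1) = phi (1 + i%:R * eps2) * e (i%:Z + 1) i%:Z + phi hbar * S.
Proof.
move=> hi; rewrite -/(root_m e i%:Z) -(chev_xm hi); have [iN|iN] := eqVneq i N.
  rewrite iN Zp_nat_eq0; apply: (series_witness (ev_xm01 evP)).
  apply: series_quad => [|s|]; [lia| |].
    rewrite [X in _ = _ + X]big_geq // [RHS]addr0; apply: eq_big_nat => k hk.
    by apply: esym; apply: (@e_comp_mul k N 1 k (- s%:Z) 0 1 (- s%:Z)); lia.
  have h := summable_ucX (fun k => Emx k N) (fun k => Emx 1 k) 0 (-1) 1 N.+1.
  apply: (eq_summable _ h) => s; apply: eq_bigr => k _.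
  by rewrite add0r [-1 - _]addrC.
have iN' : (1 <= i < N)%N by lia.
apply: (series_witness (ev_xm1 evP iN')).
apply: series_quad => [|s|]; [lia| |].
  congr (_ + _); apply: eq_big_nat => k hk.
    by apply: esym; apply: (@e_comp_mul k i i.+1 k (- s%:Z) 0 0 (- s%:Z)); lia.
  by apply: esym; apply: (@e_comp_mul k i i.+1 k (- s%:Z - 1) 0 0 (- s%:Z - 1)); lia.
apply: (summableD N3).
  have h := summable_ucX (fun k => Emx k i) (fun k => Emx i.+1 k) 0 0 1 i.+1.
  apply: (eq_summable _ h) => s; apply: eq_bigr => k _.
  by rewrite sub0r add0r.
have h := summable_ucX (fun k => Emx k i) (fun k => Emx i.+1 k) 1 (-1) i.+1 N.+1.
apply: (eq_summable _ h) => s; apply: eq_bigr => k _.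
by rewrite [1 + _]addrC [-1 - _]addrC.
Qed.

End EvaluationData.

(** * Root vectors of affine sl_N from the Chevalley generators *)

Section LoopAlgebra.
Context (K : numFieldType) (N : nat) (N3 : (2 < N)%N).
Local Notation Z := 'Z_N.
Local Notation mat := 'M[K]_((Zp_trunc N).+2).
Local Notation U := (Usl K N).
Local Notation slX := (@slX K N).
Local Notation Emx := (@Emx K N).
Local Notation unit_mx := (@unit_mx K N).
Local Notation level := (@level N).
Implicit Types (a b d k l : int) (i j : nat).

Lemma sl_bracket (X Y : mat) r s : \tr X = 0 -> \tr Y = 0 ->
  commr (slX X r) (slX Y s) =
  slX (X *m Y - Y *m X) (r + s) + ((r + s == 0)%:R * (r%:~R * \tr (X *m Y))) *: slC K N.
Proof.
move=> /eqP hX /eqP hY.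
have hZ : traceless (X *m Y - Y *m X) by rewrite /traceless raddfB /= mxtrace_mulC subrr.
rewrite /Defs.slX (insubT (@traceless K N) hX) (insubT (@traceless K N) hY) (insubT (@traceless K N) hZ).
rewrite /slC /gen /commr -!piM -piN -piD -piZ -piD.
by apply: pi_rel; exact: aff_bracket.
Qed.

Definition sl_unit a b : U := slX (unit_mx a b) (level b - level a).

Lemma mxtrace_unit_neq a b : a%:~R != b%:~R :> Z -> \tr (unit_mx a b) = 0.
Proof. by move=> /negPf h; rewrite mxtrace_unit h. Qed.

Lemma sl_unit_bracket a b d : a%:~R != b%:~R :> Z -> b%:~R != d%:~R :> Z -> a%:~R != d%:~R :> Z ->
  sl_unit a d = commr (sl_unit a b) (sl_unit b d).
Proof.
move=> hab hbd had; apply: esym; rewrite /sl_unit.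
apply: (etrans (sl_bracket _ _ (mxtrace_unit_neq hab) (mxtrace_unit_neq hbd))).
rewrite !unit_mxM eqxx [d%:~R == _]eq_sym (negPf had) (subr0 (unit_mx a d)).
rewrite (mxtrace_unit_neq had) (mulr0 (level b - level a)%:~R) mulr0 scale0r addr0.
by congr (slX _ _); rewrite addrC addrA subrK.
Qed.

Lemma sl_unitDN a b k : sl_unit (a + N%:Z * k) (b + N%:Z * k) = sl_unit a b.
Proof. by rewrite /sl_unit (unit_mxDN K N3) !(levelDN N3) [X in slX _ X](_ : _ = level b - level a) //; lia. Qed.

Lemma sl_unitE i j k : (1 <= i < N.+1)%N -> (1 <= j < N.+1)%N ->
  sl_unit i%:Z (j%:Z + N%:Z * k) = slX (Emx i j) k.
Proof.
move=> hi hj; rewrite /sl_unit -[X in unit_mx X](addr0 i%:Z) -{1}(mulr0 N%:Z) (unit_mxDN K N3).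
by rewrite (levelDN N3) (level_near N3 hi) (level_near N3 hj) add0r subr0.
Qed.

Lemma sl_chev_p i : (1 <= i < N.+1)%N -> chev_x slX true i%:R = sl_unit i%:Z (i%:Z + 1).
Proof.
rewrite /chev_x; move=> hi; have [iN|iN] := eqVneq i N.
  rewrite iN (Zp_nat_eq0 N3) eqxx.
  have -> : N%:Z + 1 = 1%:Z + N%:Z * 1 by lia.
  by rewrite sl_unitE //; lia.
rewrite (Zp_nat_neq0 N3); last lia.
rewrite (Zp_nat_val N3); last lia.
have -> : i%:Z + 1 = i.+1%:Z + N%:Z * 0 by lia.
by rewrite sl_unitE //; lia.
Qed.

Lemma sl_chev_m i : (1 <= i < N.+1)%N -> chev_x slX false i%:R = sl_unit (i%:Z + 1) i%:Z.
Proof.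
rewrite /chev_x; move=> hi; have [iN|iN] := eqVneq i N.
  rewrite iN (Zp_nat_eq0 N3) eqxx.
  have -> : sl_unit (N%:Z + 1) N%:Z = sl_unit (1%:Z + N%:Z * 1) ((N%:Z + N%:Z * (-1)) + N%:Z * 1).
    by congr sl_unit; lia.
  by rewrite sl_unitDN sl_unitE //; lia.
rewrite (Zp_nat_neq0 N3); last lia.
rewrite (Zp_nat_val N3); last lia.
have -> : sl_unit (i%:Z + 1) i%:Z = sl_unit i.+1%:Z (i%:Z + N%:Z * 0) by congr sl_unit; lia.
by rewrite sl_unitE //; lia.
Qed.

Context (A : pzRingType) (phi : {rmorphism K -> A}) (c : K).
Context (nul : (nat -> A) -> Prop) (e : int -> int -> A).
Hypothesis eP : affine_family phi N c nul e.
Context (f : U -> A).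
Hypothesis fP : algebra_map phi f.
Hypothesis f_root_p : forall i : Z, f (chev_x slX true i) = root_p e (rep i).
Hypothesis f_root_m : forall i : Z, f (chev_x slX false i) = root_m e (rep i).

Lemma int_residue a : exists2 i, (1 <= i < N.+1)%N & exists k, a = i%:Z + N%:Z * k.
Proof.
have [i hi E] := Zp_ge1 N3 (a%:~R : Z); exists i => //.
by have /(Zp_intP N3) : a%:~R == i%:Z%:~R :> Z by rewrite E.
Qed.

Lemma f_unit_p a : f (sl_unit a (a + 1)) = e a (a + 1).
Proof.
have [i hi [k ->]] := int_residue a.
rewrite addrAC sl_unitDN -sl_chev_p // f_root_p (root_p_rep N3 eP i%:Z) /root_p.
by rewrite (af_shift_neq eP) //; apply/eqP; lia.
Qed.

Lemma f_unit_m a : f (sl_unit (a + 1) a) = e (a + 1) a.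
Proof.
have [i hi [k ->]] := int_residue a.
rewrite addrAC sl_unitDN -sl_chev_m // f_root_m (root_m_rep N3 eP i%:Z) /root_m.
by rewrite (af_shift_neq eP) //; apply/eqP; lia.
Qed.

Lemma f_unit_step a b d : a%:~R != b%:~R :> Z -> b%:~R != d%:~R :> Z -> a%:~R != d%:~R :> Z ->
  f (sl_unit a b) = e a b -> f (sl_unit b d) = e b d -> f (sl_unit a d) = e a d.
Proof.
move=> hab hbd had fab fbd; rewrite (sl_unit_bracket hab hbd had) (map_commr fP) fab fbd.
by rewrite (af_bracket eP) eqxx (negPf had) subr0 addrK.
Qed.

Lemma Zp_neqP a b : reflect (forall k, a <> b + N%:Z * k) (a%:~R != b%:~R :> Z).
Proof.
apply: (iffP idP) => [/negP h k E|h]; first by apply: h; apply/(Zp_intP N3); exists k.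
by apply/negP => /(Zp_intP N3) [k]; exact: h.
Qed.

Lemma mulN_small (t k : int) : (`|t| < N)%N -> t + N%:Z * k = 0 -> t = 0.
Proof.
move=> ht E; have [k0|k0] := eqVneq k 0; first by rewrite k0 mulr0 addr0 in E.
have : (N <= `|(N%:Z * k)%R|)%N by rewrite abszM /= leq_pmulr // lt0n absz_eq0.
by lia.
Qed.

(** Induction on |b - a|, splitting off one simple root. If a + s and b lie in one class, the
    remaining factor would not be traceless; the path then goes through a + 2 s, whose class differs
    from those of a and b as N >= 3. *)
Lemma f_unit a b : a%:~R != b%:~R :> Z -> f (sl_unit a b) = e a b.
Proof.
have [d] := ubnP `|b - a|; elim: d a b => // d IH a b dab hab.
have ab : a != b by apply: contra hab => /eqP ->.
wlog [s [hs hb]] : / exists s : int, (s == 1) || (s == -1) /\ b = a + s * `|b - a|%:Z.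
  by apply; case: (ltgtP a b) ab => // h _; [exists 1|exists (-1)]; lia.
have base t : (t == 1) || (t == -1) -> f (sl_unit a (a + t)) = e a (a + t).
  case/orP=> /eqP ->; first exact: f_unit_p.
  by rewrite -{1 3}(subrK 1 a); exact: f_unit_m.
have near t : (0 < `|t| < 3)%N -> a%:~R != (a + t)%:~R :> Z.
  move=> ht; apply/Zp_neqP => k E; have := @mulN_small t k; lia.
have [h1|h1] := eqVneq `|b - a|%N 1%N; first by rewrite hb h1 mulr1; exact: base.
have [/(Zp_intP N3) [k hk]|hm] := boolP ((a + s)%:~R == b%:~R :> Z).
  apply: (@f_unit_step a (a + s + s) b) => //.
  - by rewrite -addrA; apply: near; lia.
  - by apply/Zp_neqP => l hl; have := @mulN_small s (k - l); lia.
  - apply: (@f_unit_step a (a + s)).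
    + by apply: near; lia.
    + by apply/Zp_neqP => l hl; have := @mulN_small s l; lia.
    + by rewrite -addrA; apply: near; lia.
    + exact: base.
    by apply: IH; [lia|apply/Zp_neqP => l hl; have := @mulN_small s l; lia].
  apply: IH; first by lia.
  by apply/Zp_neqP => l hl; have := @mulN_small s (k - l); lia.
apply: (@f_unit_step a (a + s)) => //; [by apply: near; lia|exact: base|].
by apply: IH => //; lia.
Qed.

Lemma f_Emx i j k : (1 <= i < N.+1)%N -> (1 <= j < N.+1)%N -> i != j ->
  f (slX (Emx i j) k) = e i%:Z (j%:Z + N%:Z * k).
Proof.
move=> hi hj ij; rewrite -sl_unitE // f_unit // (Zp_intDN N3).
by apply/Zp_neqP => l hl; have := @mulN_small (j%:Z - i%:Z) l; lia.
Qed.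

(** The bracket of E_{i,i+1}(0) with E_{i+1,i}(k); the first mode is 0, so no central term
    arises. *)
Lemma f_cartan i k : (1 <= i < N)%N -> f (slX (Emx i i - Emx i.+1 i.+1) k) =
  e i%:Z (i%:Z + N%:Z * k) - e i.+1%:Z (i.+1%:Z + N%:Z * k).
Proof.
move=> hi.
have h1 : i%:Z%:~R != (i.+1)%:Z%:~R :> Z.
  by apply/Zp_neqP => l hl; have := @mulN_small 1 l; lia.
have h2 : (i.+1)%:Z%:~R != i%:Z%:~R :> Z by rewrite eq_sym.
have E := sl_bracket 0 k (mxtrace_unit_neq h1) (mxtrace_unit_neq h2).
rewrite !unit_mxM !eqxx add0r mul0r mulr0 scale0r addr0 in E.
have -> : slX (Emx i i - Emx i.+1 i.+1) k = slX (unit_mx i%:Z i%:Z - unit_mx i.+1%:Z i.+1%:Z) k by [].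
rewrite -E (map_commr fP).
have -> : slX (unit_mx i%:Z i.+1%:Z) 0 = slX (Emx i i.+1) 0 by [].
have -> : slX (unit_mx i.+1%:Z i%:Z) k = slX (Emx i.+1 i) k by [].
rewrite !f_Emx; try lia.
rewrite mulr0 addr0 (af_bracket eP) (Zp_intDN N3) !eqxx addrK; congr (_ - _).
have [->|k0] := eqVneq k 0; first by rewrite mulr0 !addr0 addrK.
have -> : i.+1%:Z + i%:Z - (i%:Z + N%:Z * k) = i.+1%:Z - N%:Z * k by lia.
have ne : i.+1%:Z - N%:Z * k != i.+1%:Z by apply/eqP; nia.
by rewrite -(af_shift_neq eP k ne) subrK.
Qed.

End LoopAlgebra.

(** * Evaluation of [a_m] *)

(** The sum over j >= i telescopes, leaving neighbours and a term at N that closes the cycle.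
    Exchanging p with m - p and commuting neighbours then puts the factors in the stated order. *)
Lemma cartan_sum (A : pzRingType) (N m : nat) (d : nat -> nat -> A) : (1 < N)%N ->
  (forall i j p q, i != j -> (1 <= i < N.+1)%N -> (1 <= j < N.+1)%N -> d i p * d j q = d j q * d i p) ->
  (forall p, (0 < p)%N -> d N.+1 p = d 1%N p) ->
  \sum_(1 <= p < m) \sum_(1 <= i < N) \sum_(i <= j < N)
    (d i p - d i.+1 p) * (d j (m - p)%N - d j.+1 (m - p)%N) =
  \sum_(1 <= p < m) \sum_(1 <= i < N.+1) (d i p * d i (m - p)%N - d i p * d i.+1 (m - p)%N).
Proof.
move=> N1 dC dN.
have telesc (i : nat) (D : nat -> A) : (i <= N)%N -> \sum_(i <= j < N) (D j - D j.+1) = D i - D N.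
  move=> iN; rewrite -opprB -telescope_sumr // -sumrN.
  by apply: eq_bigr => j _; rewrite opprB.
under eq_bigr => p _.
  rewrite (eq_big_nat _ _ (F2 := fun i => (d i p * d i (m - p)%N - d i.+1 p * d i (m - p)%N)
     - (d i p - d i.+1 p) * d N (m - p)%N)); last first.
    move=> i /andP[_ iN]; rewrite -mulr_sumr telesc ?(ltnW iN) //.
    by rewrite mulrBr mulrBl.
  rewrite sumrB -mulr_suml telesc ?(ltnW N1) // sumrB.
  over.
under [RHS]eq_bigr do rewrite sumrB.
rewrite !sumrB /=.
pose C p := \sum_(1 <= i < N.+1) d i.+1 p * d i (m - p)%N.
have E : \sum_(1 <= p < m) \sum_(1 <= i < N.+1) d i p * d i.+1 (m - p)%N = \sum_(1 <= p < m) C p.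
  rewrite big_nat_rev; apply: eq_big_nat => p /andP[p0 pm]; apply: eq_big_nat => i hi.
  rewrite add1n subSS (_ : (m - (m - p) = p)%N); last lia.
  have [iN|iN] := eqVneq i N; last by apply: dC; lia.
  by rewrite iN dN //; apply: dC; lia.
rewrite E -!sumrB; apply: eq_big_nat => p /andP[p0 pm].
rewrite /C ![\sum_(1 <= i < N.+1) _]big_nat_recr /=; [|lia|lia].
by rewrite dN // mulrBl opprB addrACA -opprD.
Qed.

Lemma fsbig_int_interval (V : zmodType) (F : int -> V) (P : int -> bool) (b : int) (n : nat) :
  (forall p, P p = (b - n%:Z < p <= b)) ->
  \sum_(p \in [set p : int | P p]%classic) F p = \sum_(0 <= t < n) F (b - t%:Z).
Proof.
move=> hP; have inj : injective (fun t : nat => b - t%:Z) by move=> x y h; lia.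
rewrite -(big_map (fun t : nat => b - t%:Z) predT F).
rewrite [RHS]fsbig_seq ?map_inj_uniq ?iota_uniq //.
apply: eq_fsbigl; apply/seteqP; split => p /=; rewrite hP.
  by move=> hp; apply/mapP; exists (absz (b - p)); [rewrite mem_index_iota; lia|lia].
by move=> /mapP[t]; rewrite mem_index_iota => ht ->; lia.
Qed.

Lemma fsbig_windows (V : zmodType) (a b : V) (F G : int -> V) (m : nat) : (0 < m)%N ->
  a + b - \sum_(p \in [set p : int | - m%:Z + 2 <= p <= m%:Z - 1]%classic) F p
    + \sum_(p \in [set p : int | - m%:Z + 2 <= p <= 0]%classic) G p =
  a + b - \sum_(0 <= t < m.-1 + m.-1) F (m%:Z - 1 - t%:Z) + \sum_(0 <= t < m.-1) G (0 - t%:Z).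
Proof.
move=> m0; rewrite (@fsbig_int_interval _ _ _ (m%:Z - 1) (m.-1 + m.-1)%N); last by move=> p; lia.
by rewrite (@fsbig_int_interval _ _ _ 0 m.-1); last by move=> p; lia.
Qed.

Lemma sum_last2 (V : zmodType) (N : nat) (H : nat -> V) : (2 < N)%N ->
  \sum_(1 <= b < N.+1) H b = \sum_(0 <= i < N.-2) H i.+1 + H N.-1 + H N.
Proof. by case: N => [|[|n]] // _; rewrite big_add1 /= !big_nat_recr. Qed.

Lemma sum_last1 (V : zmodType) (N : nat) (H : nat -> V) : (0 < N)%N ->
  \sum_(1 <= b < N.+1) H b = \sum_(0 <= i < N.-1) H i.+1 + H N.
Proof. by case: N => [|n] // _; rewrite big_add1 /= big_nat_recr. Qed.

(** * The image of R_m *)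

Section Correction.
Context (K : numFieldType) (N : nat) (N3 : (2 < N)%N) (eps1 eps2 : K).
Local Notation Z := 'Z_N.
Local Notation Y := (Yangian N eps1 eps2).
Local Notation Yx := (Yx eps1 eps2).
Local Notation slX := (@slX K N).
Local Notation Emx := (@Emx K N).
Context (A : pzRingType) (phi : {rmorphism K -> A}).
Hypothesis phiC : forall k x, phi k * x = x * phi k.
Context (c : K) (nul : (nat -> A) -> Prop) (e : int -> int -> A).
Hypothesis eP : affine_family phi N c nul e.
Context (iota : Usl K N -> Y) (iotaP : is_sl_map iota) (g : Y -> A) (gP : algebra_map phi g).
Hypothesis g_root_p : forall i : Z, g (Yx true i 0) = root_p e (rep i).
Hypothesis g_root_m : forall i : Z, g (Yx false i 0) = root_m e (rep i).
Implicit Types (a b k l p : int) (i j t : nat).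
Local Notation f := (fun x => g (iota x)).

Lemma iota_map : algebra_map phi f.
Proof.
have [[lin [i1 iM]] _ _] := iotaP.
have iD x y : iota (x + y) = iota x + iota y.
  by have := lin 1 x y; rewrite (scale1r x) (scale1r (iota x)).
have i0 : iota 0 = 0.
  by apply: (addIr (iota 0)); rewrite -iD (addr0 (0 : Usl K N)) (add0r (iota 0)).
have iZ (a : K) x : iota (a *: x) = a *: iota x.
  by have := lin a x 0; rewrite (addr0 (a *: x)) i0 addr0.
split=> [x y|x y||a x].
- rewrite -scaleN1r iD iZ scaleN1r; exact: (map_zmod gP).
- by rewrite iM (map_mul gP).
- by rewrite i1 (map_one gP).
by rewrite iZ (map_scale gP).
Qed.

Lemma iota_root_p (i : Z) : f (chev_x slX true i) = root_p e (rep i).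
Proof. by have [_ h _] := iotaP; rewrite h. Qed.

Lemma iota_root_m (i : Z) : f (chev_x slX false i) = root_m e (rep i).
Proof. by have [_ h _] := iotaP; rewrite h. Qed.

Lemma af_eq (x y x' y' : int) k : x != y -> x' = x + N%:Z * k -> y' = y + N%:Z * k -> e x' y' = e x y.
Proof. by move=> ne -> ->; exact: (af_shift_neq eP). Qed.

Lemma iota_Emx i j k l (x y p : int) : (1 <= i < N.+1)%N -> (1 <= j < N.+1)%N -> i != j ->
  x = i%:Z + N%:Z * k -> y = j%:Z + N%:Z * l -> p = l - k ->
  g (iota (slX (Emx i j) p)) = e x y.
Proof.
move=> hi hj ij -> -> ->.
rewrite (f_Emx N3 eP iota_map iota_root_p iota_root_m (l - k) hi hj ij).
have ne : i%:Z != j%:Z + N%:Z * (l - k).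
  by apply/eqP => E; have := mulN_small N3 (t := j%:Z - i%:Z) (k := l - k); lia.
by rewrite -(af_shift_neq eP k ne); congr e; lia.
Qed.

Lemma g_Tw (i : Z) m y : good y -> Tops_ok phi e (Tw_word i m) (g y) ->
  g (Tw (wgt_elt i m) y) = Tops phi e (Tw_word i m) (g y).
Proof. by move=> hy hT; have [_ ->] := map_Tword gP g_root_p g_root_m hy hT. Qed.

Variables (m : nat) (m0 : (0 < m)%N).
Local Notation Pq := (Pq N e m).
Local Notation Vq := (Vq N e m).
Local Notation Xq := (Xq N e m).
Local Notation Wq := (Wq N e m).

(** By [w_perm0] and [w_perm1] each summand is a term of [Wq N.-1] up to the sign (-1)^(m-1), which
    the prefactor removes. *)
Lemma g_sum_Tw :
  (-1) ^+ m.-1 * \sum_(i : Z) g (Yx true i 0) * g (Tw (wgt_elt i m) (Yx true (i - 1) 0)) = Wq N.-1 (-1).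
Proof.
rewrite (sum_Zp N3 _ 2) -(@sum_Pq_shift _ _ _ _ N3 _ _ _ eP m m0 N.-1 (-1) 2) //; last lia.
rewrite [RHS]big_add1 /= mulr_sumr; apply: eq_big_nat => x hx.
have -> : (2 + x%:Z)%:~R = (x.+1%:Z + 1)%:~R :> Z by congr intmul; lia.
have -> : (x.+1%:Z + 1)%:~R - 1 = x.+1%:Z%:~R :> Z by rewrite rmorphD addrK.
have gx : g (Yx true (x.+1%:Z%:~R) 0) = e x.+1%:Z (x.+1%:Z + 1).
  by rewrite g_root_p (root_p_rep N3 eP).
have [ok E] := Tops_e phiC N3 eP (Tw_word (x.+1%:Z + 1)%:~R m) x.+1%:Z (x.+1%:Z + 1).
rewrite -gx in ok E; rewrite (g_Tw (@good_x _ _ _ _ true _ 0 isT) ok) E.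
rewrite (Tw_word_signs N3 _ m0); have [w _] := Tw_wordP N3 (x.+1%:Z + 1)%:~R m.
rewrite !w (w_perm0 N3 _ m0) (w_perm1 N3 _ m0).
rewrite g_root_p (root_p_rep N3 eP) /root_p -[(-1) ^+ m.-1]signr_odd.
have -> : Pq (x.+1%:Z + 2%:Z) (x.+1%:Z + 2%:Z + N.-1%:Z + N%:Z * (-1)) =
    e (x.+1%:Z + 1) (x.+1%:Z + 1 + 1) * e (x.+1%:Z + 2 - N%:Z * m%:Z) (x.+1%:Z + 1).
  by rewrite /Pq; congr (e _ _ * e _ _); lia.
by case: odd; rewrite ?expr0 ?expr1 ?mul1r // !mulN1r mulrN opprK.
Qed.

(** The term that R_m writes separately is the one whose index wraps past N; in cyclic indexing it
    is the term b = N. In [sum_W2] two terms wrap. *)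
Lemma sum_W1 p :
  g (iota (slX (Emx 1 N) (p - 1))) * g (iota (slX (Emx N 1) (m%:Z - p + 1)))
  + \sum_(0 <= i < N.-1) g (iota (slX (Emx i.+2 i.+1) p)) * g (iota (slX (Emx i.+1 i.+2) (m%:Z - p)))
  = Wq 1 (- p).
Proof.
rewrite /Wq sum_last1; last lia.
rewrite [LHS]addrC; congr (_ + _); first apply: eq_big_nat => i hi.
  rewrite (@iota_Emx i.+2 i.+1 (- p) 0 (i.+1%:Z + 1%:Z + N%:Z * - p) i.+1%:Z); try lia.
  by rewrite (@iota_Emx i.+1 i.+2 (- m%:Z) (- p) (i.+1%:Z - N%:Z * m%:Z) (i.+1%:Z + 1%:Z + N%:Z * - p)) //; lia.
rewrite (@iota_Emx 1 N (1 - p) 0 (N%:Z + 1%:Z + N%:Z * - p) N%:Z); try lia.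
by rewrite (@iota_Emx N 1 (- m%:Z) (1 - p) (N%:Z - N%:Z * m%:Z) (N%:Z + 1%:Z + N%:Z * - p)) //; lia.
Qed.

Lemma sum_W2 p :
  g (iota (slX (Emx 1 N.-1) (p - 1))) * g (iota (slX (Emx N.-1 1) (m%:Z - p + 1)))
  + g (iota (slX (Emx 2 N) (p - 1))) * g (iota (slX (Emx N 2) (m%:Z - p + 1)))
  + \sum_(0 <= i < N.-2) g (iota (slX (Emx i.+3 i.+1) p)) * g (iota (slX (Emx i.+1 i.+3) (m%:Z - p)))
  = Wq 2 (- p).
Proof.
rewrite /Wq sum_last2 // [LHS]addrC [LHS]addrA; congr (_ + _ + _); first apply: eq_big_nat => i hi.
- rewrite (@iota_Emx i.+3 i.+1 (- p) 0 (i.+1%:Z + 2%:Z + N%:Z * - p) i.+1%:Z); try lia.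
  by rewrite (@iota_Emx i.+1 i.+3 (- m%:Z) (- p) (i.+1%:Z - N%:Z * m%:Z) (i.+1%:Z + 2%:Z + N%:Z * - p)) //; lia.
- rewrite (@iota_Emx 1 N.-1 (1 - p) 0 (N.-1%:Z + 2%:Z + N%:Z * - p) N.-1%:Z); try lia.
  by rewrite (@iota_Emx N.-1 1 (- m%:Z) (1 - p) (N.-1%:Z - N%:Z * m%:Z) (N.-1%:Z + 2%:Z + N%:Z * - p)) //; lia.
rewrite (@iota_Emx 2 N (1 - p) 0 (N%:Z + 2%:Z + N%:Z * - p) N%:Z); try lia.
by rewrite (@iota_Emx N 2 (- m%:Z) (1 - p) (N%:Z - N%:Z * m%:Z) (N%:Z + 2%:Z + N%:Z * - p)) //; lia.
Qed.

(** Both modes p and m - p are positive, so no diagonal entry of the family is met and all shifts by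
    N are free of c. *)
Lemma sum_VX :
  \sum_(1 <= p < m) \sum_(1 <= i < N) \sum_(i <= j < N)
    g (iota (slX (Emx i i - Emx i.+1 i.+1) p%:Z)) * g (iota (slX (Emx j j - Emx j.+1 j.+1) (m%:Z - p%:Z))) =
  \sum_(1 <= j < N.+1) \sum_(0 <= t < m.-1) Vq (j%:Z + 1) (- m%:Z + 1 + t%:Z)
  - \sum_(1 <= j < N.+1) \sum_(0 <= t < m.-1) Xq (j%:Z + 1) (- m%:Z + 1 + t%:Z).
Proof.
pose d (i p : nat) := e i%:Z (i%:Z + N%:Z * p%:Z).
transitivity (\sum_(1 <= p < m) \sum_(1 <= i < N) \sum_(i <= j < N)
    (d i p - d i.+1 p) * (d j (m - p)%N - d j.+1 (m - p)%N)).
  apply: eq_big_nat => p hp; apply: eq_big_nat => i hi; apply: eq_big_nat => j hj.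
  rewrite !(f_cartan N3 eP iota_map iota_root_p iota_root_m); [|lia|lia].
  by rewrite /d -subzn //; lia.
rewrite cartan_sum; [|lia| |].
- transitivity (\sum_(1 <= p < m) \sum_(1 <= b < N.+1) (Vq b%:Z (- p%:Z) - Xq b%:Z (- p%:Z))).
    apply: eq_big_nat => p hp; apply: eq_big_nat => b hb; rewrite /Vq /Pq /Xq /d.
    rewrite (@af_eq (b%:Z + N%:Z * - p%:Z) b%:Z b%:Z _ p%:Z); [|by apply/eqP; nia|lia|lia].
    rewrite (@af_eq (b%:Z - N%:Z * m%:Z) (b%:Z + N%:Z * - p%:Z) b%:Z _ m%:Z); [|by apply/eqP; nia|lia|nia].
    by rewrite (@af_eq (b%:Z + 1 - N%:Z * m%:Z) (b%:Z + 1 + N%:Z * - p%:Z) b.+1%:Z _ m%:Z);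
      [|by apply/eqP; nia|lia|nia].
  rewrite -sumrB; under [RHS]eq_bigr do rewrite -sumrB.
  rewrite [RHS]exchange_big_nat /= [RHS]big_nat_rev big_add1; apply: eq_big_nat => p hp.
  have -> : - m%:Z + 1 + (0 + m.-1 - p.+1)%N%:Z = - p.+1%:Z by lia.
  rewrite -(@sum_period_shift A N N3 (fun b => Vq b (- p.+1%:Z) - Xq b (- p.+1%:Z))) // => b.
  congr (_ - _).
    rewrite /Vq -(@PqDN _ _ _ _ N3 _ _ _ eP m m0 b); try by apply/eqP; nia.
    by congr Pq; lia.
  rewrite /Xq; congr (_ * _); apply: (@af_eq _ _ _ _ 1); try lia; by apply/eqP; nia.
- move=> i j p q ij hi hj; apply/eqP; rewrite -subr_eq0; apply/eqP.
  have ne (i' j' : nat) k : i' != j' -> (1 <= i' < N.+1)%N -> (1 <= j' < N.+1)%N ->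
      ((i'%:Z + N%:Z * k)%:~R == j'%:Z%:~R :> Z) = false.
    move=> ij' hi' hj'; rewrite (Zp_intDN N3); apply/negbTE/(Zp_neqP N3) => l E.
    by have := mulN_small N3 (t := i'%:Z - j'%:Z) (k := - l); lia.
  rewrite -/(commr (d i p) (d j q)) (af_bracket eP) ne // [i%:Z%:~R == _]eq_sym ne ?subr0 //.
  by rewrite eq_sym.
move=> p p0; rewrite /d; apply: (@af_eq _ _ _ _ 1); try lia; by apply/eqP; nia.
Qed.

(** The map [g] is abstract because it is instantiated twice: by ev, and by ev after omega with
    values in the opposite ring. *)
Lemma g_R_elt : g (R_elt iota m) = Rq N e m.
Proof.
apply: (etrans (congr1 g (fsbig_windows _ _ _ _ m0))).
rewrite (mapD gP) (mapD gP) (mapD gP) (mapN gP) (map_scale gP) /Rq.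
have -> : phi ((-1) ^+ m.-1) = (-1) ^+ m.-1 by rewrite rmorphXn rmorphN1.
rewrite [RHS]addrAC [X in _ = X + _]addrAC.
congr (_ + _ - _ + _).
- rewrite (map_sum gP) -g_sum_Tw; congr (_ * _); apply: eq_bigr => i _; exact: (map_mul gP).
- rewrite (map_sum gP) -sum_VX; apply: eq_bigr => p _; rewrite (map_sum gP).
  apply: eq_bigr => i _; rewrite (map_sum gP); apply: eq_bigr => j _; exact: (map_mul gP).
- rewrite (map_sum gP); apply: eq_bigr => t _; rewrite (mapD gP) (map_mul gP) (map_sum gP).
  have -> : - m%:Z + 1 + t%:Z = - (m%:Z - 1 - t%:Z) by lia.
  by rewrite -sum_W1; congr (_ + _); apply: eq_bigr => i _; exact: (map_mul gP).
rewrite (map_sum gP); apply: eq_bigr => t _.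
have -> : Wq 2 t%:Z = Wq 2 (- (0 - t%:Z)) by congr Wq; lia.
rewrite -sum_W2; apply: (etrans (mapD gP _ _)); apply: (f_equal2 +%R).
  by apply: (etrans (mapD gP _ _)); apply: (f_equal2 +%R); exact: (map_mul gP).
by apply: (etrans (map_sum gP _ _ _)); apply: eq_bigr => i _; exact: (map_mul gP).
Qed.

End Correction.

Lemma sum_matrix_unit (K : numFieldType) (N : nat) (N3 : (2 < N)%N) :
  \sum_(1 <= b < N.+1) Emx K N b b = 1%:M.
Proof.
rewrite mx1_sum_delta (sum_Zp N3 _ 1) big_add1; apply: eq_bigr => k _.
by rewrite (_ : 1 + k%:Z = k.+1%:Z).
Qed.

(** * Commutators with translated root vectors *)

Section TranslatedRootVectors.
Context (K : numFieldType) (N : nat) (N3 : (2 < N)%N) (eps1 eps2 : K).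
Local Notation Z := 'Z_N.
Local Notation Y := (Yangian N eps1 eps2).
Local Notation Yx := (Yx eps1 eps2).
Local Notation Yh := (Yh eps1 eps2).
Local Notation hbar := (eps1 + eps2).
Context (A : pzRingType) (phi : {rmorphism K -> A}).
Hypothesis phiC : forall k x, phi k * x = x * phi k.
Context (c : K) (nul : (nat -> A) -> Prop) (e : int -> int -> A).
Hypothesis nulP : null_sequences nul.
Hypothesis eP : affine_family phi N c nul e.
Context (g : Y -> A) (gP : algebra_map phi g).
Hypothesis g_root_p : forall i : Z, g (Yx true i 0) = root_p e (rep i).
Hypothesis g_root_m : forall i : Z, g (Yx false i 0) = root_m e (rep i).
Implicit Types (j m n l : nat) (b : bool).
Local Notation w m j := (w_perm ((j%:Z + 1)%:~R : Z) m).

(** The two orders of j and j + 1 serve x^+ and x^-; the sign is symmetric in them. *)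
Lemma g_Tw_quad b m j (x y : int) : (0 < m)%N ->
  (x == j%:Z) && (y == j%:Z + 1) || (x == j%:Z + 1) && (y == j%:Z) ->
  (exists S, nul (fun n => quad N e (fun l => j%:Z - l%:Z) x y n - S) /\
    g (Yx b j%:R 1) = phi (1 + j%:R * eps2) * e x y + phi hbar * S) ->
  exists S, nul (fun n => quad N e (fun l => w m j (j%:Z - l%:Z)) (w m j x) (w m j y) n - S) /\
    (-1) ^+ m.-1 * g (Tw (wgt_elt (j%:Z + 1)%:~R m) (Yx b j%:R 1)) =
    phi (1 + j%:R * eps2) * e (w m j x) (w m j y) + phi hbar * S.
Proof.
move=> m0 xy [S [hS E]].
have [ok [S' hS' E']] := Tops_quad phiC N3 nulP eP (Tw_word (j%:Z + 1)%:~R m) (1 + j%:R * eps2) hbar hS.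
have [hw _] := Tw_wordP N3 (j%:Z + 1)%:~R m.
exists S'; split.
  apply: (@nul_ext A nul _ _ _ hS') => n; rewrite !hw; congr (_ - _); rewrite /quad.
  by apply: eq_bigr => l _ /=; rewrite hw.
rewrite -E in ok E'; rewrite (g_Tw gP g_root_p g_root_m (@good_x _ _ _ _ b _ 1 isT) ok) E' !hw.
have sE : word_sign (@Tw_word N (j%:Z + 1)%:~R m) x (+) word_sign (@Tw_word N (j%:Z + 1)%:~R m) y = odd m.-1.
  have h := Tw_word_signs N3 j%:Z m0.
  by case/orP: xy => /andP[/eqP -> /eqP ->] //; rewrite addbC.
rewrite sE.
by rewrite -[(-1) ^+ m.-1]signr_odd signrMK.
Qed.

Lemma sum_shift_Z (F : Z -> A) : \sum_(i : Z) F i = \sum_(1 <= j < N.+1) F (j%:Z + 1)%:~R.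
Proof.
rewrite (sum_Zp N3 F 2) big_add1; apply: eq_bigr => k _.
by congr (F (intmul _ _)); lia.
Qed.

Lemma Zp_pred_shift j : (j%:Z + 1)%:~R - 1 = j%:R :> Z.
Proof. by rewrite rmorphD addrK. Qed.

Lemma commr_sign n (u v : A) : (-1) ^+ n * commr u v = commr u ((-1) ^+ n * v).
Proof.
rewrite -signr_odd; case: odd; rewrite ?expr0 ?expr1 ?mul1r // !mulN1r /commr.
by rewrite mulrN mulNr opprB addrC opprK.
Qed.

Lemma pos_commutators m : (0 < m)%N -> hbar * c = N%:R * eps2 ->
  (forall j, (1 <= j < N.+1)%N ->
    exists S, nul (fun n => quad N e (fun l => j%:Z - l%:Z) j%:Z (j%:Z + 1) n - S) /\
    g (Yx true j%:R 1) = phi (1 + j%:R * eps2) * e j%:Z (j%:Z + 1) + phi hbar * S) ->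
  (-1) ^+ m.-1 * \sum_(i : Z) commr (g (Yx true i 0)) (g (Tw (wgt_elt i m) (Yx true (i - 1) 1))) =
  phi eps2 * (\sum_(1 <= b < N.+1) Dg N e m b%:Z) + phi hbar * Rq N e m.
Proof.
move=> m0 hc hE.
pose P j (s : A) := (1 <= j < N.+1)%N ->
    nul (fun n => quad N e (fun l => w m j (j%:Z - l%:Z)) (w m j j%:Z) (w m j (j%:Z + 1)) n - s) /\
    (-1) ^+ m.-1 * g (Tw (wgt_elt (j%:Z + 1)%:~R m) (Yx true j%:R 1)) =
    phi (1 + j%:R * eps2) * e (w m j j%:Z) (w m j (j%:Z + 1)) + phi hbar * s.
(* One limit is chosen for every j, with value 0 outside 1 <= j <= N. *)
have [j|S hS] := @boolp.choice nat A P.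
  rewrite /P.
  have [hj|_] := boolP (1 <= j < N.+1)%N; last by exists 0.
  have xy : (j%:Z == j%:Z) && (j%:Z + 1 == j%:Z + 1) || (j%:Z == j%:Z + 1) && (j%:Z + 1 == j%:Z).
    by rewrite !eqxx.
  by have [s hs] := g_Tw_quad m0 xy (hE j hj); exists s.
rewrite sum_shift_Z mulr_sumr.
rewrite -(@main_pos _ _ _ phiC _ N3 _ _ _ nulP eP m m0 eps2 hbar S hc) => [|j hj].
  apply: eq_big_nat => j hj; have [_ E] := hS j hj.
  rewrite commr_sign Zp_pred_shift E (w_perm0 N3 _ m0) (w_perm1 N3 _ m0).
  by rewrite g_root_p (root_p_rep N3 eP).
by have [h _] := hS j hj; rewrite (w_perm0 N3 _ m0) (w_perm1 N3 _ m0) in h.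
Qed.

Local Notation eo := (fun a b : int => e b a : A^c).
Local Notation phio := (@op_scalar K A phi).

(** In the opposite ring x_i^- is the vector [root_p] of the transposed family, the commutator
    changes its order, and [quad] with its outer indices exchanged is the same element. So
    [main_pos] applies. *)
Lemma neg_commutators m : (0 < m)%N -> hbar * c = N%:R * eps2 ->
  (forall j, (1 <= j < N.+1)%N ->
    exists S, nul (fun n => quad N e (fun l => j%:Z - l%:Z) (j%:Z + 1) j%:Z n - S) /\
    g (Yx false j%:R 1) = phi (1 + j%:R * eps2) * e (j%:Z + 1) j%:Z + phi hbar * S) ->
  (-1) ^+ m.-1 * \sum_(i : Z) commr (g (Tw (wgt_elt i m) (Yx false (i - 1) 1))) (g (Yx false i 0)) =
  phio eps2 * (\sum_(1 <= b < N.+1) Dg N eo m b%:Z) + phio hbar * Rq N eo m :> A^c.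
Proof.
move=> m0 hc hE.
pose P j (s : A) := (1 <= j < N.+1)%N ->
    nul (fun n => quad N e (fun l => w m j (j%:Z - l%:Z)) (w m j (j%:Z + 1)) (w m j j%:Z) n - s) /\
    (-1) ^+ m.-1 * g (Tw (wgt_elt (j%:Z + 1)%:~R m) (Yx false j%:R 1)) =
    phi (1 + j%:R * eps2) * e (w m j (j%:Z + 1)) (w m j j%:Z) + phi hbar * s.
have [j|S hS] := @boolp.choice nat A P.
  rewrite /P.
  have [hj|_] := boolP (1 <= j < N.+1)%N; last by exists 0.
  have xy : (j%:Z + 1 == j%:Z) && (j%:Z == j%:Z + 1) || (j%:Z + 1 == j%:Z + 1) && (j%:Z == j%:Z).
    by rewrite !eqxx orbT.
  by have [s hs] := g_Tw_quad m0 xy (hE j hj); exists s.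
apply: (etrans _ (@main_pos _ _ phio (op_scalarC phiC) _ N3 _ _ _ (null_sequences_op nulP)
  (affine_family_op N3 nulP eP) m m0 eps2 hbar S hc _)) => [|j hj].
  rewrite sum_shift_Z mulr_sumr; apply: eq_big_nat => j hj; have [_ E] := hS j hj.
  rewrite (w_perm0 N3 _ m0) (w_perm1 N3 _ m0) in E.
  rewrite commr_anti mulrN commr_sign -commr_anti Zp_pred_shift E.
  rewrite g_root_m (root_m_rep N3 eP) (phiC (1 + _)) (phiC hbar).
  exact: erefl.
have [h _] := hS j hj; rewrite (w_perm0 N3 _ m0) (w_perm1 N3 _ m0) in h.
exact: h.
Qed.

Lemma g_h1 (i : Z) : g (Yh i 1) = commr (g (Yx true i 1)) (g (Yx false i 0)).
Proof. by rewrite -(map_commr gP) Y_xx eqxx. Qed.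

Lemma g_h0 j : g (Yh (j%:R : Z) 0) = e j%:Z j%:Z - e (j%:Z + 1) (j%:Z + 1).
Proof.
have -> : Yh (j%:R : Z) 0 = commr (Yx true j%:R 0) (Yx false j%:R 0) by rewrite Y_xx eqxx.
rewrite (map_commr gP) g_root_p g_root_m (root_p_rep N3 eP j%:Z) (root_m_rep N3 eP j%:Z).
by rewrite (af_bracket eP) !eqxx !addrK.
Qed.

(** h_{i,1} is reached as the commutator of x_{i,1}^+ and x_{i,0}^-. *)
Lemma zero_cartan : hbar * c = N%:R * eps2 ->
  (forall j, (1 <= j < N.+1)%N ->
    exists S, nul (fun n => quad N e (fun l => j%:Z - l%:Z) j%:Z (j%:Z + 1) n - S) /\
    g (Yx true j%:R 1) = phi (1 + j%:R * eps2) * e j%:Z (j%:Z + 1) + phi hbar * S) ->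
  \sum_(i : Z) g (Yht1 eps1 eps2 i) =
  phi (c + hbar / 2 * c ^+ 2) + phi eps2 * (\sum_(1 <= b < N.+1) e b%:Z b%:Z).
Proof.
move=> hc hE.
pose P j (s : A) := (1 <= j < N.+1)%N ->
    nul (fun n => quad N e (fun l => j%:Z - l%:Z) j%:Z (j%:Z + 1) n - s) /\
    g (Yx true j%:R 1) = phi (1 + j%:R * eps2) * e j%:Z (j%:Z + 1) + phi hbar * s.
have [j|S hS] := @boolp.choice nat A P.
  rewrite /P; have [hj|_] := boolP (1 <= j < N.+1)%N; last by exists 0.
  by have [s hs] := hE j hj; exists s.
rewrite -(@main_zero _ _ _ phiC _ N3 _ _ _ nulP eP eps2 hbar S hc) => [|j hj]; last first.
  by have [] := hS j hj.
rewrite (sum_Zp N3 _ 1) big_add1; apply: eq_big_nat => k hk.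
have -> : (1 + k%:Z)%:~R = k.+1%:R :> Z by [].
have [_ E] := hS k.+1 hk; rewrite /Yht1.
rewrite (mapD gP) (mapN gP) (map_scale gP) expr2 (map_mul gP) -expr2 g_h0 g_h1 E.
by rewrite g_root_m (root_m_rep N3 eP k.+1%:Z).
Qed.

End TranslatedRootVectors.

(** * The values of ev on a_m *)

Section EvaluationOfCartan.
Context (K : numFieldType) (N : nat) (N3 : (2 < N)%N) (eps1 eps2 c : K).
Local Notation Z := 'Z_N.
Local Notation Y := (Yangian N eps1 eps2).
Local Notation Yx := (Yx eps1 eps2).
Local Notation Yh := (Yh eps1 eps2).
Local Notation hbar := (eps1 + eps2).
Local Notation UC := (Ucomp N c).
Local Notation phi := (uc_scalar N c).
Local Notation phio := (@op_scalar K UC phi).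
Local Notation ucX := (@ucX K N c).
Local Notation Emx := (@Emx K N).
Local Notation e := (@e_comp K N c).
Local Notation eo := (fun a b : int => e b a : UC^c).
Context (omega : Y -> Y) (iota : Usl K N -> Y) (ev : Y -> UC).
Hypothesis omegaP : is_omega omega.
Hypothesis iotaP : is_sl_map iota.
Hypothesis evP : is_evaluation ev.
Hypothesis hc : hbar * c = N%:R * eps2.
Hypothesis eps2_neq0 : eps2 != 0.

Lemma canon_one (k : int) : \sum_(1 <= b < N.+1) ucX (Emx b b) k = canon (glX c 1%:M k).
Proof.
rewrite -(sum_matrix_unit K N3).
by rewrite -(big_morph (fun X => ucX X k) (fun X X' => ucXD c X X' k) (ucX0 N c k)).
Qed.

Lemma ev_omega_map : algebra_map phio (fun y => ev (omega y) : UC^c).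
Proof.
have [[lin o1 oM] _ _] := omegaP; have gP := ev_map evP.
have oD x y : omega (x + y) = omega x + omega y.
  by have := lin 1 x y; rewrite (scale1r x) (scale1r (omega x)).
have o0 : omega 0 = 0.
  by apply: (addIr (omega 0)); rewrite -oD (addr0 (0 : Y)) (add0r (omega 0)).
have oZ (a : K) x : omega (a *: x) = a *: omega x.
  apply: (etrans (congr1 omega (esym (addr0 (a *: x))))).
  by apply: (etrans (lin a x 0)); rewrite o0; exact: addr0.
split=> [x y|x y||a x].
- apply: (etrans (congr1 ev (_ : omega (x - y) = omega x - omega y))); last exact: (map_zmod gP).
  by rewrite -scaleN1r oD oZ scaleN1r.
- by rewrite oM; exact: (map_mul gP).
- by rewrite o1; exact: (map_one gP).
rewrite oZ; apply: (etrans (map_scale gP a (omega x))).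
exact: uc_scalarC.
Qed.

Lemma scalar_cancel (u v : UC) : phi eps2^-1 * (phi eps2 * u + v - v) = u.
Proof.
rewrite addrK mulrA.
have -> : phi eps2^-1 * phi eps2 = 1 by rewrite -rmorphM mulVf // rmorph1.
exact: mul1r.
Qed.

Lemma scalar_sign n : phi ((-1) ^+ n) = (-1) ^+ n.
Proof. by rewrite rmorphXn rmorphN1. Qed.

Lemma ev_a_pos n : ev (a_elt c omega iota n.+1%:Z) = canon (glX c 1%:M n.+1%:Z).
Proof.
have gP := ev_map evP; rewrite /a_elt.
have -> : (-1) ^ (n.+1%:Z - 1) = (-1) ^+ n :> K.
  by rewrite (_ : n.+1%:Z - 1 = n%:Z) //; lia.
apply: (etrans (map_scale gP _ _)).
apply: (etrans (congr1 (fun u => phi eps2^-1 * u) _)); last first.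
  apply: (etrans (scalar_cancel (\sum_(1 <= b < N.+1) Dg N e n.+1 b%:Z) (phi hbar * Rq N e n.+1))).
  rewrite -canon_one; apply: eq_big_nat => b hb.
  by rewrite /Dg -[X in e _ X]addr0 -(mulr0 N%:Z) -mulrN e_compE ?opprK ?add0r //; apply/orP; left; apply/eqP; nia.
apply: (etrans (mapD gP _ _)); apply: (f_equal2 +%R); last first.
  apply: (etrans (mapN gP _)); congr (- _); apply: (etrans (map_scale gP _ _)); congr (_ * _).
  exact: (g_R_elt N3 (@uc_scalarC K N c) (e_comp_family N3 c) iotaP gP
    (ev_root_p N3 evP) (ev_root_m N3 evP)).
apply: (etrans (map_scale gP _ _)).
rewrite -(@pos_commutators K N N3 eps1 eps2 UC phi (@uc_scalarC K N c) c _ _ (uc_nullP N3 c)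
  (e_comp_family N3 c) ev gP (ev_root_p N3 evP) (ev_root_m N3 evP) n.+1 isT hc (ev_xp N3 evP)).
rewrite scalar_sign; congr (_ * _).
apply: (etrans (map_sum gP _ _ _)); apply: eq_bigr => i _; exact: (map_commr gP).
Qed.

Lemma ev_a_zero : ev (a_elt c omega iota 0) = canon (glX c 1%:M 0).
Proof.
have gP := ev_map evP; rewrite /a_elt.
apply: (etrans (map_scale gP _ _)).
apply: (etrans (congr1 (fun u => phi eps2^-1 * u) _)); last first.
  apply: (etrans (scalar_cancel (\sum_(1 <= b < N.+1) e b%:Z b%:Z) (phi (c + hbar / 2 * c ^+ 2)))).
  rewrite -canon_one; apply: eq_big_nat => b hb.
  by have := e_compE0 N3 c 0 hb hb; rewrite mulr0 (addr0 b%:Z).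
apply: (etrans (mapD gP _ _)); apply: (f_equal2 +%R); last first.
  apply: (etrans (mapN gP _)); congr (- _); apply: (etrans (map_scale gP _ _)).
  by rewrite (map_one gP); exact: mulr1.
apply: (etrans (map_sum gP _ _ _)).
rewrite addrC; exact: (zero_cartan N3 (@uc_scalarC K N c) (uc_nullP N3 c) (e_comp_family N3 c) gP
  (ev_root_p N3 evP) (ev_root_m N3 evP) hc (ev_xp N3 evP)).
Qed.

(** omega exchanges x^+ and x^-, which matches the exchange of [root_p] and [root_m] under
    transposition of the family. *)
Lemma ev_omega_R n : ev (omega (R_elt iota n.+1)) = @Rq UC^c N eo n.+1.
Proof.
have [_ ox _] := omegaP.
have op (i : Z) : ev (omega (Yx true i 0)) = @root_p UC^c eo (rep i).
  by rewrite ox; exact: (ev_root_m N3 evP).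
have om (i : Z) : ev (omega (Yx false i 0)) = @root_m UC^c eo (rep i).
  by rewrite ox; exact: (ev_root_p N3 evP).
exact: (g_R_elt N3 (op_scalarC (@uc_scalarC K N c))
  (affine_family_op N3 (uc_nullP N3 c) (e_comp_family N3 c)) iotaP ev_omega_map op om).
Qed.

Lemma ev_a_neg n : ev (a_elt c omega iota (Negz n)) = canon (glX c 1%:M (Negz n)).
Proof.
have gP := ev_map evP; rewrite /a_elt.
(* Here m = -(n + 1), and m - 1 = -(n + 2) has the parity of n = |m| - 1. *)
have -> : (-1) ^ (Negz n - 1) = (-1) ^+ n :> K.
  have -> : Negz n - 1 = Negz n.+1 by rewrite !NegzE; lia.
  by rewrite /exprz -exprVn invrN invr1 !exprS !mulN1r opprK.
apply: (etrans (map_scale gP _ _)).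
apply: (etrans (congr1 (fun u => phi eps2^-1 * u) _)); last first.
  apply: (etrans (scalar_cancel (\sum_(1 <= b < N.+1) @Dg UC^c N eo n.+1 b%:Z)
    (phi hbar * @Rq UC^c N eo n.+1))).
  rewrite -canon_one; apply: eq_big_nat => b hb.
  apply: (etrans (congr1 (e b%:Z) (_ : b%:Z - N%:Z * n.+1%:Z = b%:Z + N%:Z * Negz n))).
    by rewrite NegzE mulrN.
  exact: e_compE0.
apply: (etrans (mapD gP _ _)); apply: (f_equal2 +%R); last first.
  apply: (etrans (mapN gP _)); congr (- _); apply: (etrans (map_scale gP _ _)); congr (_ * _).
  exact: ev_omega_R.
apply: (etrans (map_scale gP _ _)).
have E := @neg_commutators K N N3 eps1 eps2 UC phi (@uc_scalarC K N c) c _ _ (uc_nullP N3 c)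
  (e_comp_family N3 c) ev gP (ev_root_p N3 evP) (ev_root_m N3 evP) n.+1 isT hc (ev_xm N3 evP).
apply: etrans (etrans E _); last by apply: (f_equal2 +%R); apply: esym; exact: uc_scalarC.
apply: (f_equal2 (@GRing.mul UC)); first exact: scalar_sign.
by apply: (etrans (map_sum gP _ _ _)); apply: eq_bigr => i _; exact: (map_commr gP).
Qed.

Lemma ev_a (m : int) : ev (a_elt c omega iota m) = canon (glX c 1%:M m).
Proof. by case: m => [[|n]|n]; [exact: ev_a_zero|exact: ev_a_pos|exact: ev_a_neg]. Qed.

End EvaluationOfCartan.

(** * The image of ev *)

Section Image.
Context (K : numFieldType) (N : nat) (N3 : (2 < N)%N) (eps1 eps2 c : K).
Local Notation Y := (Yangian N eps1 eps2).
Local Notation UC := (Ucomp N c).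
Local Notation ucX := (@ucX K N c).
Local Notation Emx := (@Emx K N).
Context (omega : Y -> Y) (iota : Usl K N -> Y) (ev : Y -> UC).
Hypothesis omegaP : is_omega omega.
Hypothesis iotaP : is_sl_map iota.
Hypothesis evP : is_evaluation ev.
Hypothesis hc : (eps1 + eps2) * c = N%:R * eps2.
Hypothesis eps2_neq0 : eps2 != 0.
Implicit Types (u v : UC) (s : int) (i j : nat).

Definition in_image v := exists y, ev y = v.

Let gP := ev_map evP.

Lemma in_imageD u v : in_image u -> in_image v -> in_image (u + v).
Proof. by move=> [x <-] [y <-]; exists (x + y); exact: (mapD gP). Qed.

Lemma in_imageM u v : in_image u -> in_image v -> in_image (u * v).
Proof. by move=> [x <-] [y <-]; exists (x * y); exact: (map_mul gP). Qed.

Lemma in_imageZ (a : K) v : in_image v -> in_image (a *: v).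
Proof.
move=> [y <-]; exists (a *: y); apply: (etrans (map_scale gP a y)); exact: uc_scalarE.
Qed.

Lemma in_image0 : in_image 0. Proof. by exists 0; exact: (map0 gP). Qed.

Lemma in_image1 : in_image 1. Proof. by exists 1; exact: (map_one gP). Qed.

Lemma in_imageB u v : in_image u -> in_image v -> in_image (u - v).
Proof. by move=> hu hv; rewrite -scaleN1r; apply: in_imageD hu _; exact: in_imageZ. Qed.

Lemma in_image_unit i j s : (1 <= i < N.+1)%N -> (1 <= j < N.+1)%N -> i != j ->
  in_image (ucX (Emx i j) s).
Proof.
move=> hi hj ij; exists (iota (slX (Emx i j) s)).
rewrite -(e_compE0 N3 c s hi hj).
exact: (f_Emx N3 (e_comp_family N3 c) (iota_map iotaP gP)
  (iota_root_p iotaP (ev_root_p N3 evP)) (iota_root_m iotaP (ev_root_m N3 evP)) s hi hj ij).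
Qed.

Lemma in_image_cartan i s : (1 <= i < N)%N -> in_image (ucX (Emx i i) s - ucX (Emx i.+1 i.+1) s).
Proof.
move=> hi; exists (iota (slX (Emx i i - Emx i.+1 i.+1) s)).
have h1 : (1 <= i < N.+1)%N by lia.
have h2 : (1 <= i.+1 < N.+1)%N by lia.
rewrite -(e_compE0 N3 c s h1 h1) -(e_compE0 N3 c s h2 h2).
exact: (f_cartan N3 (e_comp_family N3 c) (iota_map iotaP gP)
  (iota_root_p iotaP (ev_root_p N3 evP)) (iota_root_m iotaP (ev_root_m N3 evP)) s hi).
Qed.

(** The differences of diagonal units come from sl_N; adding their sum 1(s), the image of a_s, gives
    N E_{1,1}(s), and N is invertible. *)
Lemma in_image_diag i s : (1 <= i < N.+1)%N -> in_image (ucX (Emx i i) s).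
Proof.
pose D j := ucX (Emx j j) s.
have d1 j : (1 <= j < N.+1)%N -> in_image (D 1%N - D j).
  elim: j => // j IH hj; have [->|j0] := eqVneq j 0%N.
    by rewrite subrr; exact: in_image0.
  rewrite -(subrKA (D j)); apply: in_imageD; first by apply: IH; lia.
  by apply: in_image_cartan; lia.
have hD : in_image (N%:R *: D 1%N).
  have -> : N%:R *: D 1%N = \sum_(1 <= j < N.+1) (D 1%N - D j) + \sum_(1 <= j < N.+1) D j.
    by rewrite -big_split /= (eq_bigr (fun=> D 1%N)) => [|j _]; rewrite ?subrK // sumr_const_nat subn1 scaler_nat.
  apply: in_imageD; last by rewrite (canon_one N3); exists (a_elt c omega iota s); exact: ev_a.
  rewrite big_seq; apply: (big_ind in_image in_image0 in_imageD) => j.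
  by rewrite mem_index_iota; exact: d1.
have D1 : in_image (D 1%N).
  have := in_imageZ N%:R^-1 hD; rewrite scalerA mulVf ?scale1r // pnatr_eq0; lia.
move=> hi; rewrite -/(D i) -(subKr (D 1%N) (D i)); apply: in_imageB D1 _; exact: d1.
Qed.

Lemma in_image_ucX X s : in_image (ucX X s).
Proof.
have sumX (I : finType) (F : I -> 'M[K]_((Zp_trunc N).+2)) :
    (forall k, in_image (ucX (F k) s)) -> in_image (ucX (\sum_i F i) s).
  move=> hF; apply: (big_ind (fun X => in_image (ucX X s))) => [|X1 X2 h1 h2|k _]; last exact: hF.
    by rewrite ucX0; exact: in_image0.
  by rewrite ucXD; exact: in_imageD.
rewrite [X]matrix_sum_delta; apply: (sumX _ _) => i; apply: (sumX _ _) => j.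
have -> : X i j *: delta_mx i j = X i j *: delta_mx i j + 0 by rewrite addr0.
rewrite ucX_linear ucX0 addr0; apply: in_imageZ.
have [k hk ->] := Zp_ge1 N3 i; have [l hl ->] := Zp_ge1 N3 j.
have [<-|kl] := eqVneq k l; first exact: in_image_diag.
exact: in_image_unit.
Qed.

Lemma in_image_canon (u : Ugl N c) : in_image (canon u).
Proof.
elim/presW: u => x.
rewrite /canon (pr_lift_pi (@uc_scalarC K N c) (@canon_rels K N c)) /free_lift.
apply: (big_ind in_image in_image0 in_imageD) => m _.
apply: in_imageM; first by apply: in_imageZ; exact: in_image1.
apply: (big_ind in_image in_image1 in_imageM) => -[X s|] _ /=.
  by rewrite -canonX; exact: in_image_ucX.
by apply: in_imageZ; exact: in_image1.
Qed.

End Image.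

Theorem theorem4p17 (R : realType) (N : nat) (eps1 eps2 c : R[i])
    (omega : Yangian N eps1 eps2 -> Yangian N eps1 eps2)
    (iota : Usl R[i] N -> Yangian N eps1 eps2)
    (ev : Yangian N eps1 eps2 -> Ucomp N c) :
  (3 <= N)%N ->
  (eps1 + eps2) * c = N%:R * eps2 ->
  eps2 != 0 ->
  is_omega omega ->
  is_sl_map iota ->
  is_evaluation ev ->
  (forall m : int, ev (a_elt c omega iota m) = canon (glX c 1%:M m))
  /\ (forall u : Ugl N c, exists y : Yangian N eps1 eps2, ev y = canon u).
Proof.
move=> N3 hc eps2_neq0 omegaP iotaP evP; split.
  exact: (ev_a N3 omegaP iotaP evP hc eps2_neq0).
exact: (in_image_canon N3 omegaP iotaP evP hc eps2_neq0).
Qed.
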